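(* Let $\Omega\subset\mathbf R^2$ be a bounded domain with smooth boundary such that $|\Omega|=|B_1|=\pi$, where $|\Omega|$ denotes the area of $\Omega$ and $B_1$ is the unit ball in $\mathbf R^2$. Then $$E_{8\pi}(\Omega)\ge E_{8\pi}(B_1),$$ and equality holds if and only if $\Omega=B_1$.
   Context: For a bounded smooth domain $\Omega\subset\mathbf R^2$ and $u\in H^1_0(\Omega)$ define $$I_{8\pi}(u,\Omega)=\frac{1}{16\pi}\int_\Omega|\nabla u|^2-\ln\left(\frac{1}{|\Omega|}\int_\Omega e^u\right),$$ and $E_{8\pi}(\Omega)=\inf_{u\in H^1_0(\Omega)}I_{8\pi}(u,\Omega)$.
   Formalization: The equality case is stated as: equality holds if and only if Ω is a unit disk with some centre (Ω = B_1 up to translation), since E_{8π} is translation invariant and so a translated unit disk also gives equality. *)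

(* Defs.v *)
From HB Require Import structures.
From mathcomp Require Import all_boot all_order all_algebra.
From mathcomp Require Import all_classical all_reals all_analysis.
Set Implicit Arguments. Unset Strict Implicit. Unset Printing Implicit Defensive.
Import Order.TTheory GRing.Theory Num.Theory.
Import numFieldNormedType.Exports.
Local Open Scope classical_set_scope.
Local Open Scope ring_scope.

Section Defs.
Variable R : realType.
Implicit Types (f : R * R -> R) (Om : set (R * R)).

Definition leb2 := ((@lebesgue_measure R) \x (@lebesgue_measure R))%E.

Definition edir (b : bool) : R * R := if b then (0, 1) else (1, 0).

Definition pderiv (b : bool) f : R * R -> R := fun x => 'D_(edir b) f x.

Definition pderivs (s : seq bool) f : R * R -> R := foldr pderiv f s.

Definition smooth f : Prop :=
  forall s : seq bool, continuous (pderivs s f) /\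
    forall (b : bool) (x : R * R), derivable (pderivs s f) x (edir b).

Definition disk (c : R * R) (r : R) : set (R * R) :=
  [set x | (x.1 - c.1) ^+ 2 + (x.2 - c.2) ^+ 2 < r ^+ 2].

(* bounded domain (open, connected, bounded) with smooth boundary,
   given by a global defining function rho: Om = {rho < 0}, grad rho <> 0 on {rho = 0} *)
Definition smooth_bounded_domain Om : Prop :=
  [/\ open Om, connected Om, Om !=set0,
      (exists M : R, Om `<=` disk (0, 0) M) &
      exists rho : R * R -> R, [/\ smooth rho, Om = [set x | rho x < 0] &
        forall x, rho x = 0 -> (pderiv false rho x, pderiv true rho x) != 0]].

Definition Cc_inf Om f : Prop :=
  smooth f /\ exists K, [/\ compact K, K `<=` Om & forall x, ~ K x -> f x = 0].

Definition L2dist2 Om (f g : R * R -> R) : \bar R :=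
  (\int[leb2]_(x in Om) ((f x - g x) ^+ 2)%:E)%E.

(* (u, g1, g2) with u in H^1_0(Om) and (g1, g2) its weak gradient:
   u is the H^1 limit of a sequence of C_c^infinity(Om) functions *)
Definition H10 Om (u g1 g2 : R * R -> R) : Prop :=
  [/\ [/\ measurable_fun Om u, measurable_fun Om g1 & measurable_fun Om g2],
      [/\ leb2.-integrable Om (fun x => (u x ^+ 2)%:E),
        leb2.-integrable Om (fun x => (g1 x ^+ 2)%:E) &
        leb2.-integrable Om (fun x => (g2 x ^+ 2)%:E)] &
      exists phi : nat -> R * R -> R, (forall n, Cc_inf Om (phi n)) /\
        [/\ (fun n => L2dist2 Om (phi n) u) @ \oo --> 0%E,
            (fun n => L2dist2 Om (pderiv false (phi n)) g1) @ \oo --> 0%E &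
            (fun n => L2dist2 Om (pderiv true (phi n)) g2) @ \oo --> 0%E]].

Definition eln (x : \bar R) : \bar R :=
  match x with
  | r%:E => (ln r)%:E
  | +oo%E => +oo%E
  | -oo%E => -oo%E
  end.

Definition I8pi Om (u g1 g2 : R * R -> R) : \bar R :=
  ((16 * pi)^-1%:E * \int[leb2]_(x in Om) (g1 x ^+ 2 + g2 x ^+ 2)%:E
   - eln ((fine (leb2 Om))^-1%:E * \int[leb2]_(x in Om) (expR (u x))%:E))%E.

Definition E8pi Om : \bar R :=
  ereal_inf [set y | exists u g1 g2, H10 Om u g1 g2 /\ y = I8pi Om u g1 g2].
End Defs.

(* Main.v *)
Require Import Defs.
From HB Require Import structures.
From mathcomp Require Import all_boot all_order all_algebra.
From mathcomp Require Import all_classical all_reals all_analysis.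
From mathcomp Require Import measurable_realfun.
From mathcomp Require Import ring lra.
Set Implicit Arguments. Unset Strict Implicit. Unset Printing Implicit Defensive.
Import Order.TTheory GRing.Theory Num.Theory.
Import numFieldNormedType.Exports.
Local Open Scope classical_set_scope.
Local Open Scope ring_scope.

(** The infimum on a unit disk is -1.  Let [u >= 0] be C^1 with compact support [K] in [Om], let [chi] be a cutoff
    between [K] and [Om], and let [T = (T1 x, T2 (x, y))] be the Knothe rearrangement that transports
    [chi exp u dx] onto [(1+e)^2 / (|y|^2+e)^2 dy] on the unit disk, [e] being fixed by the total mass.  With
    [d = sqrt (det DT)], the change of variables computes [int d^2], [int exp(u/2) d] and [int exp u |T|^2]
    exactly.  Integrating [div T >= 2 d] against [exp(u/2) - 1] by parts and applying Young's inequality to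
    [grad u . T] gives [int |grad u|^2 / (16 pi) - ln z + 1 - 1/z >= 0] with [pi z = int chi exp u], up to three
    nonnegative deficits; this is the lower bound -1 for the functional, and it passes to H^1_0 by density.

    Rigidity is quantitative: when the deficits are small, the profile [W = (1+e)(1 - exp(-u/2))] almost
    satisfies [grad W = - 2 T] and [T] is almost a translation on the support of [W], so [W] is close to
    [1 - |x - c|^2]; hence [int_Om ((1 - |x-c|^2)^+)^2] is close to its maximum [pi/3].  Compactness in [c] makes
    it equal to [pi/3] for some [c] unless the functional stays away from -1, and then [Om] is a unit disk up to
    a null set, hence exactly, by the regularity of the boundary.

    On the disk the value -1 is approached by smoothly truncated Liouville bubbles. *)

(** No minimiser is at hand: the bubbles concentrate ([e] tends to 0) as their value tends to -1.
    Equality can therefore not be read off an optimal [u], and rigidity has to be a bound on the gap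
    that is uniform in [u].

    The Knothe map is built from one-dimensional monotone maps. Its derivative is triangular with
    nonnegative diagonal, so [div T >= 2 d] is the arithmetic-geometric mean inequality, and
    integration by parts is done line by line without regularity theory. The price is that the
    dependence of [T2] on [x] is uncontrolled, so only [T1] is shown to be nearly a translation. The
    other coordinate comes from the map built in the opposite order; the two estimates meet in [W],
    which depends on [u] and [e] alone.

    The target is the Liouville bubble: for [u = 2 ln ((1+e) / (|x|^2+e))] on the disk the identity
    is the transport and the three deficits vanish.

    The cutoff [chi] makes the transported density continuous on the plane, positive on [K] and zero
    off [Om]. It loses mass at most [pi], which is paid for by [1 - (1 - 1/z) = 1/z]. *)

Section BoundedIntegral.
Context d (T : measurableType d) (R : realType) (mu : {measure set T -> \bar R}).
Variable D : set T.
Hypothesis mD : measurable D.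
Hypothesis fD : (mu D < +oo)%E.

(** On a set of finite measure this class consists of integrable functions and, unlike
    integrability, it is stable under products; [bm_auto] then settles integrability by syntax. The
    bound is asked on [D] only, so that the coordinate functions qualify. *)
Definition bm (f : T -> R) : Prop :=
  measurable_fun setT f /\ exists C, forall x, D x -> `|f x| <= C.

Lemma bm_cst (c : R) : bm (fun=> c).
Proof. by split; [exact: measurable_cst|exists `|c|]. Qed.

Lemma bmD f g : bm f -> bm g -> bm (fun x => f x + g x).
Proof.
move=> [mf [A fA]] [mg [B gB]]; split; first exact: measurable_funD.
by exists (A + B) => x Dx; rewrite (le_trans (ler_normD _ _))// lerD// ?fA ?gB.
Qed.

Lemma bmN f : bm f -> bm (fun x => - f x).
Proof.
move=> [mf [A fA]]; split; first exact: measurableT_comp.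
by exists A => x Dx; rewrite normrN fA.
Qed.

Lemma bmB f g : bm f -> bm g -> bm (fun x => f x - g x).
Proof. by move=> bf bg; apply: bmD => //; exact: bmN. Qed.

Lemma bmM f g : bm f -> bm g -> bm (fun x => f x * g x).
Proof.
move=> [mf [A fA]] [mg [B gB]]; split; first exact: measurable_funM.
by exists (A * B) => x Dx; rewrite normrM ler_pM// ?fA ?gB.
Qed.

Lemma bmX f n : bm f -> bm (fun x => f x ^+ n).
Proof.
move=> bf; elim: n => [|n IH]; first exact: bm_cst.
by under eq_fun do rewrite exprS; exact: bmM.
Qed.

Lemma bm_norm f : bm f -> bm (fun x => `|f x|).
Proof.
move=> [mf [A fA]]; split; first exact: measurableT_comp.
by exists A => x Dx; rewrite normr_id fA.
Qed.

Lemma bm_integrable f : bm f -> mu.-integrable D (EFin \o f).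
Proof.
move=> [mf [A fA]]; apply: measurable_bounded_integrable => //.
  exact: measurable_funS mf.
exists A; split => [|B AB x Dx /=]; first exact: num_real.
by rewrite (le_trans (fA x Dx))// ltW.
Qed.

Lemma bm_le_int f g : bm f -> bm g -> (forall x, D x -> f x <= g x) ->
  \int[mu]_(x in D) f x <= \int[mu]_(x in D) g x.
Proof. by move=> bf bg fg; apply: le_Rintegral => //; exact: bm_integrable. Qed.

Lemma bm_intD f g : bm f -> bm g ->
  \int[mu]_(x in D) (f x + g x) = \int[mu]_(x in D) f x + \int[mu]_(x in D) g x.
Proof. by move=> bf bg; apply: RintegralD => //; exact: bm_integrable. Qed.

Lemma bm_intB f g : bm f -> bm g ->
  \int[mu]_(x in D) (f x - g x) = \int[mu]_(x in D) f x - \int[mu]_(x in D) g x.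
Proof. by move=> bf bg; apply: RintegralB => //; exact: bm_integrable. Qed.

Lemma bm_intZ c f : bm f ->
  \int[mu]_(x in D) (c * f x) = c * \int[mu]_(x in D) f x.
Proof. by move=> bf; apply: RintegralZl => //; exact: bm_integrable. Qed.

Lemma bm_intE f : bm f ->
  (\int[mu]_(x in D) (f x)%:E = (\int[mu]_(x in D) f x)%:E)%E.
Proof.
by move=> bf; rewrite /Rintegral fineK//; apply: integrable_fin_num => //; exact: bm_integrable.
Qed.

End BoundedIntegral.

Ltac bm_auto := repeat first [assumption | exact: bm_cst | apply: bmX | apply: bmB | apply: bmD | apply: bmN | apply: bmM | apply: bm_norm].

(** * Borel sets of the plane in the product sigma-algebra *)

Section Plane.
Variable R : realType.
Implicit Types (A : set (R * R)) (f : R * R -> R).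

(** Measurability on [R * R] refers to the product of the two Borel structures; an open set is
    reached as a countable union of squares with rational centre and radius. *)
Lemma open_measurable2 A : open A -> measurable A.
Proof.
move=> oA.
pose box (q : rat * rat * rat) : set (R * R) :=
  (ball (ratr q.1.1 : R) (ratr q.2 : R)) `*` (ball (ratr q.1.2 : R) (ratr q.2 : R)).
have -> : A = \bigcup_q (if `[< box q `<=` A >] then box q else set0).
  apply/seteqP; split=> [[x y] Axy|z [q _]]; last by case: asboolP => // qA /qA.
  have /nbhs_ballP [e /= e0 eA] : nbhs (x, y) A by exact: open_nbhs_nbhs.
  have e4 : 0 < e / 4 by rewrite divr_gt0.
  have e42 : e / 4 < e / 2 by lra.
  (* The rational centre is taken within [e / 4] of the point and the radius between [e / 4] and
     [e / 2]: the square contains the point and stays within distance [e] of it. *)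
  have [r] := rat_in_itvoo e42; rewrite in_itv/= => /andP[r1 r2].
  have [|p] := @rat_in_itvoo _ (x - e / 4) (x + e / 4); first by lra.
  rewrite in_itv/= => p12.
  have [|q] := @rat_in_itvoo _ (y - e / 4) (y + e / 4); first by lra.
  rewrite in_itv/= => q12.
  exists (p, q, r) => //=; case: asboolP => [_|[]]; last first.
    move=> [x' y'] [/= hx hy]; apply: eA.
    move: hx hy; rewrite /ball/= => hx hy; split => /=; rewrite /ball/=.
      by move: hx; rewrite !ltr_norml => /andP[? ?]; lra.
    by move: hy; rewrite !ltr_norml => /andP[? ?]; lra.
  by split; rewrite /ball/= ltr_norml; lra.
apply: countable_bigcupT_measurable; first exact: countableP.
by move=> q; case: asboolP => // _; apply: measurableX; exact: measurable_ball.
Qed.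

Lemma closed_measurable2 A : closed A -> measurable A.
Proof. by move=> cA; rewrite -[A]setCK; apply: measurableC; apply: open_measurable2; exact: closed_openC. Qed.

Lemma continuous_measurable2 f : continuous f -> measurable_fun setT f.
Proof.
move=> cf; apply: (measurability _ (RGenOInfty.measurableE R)) => //.
move=> _ [_ [x ->] <-]; rewrite setTI; apply: open_measurable2.
by apply: open_comp => //; exact: interval_open.
Qed.

End Plane.

(** * Primitives and the fundamental theorem of calculus *)

Section Calculus1.
Variable R : realType.
Implicit Types f F : R -> R.

Lemma is_derive_continuous F f : (forall x : R, is_derive x (1:R) F (f x)) -> continuous F.
Proof.
by move=> dF x; apply: differentiable_continuous; apply/derivable1_diffP; apply: ex_derive.
Qed.

Lemma FTC2 F f (a b : R) : a <= b -> continuous f -> (forall x : R, is_derive x (1:R) F (f x)) ->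
  \int[lebesgue_measure]_(x in `[a, b]) f x = F b - F a.
Proof.
rewrite le_eqVlt => /predU1P[->|ab] cf dF.
  by rewrite set_itv1 Rintegral_set1 subrr.
have cF := is_derive_continuous dF.
rewrite /Rintegral (@continuous_FTC2 _ f F)//.
- exact: continuous_subspaceT.
- split=> [x _||]; first exact: ex_derive.
    by apply: cvg_at_right_filter; exact: cF.
  by apply: cvg_at_left_filter; exact: cF.
- by move=> x _; rewrite derive1E; apply: derive_val.
Qed.

(** The integral from a base point is differentiable only to the right of that point. Two such
    integrals based at -1, of [f] and of its reflection, both normalised at 0, agree on []-1, 1[]
    and are glued at 0. *)
Lemma primitive f : continuous f -> exists F : R -> R, forall x : R, is_derive x (1:R) F (f x).
Proof.
have loc (h : R -> R) : continuous h -> exists2 F : R -> R, F 0 = 0 & forall x : R, -1 < x -> is_derive x (1:R) F (h x).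
  move=> ch.
  have intf (a b : R) : lebesgue_measure.-integrable `[a, b] (EFin \o h).
    by apply: continuous_compact_integrable; [exact: segment_compact|exact: continuous_subspaceT].
  pose P (x : R) := \int[lebesgue_measure]_(t in `[-1, x]) h t.
  exists (fun x => P x - P 0) => [|x ax]; first by rewrite subrr.
  have xx1 : x < x + 1 by lra.
  have [h1 h2] := @continuous_FTC1 _ h (BLeft (-1)) x (x + 1) xx1 (intf _ _) ax (ch x).
  have dP : is_derive x (1:R) P (h x) by split; [exact: h1|rewrite -derive1E; exact: h2].
  by apply: is_derive_eq; rewrite subr0.
move=> cf.
have [F1 F10 dF1] := loc _ cf.
have [|F2 F20 dF2] := loc (fun x => f (- x)).
  by move=> x; apply: continuous_comp; [exact: opp_continuous|exact: cf].
have dF2' (x : R) : x < 1 -> is_derive x (1:R) (fun y => - F2 (- y)) (f x).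
  move=> x1.
  have dN : is_derive x (1:R) -%R (-1) by apply: is_deriveN.
  have d2 : is_derive (- x) (1:R) F2 (f x) by rewrite -[x in f x]opprK; apply: dF2; lra.
  have := @is_derive1_comp _ F2 -%R x _ _ d2 dN => dc.
  by apply: is_derive_eq; rewrite mulrN1 opprK.
have E (x : R) : -1 < x -> x < 1 -> F1 x = - F2 (- x).
  move=> x1 x2; apply/eqP; rewrite -subr_eq0; apply/eqP.
  pose K (y : R) := F1 y - - F2 (- y).
  have dK (y : R) : -1 < y -> y < 1 -> is_derive y (1:R) K 0.
    move=> y1 y2; have := dF1 _ y1 => d1; have := dF2' _ y2 => d2.
    by apply: is_derive_eq; rewrite subrr.
  have K0 : K 0 = 0 by rewrite /K F10 oppr0 F20 oppr0 subr0.
  have cK (a b : R) : -1 < a -> b < 1 -> {within `[a, b], continuous K}.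
    move=> a1 b1; apply: derivable_within_continuous => y.
    rewrite in_itv/= => /andP[ay yb]; have ? := dK y (lt_le_trans a1 ay) (le_lt_trans yb b1).
    exact: ex_derive.
  have [x0|x0|->//] := ltgtP x 0.
  - have [||c cI] := @MVT _ K (fun=> 0) x 0 x0.
      by move=> y; rewrite in_itv/= => /andP[? ?]; apply: dK; lra.
      exact: (cK _ _ x1 ltr01).
    by rewrite K0 mul0r sub0r => /eqP; rewrite oppr_eq0 => /eqP.
  - have [||c cI] := @MVT _ K (fun=> 0) 0 x x0.
      by move=> y; rewrite in_itv/= => /andP[? ?]; apply: dK; lra.
      exact: (cK _ _ (ltrN10 R) x2).
    by rewrite K0 mul0r subr0.
exists (fun x => if 0 <= x then F1 x else - F2 (- x)) => x.
have [x0|x0] := leP 0 x.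
  apply: (@near_eq_is_derive _ _ _ F1); rewrite ?oner_neq0//; last by apply: dF1; lra.
  near=> y; have y1 : -1 < y by near: y; apply: lt_nbhsr; lra.
  by case: leP => // y0; apply/E => //; lra.
apply: (@near_eq_is_derive _ _ _ (fun x => - F2 (- x))); rewrite ?oner_neq0//; last by apply: dF2'; lra.
near=> y; have y1 : y < 0 by near: y; apply: lt_nbhsl; lra.
by rewrite leNgt y1.
Unshelve. all: by end_near. Qed.

End Calculus1.

(** * Monotone transport on the line *)

Section Transport1.
Variables (R : realType) (a b : R) (g r G Rc : R -> R).
Hypotheses (ab : a < b) (cg : continuous g) (g0 : forall y, 0 <= g y)
  (cr : continuous r) (r0 : forall s, a < s < b -> 0 < r s)
  (dG : forall y : R, is_derive y (1:R) G (g y))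
  (dR : forall s : R, is_derive s (1:R) Rc (r s))
  (Gab : forall y, Rc a <= G y <= Rc b).

Let cG : continuous G.
Proof. by move=> x; apply: differentiable_continuous; apply/derivable1_diffP; apply: ex_derive. Qed.
Let cRc : continuous Rc.
Proof. by move=> x; apply: differentiable_continuous; apply/derivable1_diffP; apply: ex_derive. Qed.

Lemma target_cdf_mono s s' : a <= s -> s' <= b -> s < s' -> Rc s < Rc s'.
Proof.
move=> as1 sb ss.
have [c] := MVT ss (fun x _ => dR x) (continuous_subspaceT cRc).
rewrite in_itv/= => /andP[sc cs] E; rewrite -subr_gt0 E mulr_gt0// ?subr_gt0//.
by apply: r0; rewrite (le_lt_trans as1 sc) (lt_le_trans cs sb).
Qed.

(** [g] and [r] are the source and target densities, [G] and [Rc] their primitives. The target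
    density is positive on the open interval only, because the chord masses to which this is applied
    vanish at both ends. *)
Lemma transport_exists : exists T : R -> R, forall y, a <= T y <= b /\ Rc (T y) = G y.
Proof.
suff h y : exists s, a <= s <= b /\ Rc s = G y by have [T TP] := boolp.choice h; exists T.
have [||s sI E] := @IVT _ Rc a b (G y) (ltW ab).
- exact: continuous_subspaceT.
- have RR : Rc a <= Rc b by apply/ltW/target_cdf_mono.
  by rewrite min_l// max_r.
- by exists s; move: sI; rewrite in_itv.
Qed.

Variable T : R -> R.
Hypothesis Tab : forall y, a <= T y <= b.
Hypothesis RT : forall y, Rc (T y) = G y.

(** A Galois connection between [T] and [Rc]: through it, monotonicity and continuity of [T] are
    read off from [G]. *)
Lemma transport_le y s : a <= s -> s <= b -> (T y <= s) = (G y <= Rc s).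
Proof.
move=> as1 sb; have /andP[aT Tb] := Tab y; rewrite -RT.
apply/idP/idP; last by apply: contraTT; rewrite -!ltNge; exact: target_cdf_mono.
by rewrite le_eqVlt => /predU1P[->//|ts]; apply/ltW/target_cdf_mono.
Qed.

Lemma transport_homo y y' : y <= y' -> T y <= T y'.
Proof.
move=> yy; have /andP[aT Tb] := Tab y'; rewrite transport_le// RT.
move: yy; rewrite le_eqVlt => /predU1P[->//|yy].
have [c _ E] := MVT yy (fun x _ => dG x) (continuous_subspaceT cG).
by rewrite -subr_ge0 E mulr_ge0// subr_ge0 ltW.
Qed.

Lemma transport_continuous : continuous T.
Proof.
move=> y; apply/cvgrPdist_lt => e e0; have /andP[aT Tb] := Tab y.
have L : \forall z \near y, T y - e < T z.
  have [h|h] := ltP (T y - e) a.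
    by near=> z; have /andP[aTz _] := Tab z; exact: lt_le_trans h aTz.
  have GR : Rc (T y - e) < G y by rewrite -RT; apply: target_cdf_mono => //; lra.
  have H : \forall z \near y, Rc (T y - e) < G z by apply: (cvgr_gt _ (@cG y)).
  near=> z; rewrite ltNge transport_le//; last by lra.
  by rewrite -ltNge; near: z.
have U : \forall z \near y, T z < T y + e.
  have [h|h] := ltP b (T y + e).
    by near=> z; have /andP[_ Tzb] := Tab z; exact: le_lt_trans Tzb h.
  have GR : G y < Rc (T y + e / 2).
    by rewrite -RT; apply: target_cdf_mono => //; lra.
  have H : \forall z \near y, G z < Rc (T y + e / 2) by apply: (cvgr_lt _ (@cG y)).
  near=> z; apply: (@le_lt_trans _ _ (T y + e / 2)); last by lra.
  rewrite transport_le; [|lra|lra].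
  by apply/ltW; near: z.
near=> z; rewrite distrC ltr_distl; apply/andP; split; by near: z.
Unshelve. all: by end_near. Qed.

(** When [T y] is an end of the target interval, [G] has a global extremum at [y], so its derivative
    vanishes there. *)
Lemma transport_edge y : ~ (a < T y < b) -> g y = 0.
Proof.
move=> h; have /andP[aT Tb] := Tab y.
have dG' t : t \in `](y - 1), (y + 1)[ -> derivable G t (1:R) by move=> _; exact: ex_derive.
have yI : y \in `](y - 1), (y + 1)[ by rewrite in_itv/=; lra.
have y11 : y - 1 < y + 1 by lra.
have dy := dG y.
have [Ta|Ta] := leP (T y) a.
  have -> := esym (@derive_val _ _ _ _ _ _ _ dy).
  apply: derive_val; apply: (@derive1_at_min _ G (y - 1) (y + 1) _ (ltW y11)) => // t _.
  have -> : G y = Rc a by rewrite -RT; congr Rc; lra.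
  by have /andP[] := Gab t.
have [Tb'|Tb'] := leP b (T y); last by case: h; rewrite Ta.
have -> := esym (@derive_val _ _ _ _ _ _ _ dy).
apply: derive_val; apply: (@derive1_at_max _ G (y - 1) (y + 1) _ (ltW y11)) => // t _.
have -> : G y = Rc b by rewrite -RT; congr Rc; lra.
by have /andP[] := Gab t.
Qed.

(** Caratheodory's form of differentiability: the slope of [T] is the slope of [G] divided by that
    of [Rc] taken along [T], and it is continuous because [T] is. *)
Lemma transport_derive y : a < T y < b -> is_derive y (1:R) T (g y / r (T y)).
Proof.
move=> Ty; have rT := r0 Ty.
have [phi [phiE cphi phiy]] : exists phi : R -> R, [/\ forall z, Rc z - Rc (T y) = phi z * (z - T y),
    {for T y, continuous phi} & phi (T y) = r (T y)] by apply/is_derive1_caratheodory; exact: dR.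
have [psi [psiE cpsi psiy]] : exists psi : R -> R, [/\ forall z, G z - G y = psi z * (z - y),
    {for y, continuous psi} & psi y = g y] by apply/is_derive1_caratheodory; exact: dG.
have cphiT : (phi \o T) z @[z --> y] --> r (T y).
  by rewrite -phiy; apply: (@continuous_comp _ _ _ T phi y); [exact: transport_continuous|exact: cphi].
have nz : \forall z \near y, phi (T z) != 0.
  have H : \forall z \near y, 0 < phi (T z) by apply: (cvgr_gt _ cphiT).
  by near=> z; apply: lt0r_neq0; near: z.
have key : \forall z \near y, T z - T y = psi z / phi (T z) * (z - y).
  near=> z; have n0 : phi (T z) != 0 by near: z.
  have := phiE (T z); rewrite !RT psiE => e.
  by rewrite mulrAC e mulrC mulKf.
pose q z := if z == y then g y / r (T y) else (T z - T y) / (z - y).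
apply/is_derive1_caratheodory; exists q; split.
- move=> z; rewrite /q; case: eqVneq => [->|zy]; first by rewrite !subrr mulr0.
  by rewrite divfK// subr_eq0.
- have q0 : q y = psi y / r (T y) by rewrite /q eqxx psiy.
  change (q z @[z --> y] --> q y); rewrite q0.
  have c1 : psi z / phi (T z) @[z --> y] --> psi y / r (T y).
    apply: cvgM; first exact: cpsi.
    by apply: cvgV => //; exact: lt0r_neq0.
  apply: cvg_trans c1; apply: near_eq_cvg; near=> z; rewrite /q.
  case: eqVneq => [->|zy]; first by rewrite phiy psiy.
  have -> : T z - T y = psi z / phi (T z) * (z - y) by near: z.
  by rewrite mulfK// subr_eq0.
- by rewrite /q eqxx.
Unshelve. all: by end_near. Qed.

Section PushForward.
Variables (hr N : R -> R) (C : R).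
Hypotheses (chr : continuous hr) (hrC : forall s, a <= s <= b -> `|hr s| <= C * r s)
  (dN : forall s : R, is_derive s (1:R) N (hr s)).

Lemma push_density_le z : `|g z * (hr (T z) / r (T z))| <= C * g z.
Proof.
have [h|/negP/transport_edge ->] := boolP (a < T z < b); last by rewrite !(mul0r, mulr0) normr0.
have rT := r0 h; rewrite normrM ger0_norm// mulrC ler_wpM2r//.
by rewrite normrM normfV (gtr0_norm rT) ler_pdivrMr// hrC.
Qed.

(** Both [C * Rc + N] and [C * Rc - N] are nondecreasing, since [hr] is dominated by [C * r]. *)
Lemma push_primitive_le s s' : a <= s -> s <= s' -> s' <= b -> `|N s' - N s| <= C * (Rc s' - Rc s).
Proof.
move=> as1; rewrite le_eqVlt => /predU1P[->|ss] sb; first by rewrite !subrr normr0 mulr0.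
have dA e (x : R) : is_derive x (1:R) (fun x => C * Rc x + e * N x) (C * r x + e * hr x).
  by have := dR x; have := dN x => h1 h2; apply: is_derive_eq.
have key e : `|e| <= 1 -> 0 <= C * (Rc s' - Rc s) + e * (N s' - N s).
  move=> e1; have [c] := MVT ss (fun x _ => dA e x) (continuous_subspaceT (@is_derive_continuous _ _ _ (dA e))).
  rewrite in_itv/= => /andP[sc cs] E.
  have -> : C * (Rc s' - Rc s) + e * (N s' - N s) = (C * r c + e * hr c) * (s' - s) by rewrite -E; ring.
  rewrite mulr_ge0// ?subr_ge0 ?(ltW ss)//.
  have h1 : `|hr c| <= C * r c by apply: hrC; rewrite (ltW (le_lt_trans as1 sc)) (ltW (lt_le_trans cs sb)).
  have h2 : `|e * hr c| <= `|hr c| by rewrite normrM ler_piMl.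
  by move: (le_trans h2 h1); rewrite ler_norml => /andP[? ?]; lra.
rewrite ler_norml; have := key 1; have := key (-1); rewrite normrN normr1 lexx => /(_ isT) ? /(_ isT) ?; lra.
Qed.

(** [N \o T] is differentiable even where [T] may fail to be. At the ends of the target interval the
    increments of [N \o T] are at most [C] times those of [G], and [G] has derivative 0 there. *)
Lemma push_derive y : is_derive y (1:R) (N \o T) (g y * (hr (T y) / r (T y))).
Proof.
have [h|nh] := boolP (a < T y < b).
  have dT := transport_derive h; have dNT := dN (T y).
  have := @is_derive1_comp _ N T y _ _ dNT dT => dc.
  by apply: is_derive_eq; rewrite mulrCA.
have gy : g y = 0 by apply: transport_edge; exact/negP.
rewrite gy mul0r.
have [psi [psiE cpsi psiy]] : exists psi : R -> R, [/\ forall z, G z - G y = psi z * (z - y),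
    {for y, continuous psi} & psi y = g y] by apply/is_derive1_caratheodory; exact: dG.
pose q z := if z == y then 0 else (N (T z) - N (T y)) / (z - y).
have Nle z : `|N (T z) - N (T y)| <= C * `|G z - G y|.
  have /andP[a1 b1] := Tab z; have /andP[a2 b2] := Tab y.
  have [zy|yz] := leP (T z) (T y).
    have := push_primitive_le a1 zy b2; rewrite -!RT distrC => /le_trans; apply.
    have [<-|tt] := eqVneq (T z) (T y); first by rewrite subrr normr0.
    have lt1 : T z < T y by rewrite lt_neqAle tt.
    by rewrite distrC ger0_norm// subr_ge0 ltW// target_cdf_mono.
  have := push_primitive_le a2 (ltW yz) b1; rewrite -!RT => /le_trans; apply.
  by rewrite ger0_norm// subr_ge0 ltW// target_cdf_mono.
apply/is_derive1_caratheodory; exists q; split.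
- move=> z; rewrite /q /=; case: eqVneq => [->|zy]; first by rewrite !subrr mulr0.
  by rewrite divfK// subr_eq0.
- have q0 : q y = 0 by rewrite /q eqxx.
  change (q z @[z --> y] --> q y); rewrite q0; apply/norm_cvg0P.
  have c0 : C * `|psi z| @[z --> y] --> 0.
    rewrite -[0](mulr0 C); apply: cvgM; first exact: cvg_cst.
    have cp : psi z @[z --> y] --> (0 : R) by rewrite -gy -psiy; exact: cpsi.
    exact/norm_cvg0P.
  apply: (@squeeze_cvgr _ _ _ _ (fun=> 0) (fun z => C * `|psi z|)) => //; last exact: cvg_cst.
  near=> z; rewrite normr_ge0/= /q; case: eqVneq => [->|zy].
    by rewrite normr0 psiy gy normr0 mulr0.
  have zy0 : 0 < `|z - y| by rewrite normr_gt0 subr_eq0.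
  by rewrite normrM normfV ler_pdivrMr// -mulrA -normrM -psiE.
- by rewrite /q eqxx.
Unshelve. all: by end_near. Qed.

Lemma push_continuous : continuous (fun y => g y * (hr (T y) / r (T y))).
Proof.
move=> y; have [h|nh] := boolP (a < T y < b).
  apply: cvgM; first exact: cg.
  apply: cvgM.
    by apply: (@continuous_comp _ _ _ T hr y); [exact: transport_continuous|exact: chr].
  apply: cvgV; first by apply: lt0r_neq0; exact: r0.
  by apply: (@continuous_comp _ _ _ T r y); [exact: transport_continuous|exact: cr].
have gy : g y = 0 by apply: transport_edge; exact/negP.
rewrite /continuous_at gy mul0r; apply/norm_cvg0P.
have c0 : C * g z @[z --> y] --> 0.
  by rewrite -[0](mulr0 C) -gy; apply: cvgM; [exact: cvg_cst|exact: cg].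
apply: (@squeeze_cvgr _ _ _ _ (fun=> 0) (fun z => C * g z)) => //; last exact: cvg_cst.
by near=> z; rewrite normr_ge0/= push_density_le.
Unshelve. all: by end_near. Qed.

Lemma push_forward c d : c <= d -> T c = a -> T d = b ->
  \int[lebesgue_measure]_(y in `[c, d]) (g y * (hr (T y) / r (T y))) =
  \int[lebesgue_measure]_(s in `[a, b]) hr s.
Proof.
move=> cd Tc Td; rewrite (FTC2 cd push_continuous push_derive) /= Tc Td.
by rewrite (FTC2 (ltW ab) chr dN).
Qed.

End PushForward.

Section ByParts.
Variables (f f' : R -> R) (K : set R).
Hypotheses (df : forall y : R, is_derive y (1:R) f (f' y)) (cf' : continuous f')
  (clK : closed K) (gK : forall y, K y -> 0 < g y) (fK : forall y, ~ K y -> f y = 0).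

Let off y : ~ K y -> \forall z \near y, f z = 0.
Proof.
move=> Ky; have : nbhs y (~` K) by apply: open_nbhs_nbhs; split=> //; exact: closed_openC.
by move=> nK; near=> z; apply: fK; near: z.
Unshelve. all: by end_near. Qed.

Let inK y : K y -> a < T y < b.
Proof. by move=> /gK gy; apply: contraPT (gt_eqF gy) => /negP/transport_edge ->; rewrite eqxx. Qed.

Let cf : continuous f.
Proof. by move=> x; apply: differentiable_continuous; apply/derivable1_diffP; apply: ex_derive. Qed.

(** On [K] the source density is positive, so [T] stays inside the open interval and is
    differentiable; off [K] the function [f] vanishes in a neighbourhood, and so does the product,
    whatever [T] does. *)
Lemma parts_derive y : is_derive y (1:R) (fun y => f y * T y) (f' y * T y + f y * (g y / r (T y))).
Proof.
have [Ky|Ky] := pselect (K y).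
  have dT := transport_derive (inK Ky); have d1 := df y.
  have := is_deriveM d1 dT => dd.
  rewrite [X in is_derive _ _ _ X](_ : _ = f y *: (g y / r (T y)) + T y *: f' y); first exact: dd.
  by rewrite /GRing.scale/=; ring.
have off0 := off Ky.
have f0 : f' y = 0.
  have d0 : is_derive y (1:R) f 0.
    by apply: (@near_eq_is_derive _ _ _ (fun=> 0)); near=> z; apply/esym; near: z.
  by have <- := @derive_val _ _ _ _ _ _ _ (df y); apply: derive_val.
rewrite f0 (fK Ky) !mul0r addr0.
apply: (@near_eq_is_derive _ _ _ (fun=> 0)); near=> z.
have -> : f z = 0 by near: z.
by rewrite mul0r.
Unshelve. all: by end_near. Qed.

Lemma parts_continuous : continuous (fun y => f' y * T y + f y * (g y / r (T y))).
Proof.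
move=> y; apply: cvgD.
  by apply: cvgM; [exact: cf'|exact: transport_continuous].
have [Ky|Ky] := pselect (K y).
  apply: cvgM; first exact: cf.
  apply: cvgM; first exact: cg.
  apply: cvgV; first by apply: lt0r_neq0; apply/r0/inK.
  by apply: (@continuous_comp _ _ _ T r y); [exact: transport_continuous|exact: cr].
have off0 := off Ky; rewrite (fK Ky) mul0r.
apply: cvg_near_cst; near=> z.
have -> : f z = 0 by near: z.
by rewrite mul0r.
Unshelve. all: by end_near. Qed.

Lemma transport_by_parts c d : c <= d -> ~ K c -> ~ K d ->
  \int[lebesgue_measure]_(y in `[c, d]) (f' y * T y + f y * (g y / r (T y))) = 0.
Proof.
move=> cd Kc Kd; rewrite (FTC2 cd parts_continuous parts_derive).
by rewrite (fK Kc) (fK Kd) !mul0r subrr.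
Qed.
End ByParts.
End Transport1.

(** * Radial integrals *)

Section FTC.
Variable R : realType.

Lemma FTC2in (F f : R -> R) (a b : R) : a <= b ->
  (forall x, a <= x <= b -> {for x, continuous f}) ->
  (forall x : R, a <= x <= b -> is_derive x (1:R) F (f x)) ->
  \int[lebesgue_measure]_(x in `[a, b]) f x = F b - F a.
Proof.
rewrite le_eqVlt => /predU1P[->|ab] cf dF.
  by rewrite set_itv1 Rintegral_set1 subrr.
have cF x : a <= x <= b -> {for x, continuous F}.
  move=> xab; have := dF x xab => dFx.
  by apply: differentiable_continuous; apply/derivable1_diffP; exact: ex_derive.
have aa : a <= a <= b by rewrite lexx ltW.
have bb : a <= b <= b by rewrite lexx ltW.
have W (h : R -> R) : (forall x, a <= x <= b -> {for x, continuous h}) -> {within `[a, b], continuous h}.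
  move=> ch; apply/continuous_within_itvP => //; split.
  - by move=> x; rewrite in_itv/= => /andP[? ?]; apply: ch; rewrite !ltW.
  - by apply: cvg_at_right_filter; exact: ch.
  - by apply: cvg_at_left_filter; exact: ch.
rewrite /Rintegral (@continuous_FTC2 _ f F)//.
- exact: W.
- split=> [x||].
  + by rewrite in_itv/= => /andP[? ?]; apply: ex_derive; apply: dF; rewrite !ltW.
  + by apply: cvg_at_right_filter; exact: cF.
  + by apply: cvg_at_left_filter; exact: cF.
- move=> x; rewrite in_itv/= => /andP[? ?]; rewrite derive1E; apply: derive_val.
  by apply: dF; rewrite !ltW.
Qed.
End FTC.

Section Radial.
Variable R : realType.
Local Notation mu := (@lebesgue_measure R).
Implicit Types c z : R * R.

Definition dist2 c z : R := (z.1 - c.1) ^+ 2 + (z.2 - c.2) ^+ 2.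

Lemma dist2_ge0 c z : 0 <= dist2 c z.
Proof. by rewrite addr_ge0// sqr_ge0. Qed.

Lemma dist2_continuous c : continuous (dist2 c).
Proof.
move=> z; apply: cvgD; rewrite /GRing.exp/=.
  by apply: cvgM; (apply: cvgB; [exact: cvg_fst|exact: cvg_cst]).
by apply: cvgM; (apply: cvgB; [exact: cvg_snd|exact: cvg_cst]).
Qed.

Lemma measurable_dist2 c : measurable_fun setT (dist2 c).
Proof. by apply: continuous_measurable2; exact: dist2_continuous. Qed.

(** Substitution [x = c + r sin t], carried out by composing a primitive with the new variable; the
    integrand becomes [2 r^2 (cos t)^2]. *)
Lemma half_disk_integral (c r : R) : 0 <= r ->
  \int[mu]_(x in `[c - r, c + r]) (2 * Num.sqrt (r ^+ 2 - (x - c) ^+ 2)) = pi * r ^+ 2.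
Proof.
move=> r0; pose h (x : R) := 2 * Num.sqrt (r ^+ 2 - (x - c) ^+ 2).
have ch : continuous h.
  move=> x; apply: cvgM; first exact: cvg_cst.
  apply: (@continuous_comp _ _ _ (fun x => r ^+ 2 - (x - c) ^+ 2) Num.sqrt); last exact: sqrt_continuous.
  apply: cvgB; first exact: cvg_cst.
  by rewrite /GRing.exp/=; apply: cvgM; (apply: cvgB; [exact: cvg_id|exact: cvg_cst]).
have [P dP] := primitive ch.
rewrite (FTC2 _ ch dP); last by lra.
pose k (t : R) := h (c + r * sin t) * (r * cos t).
have dk (t : R) : is_derive t (1:R) (fun t => P (c + r * sin t)) (k t).
  have d1 : is_derive t (1:R) (fun t => c + r * sin t) (r * cos t).
    by apply: is_derive_eq; rewrite /GRing.scale/=; ring.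
  have d2 := dP (c + r * sin t).
  exact: (@is_derive1_comp _ P (fun t => c + r * sin t) t _ _ d2 d1).
have ck : continuous k.
  move=> t; have ct : continuous (@cos R) by exact: continuous_cos.
  have st : continuous (@sin R) by exact: continuous_sin.
  apply: cvgM; last by apply: cvgM; [exact: cvg_cst|exact: ct].
  apply: (@continuous_comp _ _ _ (fun t => c + r * sin t) h); last exact: ch.
  by apply: cvgD; [exact: cvg_cst|apply: cvgM; [exact: cvg_cst|exact: st]].
have pi2 : - (pi / 2) <= pi / 2 :> R by have := pi_ge0 R; lra.
have := FTC2 pi2 ck dk; rewrite sin_pihalf sinN sin_pihalf mulr1 mulrN1 => <-.
pose k2 (t : R) := 2 * r ^+ 2 * cos t ^+ 2.
have ck2 : continuous k2.
  move=> t; have ct : continuous (@cos R) by exact: continuous_cos.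
  apply: cvgM; first exact: cvg_cst.
  by rewrite /GRing.exp/=; apply: cvgM; exact: ct.
have dk2 (t : R) : is_derive t (1:R) (fun t => r ^+ 2 * (t + sin t * cos t)) (k2 t).
  apply: is_derive_eq; rewrite /GRing.scale/= /k2.
  transitivity (r ^+ 2 * (cos t ^+ 2 + sin t ^+ 2 + cos t ^+ 2 - sin t ^+ 2)); first by rewrite cos2Dsin2; ring.
  by ring.
transitivity (\int[mu]_(t in `[- (pi / 2), pi / 2]) k2 t).
  apply: eq_Rintegral => t; rewrite inE/= in_itv/= => /cos_ge0_pihalf c0.
  rewrite /k /h /k2 addrAC subrr add0r.
  have -> : r ^+ 2 - (r * sin t) ^+ 2 = (r * cos t) ^+ 2.
    by rewrite !exprMn -[X in X - _]mulr1 -(cos2Dsin2 t); ring.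
  by rewrite sqrtr_sqr ger0_norm ?mulr_ge0//; ring.
by rewrite (FTC2 pi2 ck2 dk2) cosN cos_pihalf sin_pihalf sinN sin_pihalf; field.
Qed.

Lemma closed_disk_section c s x : 0 <= s ->
  mu (xsection [set z | dist2 c z <= s] x) = (2 * Num.sqrt (s - (x - c.1) ^+ 2))%:E.
Proof.
move=> s0; set t := s - (x - c.1) ^+ 2.
have [t0|t0] := leP 0 t.
  have -> : xsection [set z | dist2 c z <= s] x = `[c.2 - Num.sqrt t, c.2 + Num.sqrt t]%classic.
    apply/seteqP; split=> y; rewrite /xsection/= inE/= /dist2/= in_itv/=.
      move=> h; have : (y - c.2) ^+ 2 <= t by rewrite /t; lra.
      move=> /ler_wsqrtr; rewrite sqrtr_sqr.
      by rewrite ler_norml => /andP[? ?]; apply/andP; split; lra.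
    move=> /andP[h1 h2]; have : `|y - c.2| <= Num.sqrt t by rewrite ler_norml; lra.
    rewrite -ler_sqr ?nnegrE// ?sqrtr_ge0// sqr_sqrtr// real_normK ?num_real// /t; lra.
  rewrite lebesgue_measure_itv/= lte_fin.
  have := sqrtr_ge0 t; rewrite le_eqVlt => /predU1P[<-|st].
    by rewrite ifF ?mulr0//; apply/negbTE; rewrite -leNgt; lra.
  by rewrite ifT -?EFinB; [congr EFin; lra|lra].
rewrite ltr0_sqrtr// mulr0 (_ : xsection _ _ = set0) ?measure0//.
apply/seteqP; split=> y //; rewrite /xsection/= inE/= /dist2/= => h.
by have := sqr_ge0 (y - c.2); move: t0 h; rewrite /t; lra.
Qed.

Lemma measurable_closed_disk c s : measurable [set z | dist2 c z <= s].
Proof.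
rewrite (_ : [set z | _] = dist2 c @^-1` [set` `]-oo, s]]).
  by rewrite -[X in measurable X]setTI; apply: measurable_dist2.
by apply/seteqP; split=> z /=; rewrite in_itv.
Qed.

Lemma closed_disk_area c s : 0 <= s -> leb2 [set z | dist2 c z <= s] = (pi * s)%:E.
Proof.
move=> s0; rewrite /leb2 /product_measure1.
under eq_integral do rewrite /= closed_disk_section//.
pose r := Num.sqrt s; have r0 : 0 <= r := sqrtr_ge0 s.
have -> : s = r ^+ 2 by rewrite sqr_sqrtr.
pose h (x : R) := 2 * Num.sqrt (r ^+ 2 - (x - c.1) ^+ 2).
have ch : continuous h.
  move=> x; apply: cvgM; first exact: cvg_cst.
  apply: (@continuous_comp _ _ _ (fun x => r ^+ 2 - (x - c.1) ^+ 2) Num.sqrt); last exact: sqrt_continuous.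
  apply: cvgB; first exact: cvg_cst.
  by rewrite /GRing.exp/=; apply: cvgM; (apply: cvgB; [exact: cvg_id|exact: cvg_cst]).
transitivity (\int[mu]_(x in `[(c.1 - r)%R, (c.1 + r)%R]) (h x)%:E)%E; last first.
  rewrite -(half_disk_integral c.1 r0) /Rintegral fineK//.
  apply: integrable_fin_num => //.
  by apply: continuous_compact_integrable; [exact: segment_compact|exact: continuous_subspaceT].
rewrite [RHS]integral_mkcond; apply: eq_integral => x _.
rewrite patchE; case: ifPn => //; rewrite notin_setE/= in_itv/= => h1.
congr EFin; rewrite ler0_sqrtr ?mulr0// subr_le0.
have h2 : r <= `|x - c.1|.
  rewrite leNgt; apply/negP => h2; apply/h1.
  by move: h2; rewrite ltr_norml => /andP[? ?]; apply/andP; split; lra.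
by rewrite -[leRHS]real_normK ?num_real// lerXn2r// nnegrE.
Qed.

(** The truncations at 0 cover negative endpoints: the characterisation of Lebesgue measure used in
    [radial_measure] tests every interval []a, b]] of the line. *)
Lemma annulus_area c (a b : R) : a <= b ->
  leb2 (dist2 c @^-1` `]a, b]) = (pi * (Num.max b 0 - Num.max a 0))%:E.
Proof.
move=> ab.
have E : dist2 c @^-1` `]a, b] = [set z | dist2 c z <= b] `\` [set z | dist2 c z <= a].
  apply/seteqP; split=> z /=; rewrite in_itv/=.
    by move=> /andP[h1 h2]; split=> //; apply/negP; rewrite -ltNge.
  by move=> [h1 /negP]; rewrite -ltNge => ->.
have [b0|b0] := ltP b 0.
  rewrite max_r ?(le_trans ab (ltW b0))// subrr mulr0 (_ : _ @^-1` _ = set0) ?/leb2 ?measure0//.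
  apply/seteqP; split=> z //=; rewrite in_itv/= => /andP[_ h]; have := dist2_ge0 c z; lra.
rewrite E; have [a0|a0] := ltP a 0.
  rewrite subr0 (_ : [set z | dist2 c z <= a] = set0) ?setD0 ?closed_disk_area//.
  by apply/seteqP; split=> z //= h; have := dist2_ge0 c z; lra.
set A := [set z | _ <= b]; set B := [set z | _ <= a].
have -> : leb2 (A `\` B) = (leb2 A - leb2 (A `&` B))%E.
  apply: measureD; try exact: measurable_closed_disk.
  by rewrite [X in (X < _)%E](closed_disk_area c b0) ltry.
rewrite setIidr; last by move=> z /= h; exact: le_trans h ab.
by rewrite !closed_disk_area// -EFinB mulrBr.
Qed.

(** Archimedes' observation that the area between two concentric circles is proportional to the
    difference of the squared radii, extended from intervals to Borel sets by uniqueness of Lebesgue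
    measure. The image of the area under [dist2 c] charges nonnegative numbers only, so Lebesgue
    measure of the negative half-line ([N]) is added before comparing. *)
Lemma radial_measure c (A : set R) : measurable A -> (forall x, A x -> 0 <= x) ->
  (leb2 (dist2 c @^-1` A) = pi%:E * mu A)%E.
Proof.
move=> mA A0.
pose P0 : {measure set (measurableTypeR R) -> \bar R} := pushforward (@leb2 R) (dist2 c : _ -> measurableTypeR R).
pose P := P0 (measurable_dist2 c).
have pi0 : 0 <= (pi : R)^-1 by rewrite invr_ge0 pi_ge0.
pose ip := NngNum pi0.
have mneg : measurable (`]-oo, 0[%classic : set R) by exact: measurable_itv.
pose N : {measure set (measurableTypeR R) -> \bar R} := mrestr mu mneg.
pose M : {measure set (measurableTypeR R) -> \bar R} := measure_add (mscale ip P) N.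
have ME X : M X = (pi^-1%:E * leb2 (dist2 c @^-1` X) + mu (X `&` `]-oo, 0%R[))%E.
  exact: measure_addE.
have : mu A = M A.
  apply: lebesgue_measure_unique => // X [[a b] _ <-] /=; rewrite ME.
  have [ab|ba] := leP a b; last first.
    have -> : `]a, b]%classic = set0 :> set R by rewrite set_itv_ge// bnd_simp -leNgt ltW.
    by rewrite preimage_set0 set0I !measure0 /leb2 measure0 mule0 adde0.
  rewrite annulus_area// -EFinM mulKf ?gt_eqF ?pi_gt0// lebesgue_measure_itv/= lte_fin.
  have -> : mu (`]a, b] `&` `]-oo, 0%R[) = (Num.min b 0 - Num.min a 0)%:E.
    have [b0|b0] := ltP b 0.
      rewrite min_l; last by rewrite (le_trans ab)// ltW.
      rewrite setIidl.
        rewrite lebesgue_measure_itv/= lte_fin; case: ifPn => [_|]; first by rewrite -EFinB.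
        by rewrite -leNgt => ba; rewrite (_ : b - a = 0)//; lra.
      by move=> x /=; rewrite !in_itv/= => /andP[_ xb]; exact: le_lt_trans xb b0.
    have [a0|a0] := ltP a 0.
      rewrite sub0r (_ : _ `&` _ = `]a, 0[%classic).
        by rewrite lebesgue_measure_itv/= lte_fin a0 -EFinB sub0r.
      by apply/seteqP; split=> x /=; rewrite !in_itv/=; [move=> [/andP[-> _]->]|move=> /andP[-> h]; split; lra].
    rewrite subrr (_ : _ `&` _ = set0) ?measure0//.
    by apply/seteqP; split=> x //=; rewrite !in_itv/= => -[/andP[h1 _] h2]; lra.
  rewrite -EFinD; case: ifPn => [_|]; last first.
    rewrite -leNgt => ba; have -> : b = a by lra.
    by rewrite !subrr addr0.
  rewrite -EFinD; congr EFin.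
  by case: (leP b 0) => h1; case: (leP a 0) => h2; rewrite ?(max_r h1) ?(max_r h2) ?(max_l (ltW h1)) ?(max_l (ltW h2)) ?(min_l h1) ?(min_l h2) ?(min_r (ltW h1)) ?(min_r (ltW h2)); lra.
rewrite ME (_ : A `&` _ = set0); last first.
  by apply/seteqP; split=> x //= [/A0]; rewrite in_itv/=; lra.
rewrite measure0 adde0 => ->; rewrite muleA -EFinM mulfV ?gt_eqF ?pi_gt0// mul1e//.
Qed.

Lemma measurable_disk c r : measurable (disk c r).
Proof.
rewrite (_ : disk c r = dist2 c @^-1` [set` `]-oo, r ^+ 2[]).
  by rewrite -[X in measurable X]setTI; apply: measurable_dist2.
by apply/seteqP; split=> z /=; rewrite /disk /dist2 /= in_itv.
Qed.

Lemma radial_integral c (f : R -> R) : measurable_fun setT f -> (forall x, 0 <= f x) ->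
  (\int[@leb2 R]_(z in disk c 1) (f (dist2 c z))%:E = pi%:E * \int[mu]_(x in `[0%R, 1%R]) (f x)%:E)%E.
Proof.
move=> mf f0.
pose P0 : {measure set (measurableTypeR R) -> \bar R} := pushforward (@leb2 R) (dist2 c : _ -> measurableTypeR R).
pose P := P0 (measurable_dist2 c).
have -> : disk c 1 = dist2 c @^-1` `[0, 1[.
  by apply/seteqP; split=> z /=; have := dist2_ge0 c z; rewrite /disk /dist2 /= in_itv/= expr1n => ->.
transitivity (\int[P]_(x in `[0%R, 1%R[) (f x)%:E)%E.
  rewrite ge0_integral_pushforward//; first exact: measurable_dist2.
    by apply/measurable_EFinP; apply: measurable_funTS.
  by move=> y _; rewrite lee_fin.
have pi0 : 0 <= (pi : R) by rewrite pi_ge0.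
rewrite (eq_measure_integral (mscale (NngNum pi0) mu)).
  rewrite ge0_integral_mscale//; first last.
  - by move=> y _; rewrite lee_fin.
  - by apply/measurable_EFinP; apply: measurable_funTS.
  by congr (_ * _)%E; apply: integral_itv_bndo_bndc; apply/measurable_EFinP; apply: measurable_funTS.
move=> A mA A01; have A0 x : A x -> 0 <= x by move/A01; rewrite /= in_itv/= => /andP[].
exact: (radial_measure c mA A0).
Qed.

Lemma disk_area c : leb2 (disk c 1) = (pi : R)%:E.
Proof.
have := @radial_integral c (fun=> 1) (measurable_cst _) (fun=> ler01).
rewrite !integral_cst//=; last exact: measurable_disk.
by rewrite !mul1e /leb2 => ->; rewrite lebesgue_measure_itv/= lte01 oppr0 adde0 mule1.
Qed.

End Radial.

(** * The Knothe map onto the disk *)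

Section FubiniBox.
Variable R : realType.
Local Notation mu := (@lebesgue_measure R).
Local Notation R2 := (measurableTypeR R * measurableTypeR R)%type.
Implicit Types (f : R * R -> R) (X : R).

Definition seg X : set R := `[- X, X]%classic.
Definition box X : set (R * R) := seg X `*` seg X.

Lemma measurable_seg X : measurable (seg X). Proof. exact: measurable_itv. Qed.

Lemma seg_fin X : (mu (seg X) < +oo)%E.
Proof. by rewrite /seg lebesgue_measure_itv/=; case: ifP => _; rewrite ?ltry// -EFinB ltry. Qed.

Lemma measurable_box X : measurable (box X). Proof. by apply: measurableX; exact: measurable_seg. Qed.

Lemma box_fin X : (@leb2 R (box X) < +oo)%E.
Proof.
rewrite /leb2 /box [X in (X < _)%E]product_measure1E; [|exact: measurable_seg|exact: measurable_seg].
by apply: lte_mul_pinfty => //; [rewrite ge0_fin_numE//|]; exact: seg_fin.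
Qed.

Lemma bm_row X f x : bm (T := R2) (box X) f -> seg X x -> bm (T := measurableTypeR R) (seg X) (fun y => f (x, y)).
Proof.
move=> [mf [C fC]] sx; split; first exact: (measurableT_comp mf (pair1_measurable x)).
by exists C => y sy; apply: fC.
Qed.

Lemma bm_col X f y : bm (T := R2) (box X) f -> seg X y -> bm (T := measurableTypeR R) (seg X) (fun x => f (x, y)).
Proof.
move=> [mf [C fC]] sx; split; first exact: (measurableT_comp mf (pair2_measurable y)).
by exists C => x sy; apply: fC.
Qed.

Lemma seg_intE X (f : R -> R) : bm (T := measurableTypeR R) (seg X) f ->
  (\int[mu]_(y in seg X) (f y)%:E = (\int[mu]_(y in seg X) f y)%:E)%E.
Proof. exact: (@bm_intE _ (measurableTypeR R) R mu (seg X) (measurable_seg X) (seg_fin X)). Qed.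

Let fe X f : R2 -> \bar R := (EFin \o f) \_ (box X).

Lemma integrable_patch_box X f : bm (T := R2) (box X) f -> (@leb2 R).-integrable setT (fe X f).
Proof.
move=> bf; apply: (@integrable_mkcond _ R2 R (@leb2 R) (box X) (EFin \o f) (measurable_box X)).1.
exact: (@bm_integrable _ R2 R (@leb2 R) (box X) (measurable_box X) (box_fin X)).
Qed.

Lemma fubini_F_box X f x : bm (T := R2) (box X) f ->
  fubini_F mu (fe X f) x = ((fun x => (\int[mu]_(y in seg X) f (x, y))%:E) \_ (seg X)) x.
Proof.
move=> bf; rewrite /fubini_F patchE; case: ifPn => xX.
  rewrite inE in xX.
  rewrite -(seg_intE (bm_row bf xX)) [RHS]integral_mkcond.
  apply: eq_integral => y _; rewrite /fe !patchE /box.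
  by rewrite (_ : ((x, y) \in seg X `*` seg X) = (y \in seg X))//; apply/idP/idP; rewrite !inE/= => // -[].
apply: integral0_eq => y _; rewrite /fe patchE ifF//; apply/negbTE.
by rewrite notin_setE => -[/= h _]; rewrite notin_setE in xX.
Qed.

Lemma fubini_G_box X f y : bm (T := R2) (box X) f ->
  fubini_G mu (fe X f) y = ((fun y => (\int[mu]_(x in seg X) f (x, y))%:E) \_ (seg X)) y.
Proof.
move=> bf; rewrite /fubini_G patchE; case: ifPn => xX.
  rewrite inE in xX.
  rewrite -(seg_intE (bm_col bf xX)) [RHS]integral_mkcond.
  apply: eq_integral => x _; rewrite /fe !patchE /box.
  by rewrite (_ : ((x, y) \in seg X `*` seg X) = (x \in seg X))//; apply/idP/idP; rewrite !inE/= => // -[].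
apply: integral0_eq => x _; rewrite /fe patchE ifF//; apply/negbTE.
by rewrite notin_setE => -[/= _ h]; rewrite notin_setE in xX.
Qed.

Lemma fubini_box1 X f : bm (T := R2) (box X) f ->
  \int[@leb2 R]_(z in box X) f z = \int[mu]_(x in seg X) \int[mu]_(y in seg X) f (x, y).
Proof.
move=> bf; rewrite /Rintegral; congr fine.
rewrite [LHS]integral_mkcond -[LHS]/(\int[@leb2 R]_z (fe X f) z)%E /leb2.
rewrite -(integral12_prod_meas1 (integrable_patch_box bf)) [RHS]integral_mkcond.
by apply: eq_integral => x _; exact: fubini_F_box.
Qed.

Lemma fubini_box2 X f : bm (T := R2) (box X) f ->
  \int[@leb2 R]_(z in box X) f z = \int[mu]_(y in seg X) \int[mu]_(x in seg X) f (x, y).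
Proof.
move=> bf; rewrite /Rintegral; congr fine.
rewrite [LHS]integral_mkcond -[LHS]/(\int[@leb2 R]_z (fe X f) z)%E /leb2.
rewrite -(integral21_prod_meas1 (integrable_patch_box bf)) [RHS]integral_mkcond.
by apply: eq_integral => x _; exact: fubini_G_box.
Qed.

Lemma measurable_inner_int X f : bm (T := R2) (box X) f ->
  measurable_fun (seg X) (fun x => \int[mu]_(y in seg X) f (x, y)).
Proof.
move=> bf; apply/measurable_EFinP.
have := measurable_fubini_F (integrable_patch_box bf) => mF.
apply: (eq_measurable_fun (fubini_F mu (fe X f))).
  by move=> x xX; rewrite fubini_F_box// patchE xX.
exact: measurable_funTS mF.
Qed.

Lemma int_box_sub X f (A : set (R * R)) : A `<=` box X -> (forall z, ~ A z -> f z = 0) ->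
  \int[@leb2 R]_(z in A) f z = \int[@leb2 R]_(z in box X) f z.
Proof.
move=> AX f0; rewrite Rintegral_mkcond [RHS]Rintegral_mkcond; congr Rintegral; apply/funext => z.
rewrite !patchE; case: ifPn => zA; case: ifPn => zX //.
- by rewrite inE in zA; rewrite notin_setE in zX; case: zX; exact: AX.
- by rewrite notin_setE in zA; rewrite f0.
Qed.

End FubiniBox.

Lemma continuous_compR (R : realType) (f g : R -> R) : continuous f -> continuous g ->
  continuous (fun x => g (f x)).
Proof. by move=> cf cg x; apply: (@continuous_comp _ _ _ f g); [exact: cf|exact: cg]. Qed.

(** * The target density on the disk, chord by chord *)

Section DiskTarget.
Variables (R : realType) (e : R).
Hypothesis e0 : 0 < e.
Local Notation mu := (@lebesgue_measure R).
Local Notation R2 := (measurableTypeR R * measurableTypeR R)%type.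

Definition half_chord (t : R) : R := Num.sqrt (1 - t ^+ 2).
Local Notation bb := half_chord.

Lemma half_chord_continuous : continuous bb.
Proof.
move=> t; rewrite /half_chord /continuous_at; apply: (@continuous_comp _ _ _ (fun t : R => 1 - t ^+ 2) Num.sqrt t); last exact: sqrt_continuous.
by apply: cvgB; [exact: cvg_cst|exact: exprn_continuous].
Qed.

Lemma half_chord_gt0 t : -1 < t < 1 -> 0 < bb t.
Proof. by move=> /andP[h1 h2]; rewrite sqrtr_gt0; nra. Qed.

Lemma half_chord_eq0 t : ~ (-1 < t < 1) -> bb t = 0.
Proof.
move=> h; apply: ler0_sqrtr; rewrite subr_le0.
have [h1|h1] := leP t (-1); first by nra.
have [h2|h2] := leP 1 t; first by nra.
by case: h; rewrite h1.
Qed.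

Lemma half_chord_sqr t : -1 <= t <= 1 -> bb t ^+ 2 = 1 - t ^+ 2.
Proof. by move=> /andP[h1 h2]; rewrite sqr_sqrtr//; nra. Qed.

Lemma half_chord_le1 t : bb t <= 1.
Proof. by rewrite -sqrtr1 ler_wsqrtr//; have := sqr_ge0 t; lra. Qed.

Lemma in_chord t s : -1 <= t <= 1 -> - bb t <= s <= bb t -> t ^+ 2 + s ^+ 2 <= 1.
Proof.
move=> ht hs; have E := half_chord_sqr ht; have b0 : 0 <= bb t := sqrtr_ge0 _.
suff : s ^+ 2 <= bb t ^+ 2 by rewrite E; lra.
by rewrite -[leLHS]real_normK ?num_real// lerXn2r ?nnegrE// ler_norml; case/andP: hs => -> ->.
Qed.

(** Fubini on the square cuts the disk into vertical chords, while [radial_integral] evaluates the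
    same integral in the squared radius. *)
Lemma chord_integral_disk (phi : R -> R) (N : R -> R) :
  continuous phi -> (forall x, 0 <= phi x) ->
  (forall t, -1 <= t <= 1 -> N t = \int[mu]_(s in `[- bb t, bb t]) phi (t ^+ 2 + s ^+ 2)) ->
  \int[mu]_(t in `[-1, 1]) N t = pi * \int[mu]_(x in `[0, 1]) phi x.
Proof.
move=> cphi phi0 NE.
have mphi : measurable_fun setT phi by exact: continuous_measurable_fun.
have := @radial_integral R (0, 0) phi mphi phi0 => E.
have -> : pi * \int[mu]_(x in `[0, 1]) phi x = \int[@leb2 R]_(z in disk (0, 0) 1) phi (dist2 (0, 0) z).
  rewrite /Rintegral E fineM//; apply: integrable_fin_num => //.
  by apply: continuous_compact_integrable; [exact: segment_compact|exact: continuous_subspaceT].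
have cd : continuous (fun z : R * R => phi (dist2 (0, 0) z)).
  by move=> z; apply: (@continuous_comp _ _ _ (dist2 (0,0)) phi); [exact: dist2_continuous|exact: cphi].
pose f (z : R * R) := phi (dist2 (0, 0) z) * \1_(disk (0, 0) 1) z.
have dbox : disk (0, 0) 1 `<=` box (1 : R).
  move=> [x y]; rewrite /disk /= !subr0 expr1n => h.
  by split; rewrite /seg /= in_itv/=; apply/andP; split; nra.
have bf : bm (T := R2) (box 1) f.
  split.
    apply: measurable_funM; first exact: continuous_measurable2.
    by apply: measurable_indic; exact: measurable_disk.
  have := @compact_bounded R R (phi @` `[0, 1]).
  case; first by apply: continuous_compact; [exact: continuous_subspaceT|exact: segment_compact].
  move=> C [_ HC]; exists (C + 1) => z _; rewrite /f indicE.
  have C1 : C < C + 1 by lra.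
  case: (boolP (z \in _)) => [|_]; last first.
    rewrite mulr0 normr0; apply: le_trans (HC _ C1 (phi 0) _) => //.
    by exists 0 => //=; rewrite in_itv/= lexx ler01.
  rewrite inE /disk /= expr1n mulr1 => h; apply: (HC _ C1); exists (dist2 (0, 0) z) => //=.
  by rewrite in_itv/= dist2_ge0 ltW.
transitivity (\int[@leb2 R]_(z in disk (0, 0) 1) f z); last first.
  by apply: eq_Rintegral => z zd; rewrite /f indicE zd mulr1.
rewrite (int_box_sub dbox); last first.
  by move=> z nz; rewrite /f indicE memNset// mulr0.
rewrite (fubini_box1 bf) /seg; apply: eq_Rintegral => t; rewrite inE/= in_itv/= => ht.
have E2 := half_chord_sqr ht; have b0 : 0 <= bb t := sqrtr_ge0 _.
rewrite NE//.
have -> : \int[mu]_(y in `[-1, 1]) f (t, y) = \int[mu]_(y in `](- bb t), bb t[) phi (t ^+ 2 + y ^+ 2).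
  rewrite [LHS]Rintegral_mkcond [RHS]Rintegral_mkcond; congr Rintegral; apply/funext => y.
  rewrite !patchE /f indicE /dist2 /= !subr0.
  have [h|h] := boolP (y \in `](- bb t), bb t[%classic).
    have h' : - bb t < y < bb t by move: h; rewrite inE/= in_itv.
    have bl := half_chord_le1 t.
    rewrite !mem_set; first by rewrite mulr1.
      by rewrite /disk/= !subr0 expr1n; move/andP: h' => [? ?]; nra.
    by rewrite /= in_itv/=; move/andP: h' => [? ?]; apply/andP; split; lra.
  rewrite (memNset (_ : ~ disk (0, 0) 1 (t, y))) ?mulr0 ?if_same//.
  rewrite /disk/= !subr0 expr1n => h2; move: h; rewrite notin_setE/= in_itv/=; apply.
  rewrite -ltr_norml -ltr_sqr ?nnegrE// real_normK ?num_real// E2; lra.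
have ci : lebesgue_measure.-integrable `[- bb t, bb t] (EFin \o (fun s : R => phi (t ^+ 2 + s ^+ 2))).
  apply: continuous_compact_integrable; [exact: segment_compact|apply: continuous_subspaceT].
  apply: (@continuous_compR _ (fun s => t ^+ 2 + s ^+ 2) phi) => // s.
  by apply: cvgD; [exact: cvg_cst|exact: exprn_continuous].
rewrite -Rintegral_itv_bndo_bndc -?Rintegral_itv_obnd_cbnd//; apply: integrableS ci => //.
all: by apply: subset_itv; rewrite bnd_simp.
Qed.

Local Notation c2 := ((1 + e) ^+ 2).
Let k (t : R) : R := Num.sqrt (t ^+ 2 + e).

Lemma sqDe_gt0 (t s : R) : 0 < t ^+ 2 + s ^+ 2 + e.
Proof. by move: e0 => e1; have := sqr_ge0 t; have := sqr_ge0 s; lra. Qed.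

Let k_gt0 t : 0 < k t.
Proof. by move: e0 => e1; rewrite sqrtr_gt0; have := sqr_ge0 t; lra. Qed.

Let k_sqr t : k t ^+ 2 = t ^+ 2 + e.
Proof. by move: e0 => e1; rewrite sqr_sqrtr//; have := sqr_ge0 t; lra. Qed.

Let k_continuous : continuous k.
Proof.
apply: continuous_compR; last exact: sqrt_continuous.
by move=> t; apply: cvgD; [exact: exprn_continuous|exact: cvg_cst].
Qed.

(** Antiderivatives in [s] of the densities [chord_density j t], with [k t] the root of [t^2 + e].
    They are explicit so that continuity in [t], also along a moving endpoint, is immediate; chord
    masses and the measurability of the second component of the map rest on it. *)
Definition chord_primitive (j : nat) (t s : R) : R := c2 *
  match j with
  | 0 => s / (2 * k t ^+ 2 * (k t ^+ 2 + s ^+ 2)) + atan (s / k t) / (2 * k t ^+ 3)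
  | 1 => atan (s / k t) / k t
  | 2 => s
  | 3 => k t ^+ 2 * s + s ^+ 3 / 3
  | _ => k t ^+ 4 * s + 2 * k t ^+ 2 * s ^+ 3 / 3 + s ^+ 5 / 5
  end.
Local Notation Q := chord_primitive.

(** The bubble weighted by powers of [|y|^2 + e]. Exponent 0 gives the mass, 1 the integral of
    [sqrt g * d], 2 that of [d^2], and 3 and 4 the moments of [|T|^2] needed for stability. *)
Definition chord_density (j : nat) (t s : R) : R :=
  c2 * (t ^+ 2 + s ^+ 2 + e) ^+ j / (t ^+ 2 + s ^+ 2 + e) ^+ 2.

Lemma chord_primitive_derive j t (s : R) : (j <= 4)%N ->
  is_derive s (1:R) (Q j t) (chord_density j t s).
Proof.
move=> j4; have k0 := k_gt0 t; have kn0 : k t != 0 by rewrite gt_eqF.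
have ksn0 : k t ^+ 2 + s ^+ 2 != 0 by rewrite gt_eqF// ltr_pwDl ?sqr_ge0// exprn_gt0.
have dat : is_derive s (1:R) (fun s => atan (s / k t)) (k t / (k t ^+ 2 + s ^+ 2)).
  have d1 : is_derive s (1:R) (fun s => s / k t) (k t)^-1.
    by apply: is_derive_eq; rewrite /GRing.scale/=; ring.
  have := @is_derive1_comp _ (@atan R) (fun s => s / k t) s _ _ (is_derive1_atan _) d1 => dd.
  rewrite [X in is_derive _ _ _ X](_ : _ = (1 + (s / k t) ^+ 2)^-1 * (k t)^-1); first exact: dd.
  by field; rewrite kn0 ksn0.
rewrite /chord_density.
have -> : t ^+ 2 + s ^+ 2 + e = k t ^+ 2 + s ^+ 2 by rewrite k_sqr; ring.
case: j j4 => [|[|[|[|[|//]]]]] _ /=.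
- have dV : is_derive s (1:R) (fun s => (k t ^+ 2 + s ^+ 2)^-1) (- (2 * s) / (k t ^+ 2 + s ^+ 2) ^+ 2).
    have d1 : is_derive s (1:R) (fun s => k t ^+ 2 + s ^+ 2) (2 * s).
      by apply: is_derive_eq; rewrite /GRing.scale/=; ring.
    have := @is_deriveV _ (fun s => k t ^+ 2 + s ^+ 2) s _ 1 ksn0 d1 => dd.
    by apply: is_derive_eq; rewrite /GRing.scale/=; field.
  have E : Q 0 t = (fun s => c2 * ((2 * k t ^+ 2)^-1 * (s * (k t ^+ 2 + s ^+ 2)^-1) + (2 * k t ^+ 3)^-1 * atan (s / k t))).
    by apply/funext => y; rewrite /chord_primitive invfM; ring.
  by rewrite E; apply: is_derive_eq; rewrite /GRing.scale/=; field; rewrite kn0 ksn0.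
- have E : Q 1 t = (fun s => c2 * ((k t)^-1 * atan (s / k t))).
    by apply/funext => y; rewrite /chord_primitive; ring.
  by rewrite E; apply: is_derive_eq; rewrite /GRing.scale/=; field; rewrite kn0 ksn0.
- by apply: is_derive_eq; rewrite /GRing.scale/=; field; rewrite ksn0.
- by apply: is_derive_eq; rewrite /GRing.scale/=; field; rewrite ksn0.
- by apply: is_derive_eq; rewrite /GRing.scale/=; field; rewrite ksn0.
Qed.

Lemma chord_density_continuous j t : continuous (chord_density j t).
Proof.
move=> s; have cq : (t ^+ 2 + s ^+ 2 + e) @[s --> s] --> t ^+ 2 + s ^+ 2 + e.
  apply: cvgD; last exact: cvg_cst.
  by apply: cvgD; [exact: cvg_cst|exact: exprn_continuous].
apply: cvgM.
  apply: cvgM; first exact: cvg_cst.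
  apply: (@continuous_comp _ _ _ (fun s : R => t ^+ 2 + s ^+ 2 + e) (fun x => x ^+ j)); first exact: cq.
  exact: exprn_continuous.
apply: cvgV; first by rewrite gt_eqF// exprn_gt0// sqDe_gt0.
apply: (@continuous_comp _ _ _ (fun s : R => t ^+ 2 + s ^+ 2 + e) (fun x => x ^+ 2)); first exact: cq.
exact: exprn_continuous.
Qed.

Lemma chord_density_gt0 j t s : 0 < chord_density j t s.
Proof. by move: e0 => e1; have h := sqDe_gt0 t s; rewrite divr_gt0 ?mulr_gt0 ?exprn_gt0//; lra. Qed.

Definition chord_mass (j : nat) (t : R) : R := Q j t (bb t) - Q j t (- bb t).

Lemma chord_primitive_continuous j (b : R -> R) : (j <= 4)%N -> continuous b ->
  continuous (fun t => Q j t (b t)).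
Proof.
move=> j4 cb t; apply: cvgM; first exact: cvg_cst.
have k0 := k_gt0 t; have kn0 : k t != 0 by rewrite gt_eqF.
have ckn n : (k t ^+ n) @[t --> t] --> k t ^+ n.
  by apply: (@continuous_comp _ _ _ k (fun x => x ^+ n)); [exact: k_continuous|exact: exprn_continuous].
have cbn n : (b t ^+ n) @[t --> t] --> b t ^+ n.
  by apply: (@continuous_comp _ _ _ b (fun x => x ^+ n)); [exact: cb|exact: exprn_continuous].
have cat : atan (b t / k t) @[t --> t] --> atan (b t / k t).
  apply: (@continuous_comp _ _ _ (fun t => b t / k t) (@atan R)); last exact: continuous_atan.
  by apply: cvgM; [exact: cb|apply: cvgV => //; exact: k_continuous].
have ksn0 : k t ^+ 2 + b t ^+ 2 != 0 by rewrite gt_eqF// ltr_pwDl ?sqr_ge0// exprn_gt0.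
case: j j4 => [|[|[|[|[|//]]]]] _ /=.
- apply: cvgD.
    apply: cvgM; first exact: cb.
    apply: cvgV; first by rewrite !mulf_neq0// expf_neq0.
    apply: cvgM; last exact: cvgD.
    by apply: cvgM; [exact: cvg_cst|].
  apply: cvgM => //; apply: cvgV; first by rewrite !mulf_neq0// expf_neq0.
  by apply: cvgM; [exact: cvg_cst|].
- by apply: cvgM => //; apply: cvgV => //; exact: k_continuous.
- exact: cb.
- apply: cvgD; first by apply: cvgM => //; exact: cb.
  by apply: cvgM => //; exact: cvg_cst.
- apply: cvgD; last by apply: cvgM => //; exact: cvg_cst.
  apply: cvgD; first by apply: cvgM => //; exact: cb.
  apply: cvgM; last exact: cvg_cst.
  apply: cvgM => //.
  by apply: cvgM => //; exact: cvg_cst.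
Qed.

Lemma chord_mass_continuous j : (j <= 4)%N -> continuous (chord_mass j).
Proof.
move=> j4 t; apply: cvgB; apply: chord_primitive_continuous => //; first exact: half_chord_continuous.
by move=> x; apply: cvgN; exact: half_chord_continuous.
Qed.

Lemma chord_massE j t : (j <= 4)%N ->
  chord_mass j t = \int[mu]_(s in `[- bb t, bb t]) chord_density j t s.
Proof.
move=> j4; have b0 : - bb t <= bb t by have := sqrtr_ge0 (1 - t ^+ 2); rewrite -/(bb t); lra.
by rewrite (FTC2 b0 (@chord_density_continuous j t) (fun s => chord_primitive_derive t s j4)).
Qed.

Definition disk_moment (j : nat) : R :=
  pi * c2 * match j with
  | 0 => 1 / e - 1 / (1 + e) | 1 => ln (1 + e) - ln e | 2 => 1 | 3 => 1 / 2 + e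
  | _ => ((1 + e) ^+ 3 - e ^+ 3) / 3 end.

Lemma chord_mass_integral j : (j <= 4)%N ->
  \int[mu]_(t in `[-1, 1]) chord_mass j t = disk_moment j.
Proof.
(* The absolute value removes the pole at [-e], so that [phi] is continuous and nonnegative on the
   whole line. *)
move=> j4; pose phi (x : R) := c2 * (`|x| + e) ^+ j / (`|x| + e) ^+ 2.
move: e0 => e1; have p0 (x : R) : 0 < `|x| + e by have := normr_ge0 x; lra.
have cphi : continuous phi.
  have cn : continuous (fun x : R => `|x| + e).
    by move=> x; apply: cvgD; [exact: norm_continuous|exact: cvg_cst].
  have cj i : continuous (fun x : R => (`|x| + e) ^+ i).
    by apply: (@continuous_compR _ (fun x : R => `|x| + e) (fun x => x ^+ i)) => //; exact: exprn_continuous.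
  move=> x; apply: cvgM.
    by apply: cvgM; [exact: cvg_cst|exact: cj].
  apply: cvgV; first by rewrite gt_eqF// exprn_gt0.
  exact: cj.
rewrite (@chord_integral_disk phi)//.
- pose P (x : R) := c2 * match j with 0 => - (x + e)^-1 | 1 => ln (x + e) | 2 => x | 3 => x ^+ 2 / 2 + e * x | _ => (x + e) ^+ 3 / 3 end.
  have dP (x : R) : 0 <= x <= 1 -> is_derive x (1:R) P (phi x).
    move=> /andP[x0 x1]; rewrite /phi /P (ger0_norm x0).
    have xe : 0 < x + e by lra.
    have xn : x + e != 0 by rewrite gt_eqF.
    case: j j4 {phi p0 cphi P} => [|[|[|[|[|//]]]]] _.
    + have d1 : is_derive x (1:R) (fun x => x + e) 1 by apply: is_derive_eq; rewrite addr0.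
      have := @is_deriveV _ (fun x => x + e) x _ 1 xn d1 => dd.
      by apply: is_derive_eq; rewrite /GRing.scale/= expr0; field.
    + have d1 : is_derive x (1:R) (fun x => x + e) 1 by apply: is_derive_eq; rewrite addr0.
      have := @is_derive1_comp _ (@ln R) (fun x => x + e) x _ _ (is_derive1_ln xe) d1 => dd.
      by apply: is_derive_eq; rewrite /GRing.scale/=; field.
    + by apply: is_derive_eq; rewrite /GRing.scale/=; field.
    + by apply: is_derive_eq; rewrite /GRing.scale/=; field.
    + by apply: is_derive_eq; rewrite /GRing.scale/=; field.
  rewrite (FTC2in ler01 (fun x _ => cphi x) dP).
  rewrite /P /disk_moment -mulrA; congr (_ * _); rewrite -mulrBr; congr (_ * _).
    by case: j {j4 phi p0 cphi P dP} => [|[|[|[|j]]]]; rewrite ?add0r ?div1r; try ring; field; lra.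
- move=> x; have := p0 x => /ltW px; apply: divr_ge0; last exact: exprn_ge0.
  by apply: mulr_ge0; apply: exprn_ge0 => //; lra.
- move=> t _; rewrite chord_massE//; apply: eq_Rintegral => s _.
  by rewrite /phi /chord_density ger0_norm// addr_ge0// sqr_ge0.
Qed.

End DiskTarget.

(** * Primitives of densities supported in an interval *)

Section CutPrimitive.
Variables (R : realType) (X : R) (h P : R -> R).
Local Notation mu := (@lebesgue_measure R).
Hypotheses (X0 : 0 < X) (ch : continuous h) (h0 : forall y, 0 <= h y)
  (hX : forall y, ~ (- X < y < X) -> h y = 0) (dP : forall y : R, is_derive y (1:R) P (h y)).

Let cP : continuous P := is_derive_continuous dP.

Lemma primitive_homo y y' : y <= y' -> P y <= P y'.
Proof.
rewrite le_eqVlt => /predU1P[->//|yy].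
have [c _ E] := MVT yy (fun x _ => dP x) (continuous_subspaceT cP).
by rewrite -subr_ge0 E mulr_ge0// subr_ge0 ltW.
Qed.

Lemma cut_primitive_left y : y <= - X -> P y = P (- X).
Proof.
rewrite le_eqVlt => /predU1P[->//|yy].
have [c] := MVT yy (fun x _ => dP x) (continuous_subspaceT cP).
rewrite in_itv/= => /andP[c1 c2] E; apply/esym/eqP; rewrite -subr_eq0 E hX ?mul0r//.
by move=> /andP[? ?]; lra.
Qed.

Lemma cut_primitive_right y : X <= y -> P y = P X.
Proof.
rewrite le_eqVlt => /predU1P[->//|yy].
have [c] := MVT yy (fun x _ => dP x) (continuous_subspaceT cP).
rewrite in_itv/= => /andP[c1 c2] E; apply/eqP; rewrite -subr_eq0 E hX ?mul0r//.
by move=> /andP[? ?]; lra.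
Qed.

Lemma cut_primitive_bound y : P (- X) <= P y <= P X.
Proof.
have x1 := X0.
have [h1|h1] := leP y (- X); first by rewrite cut_primitive_left// lexx primitive_homo//; lra.
have [h2|h2] := leP X y; first by rewrite (cut_primitive_right h2) lexx andbT primitive_homo//; lra.
by rewrite !primitive_homo// ltW.
Qed.

Lemma cut_primitiveE y : P y - P (- X) = \int[mu]_(s in seg X) (if (s <= y)%R then h s else 0).
Proof.
have x1 := X0; have mXX : - X <= X by lra.
have [h1|h1] := ltP y (- X).
  rewrite cut_primitive_left ?ltW// subrr; apply/esym.
  rewrite (@eq_Rintegral _ _ _ mu (seg X) (fun=> 0)).
    by rewrite Rintegral_cst ?mul0r//; exact: measurable_seg.
  by move=> s; rewrite inE /seg/= in_itv/= => /andP[s1 s2]; rewrite leNgt (lt_le_trans h1 s1).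
have [h2|h2] := leP X y.
  rewrite (cut_primitive_right h2) -(FTC2 mXX ch dP); apply: eq_Rintegral => s.
  by rewrite inE/= in_itv/= => /andP[s1 s2]; rewrite (le_trans s2 h2).
rewrite -(FTC2 h1 ch dP) [LHS]Rintegral_mkcond [RHS]Rintegral_mkcond; congr Rintegral; apply/funext => s.
rewrite !patchE /seg; case: ifPn; case: ifPn; rewrite ?(inE, notin_setE) /= !in_itv/=.
- by move=> _ /andP[_ ->].
- by move=> hs /andP[s1 s2]; case: hs; rewrite s1 (le_trans s2 (ltW h2)).
- move=> /andP[s1 s2] /negP; by rewrite s1/= => /negbTE ->.
- by [].
Qed.

Lemma cut_primitive_total : P X - P (- X) = \int[mu]_(s in seg X) h s.
Proof. by have x1 := X0; rewrite -(FTC2 _ ch dP)//; lra. Qed.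

Lemma cut_total_gt0 y : 0 < h y -> 0 < \int[mu]_(s in seg X) h s.
Proof.
move=> hy; rewrite -cut_primitive_total lt_neqAle subr_ge0.
have /andP[b1 b2] := cut_primitive_bound y.
rewrite (le_trans b1 b2) andbT eq_sym subr_eq0; apply/eqP => E.
have yX : - X < y < X by apply/negPn/negP => /negP/hX h1; rewrite h1 ltxx in hy.
have PE z : P z = P X by have /andP[p1 p2] := cut_primitive_bound z; apply/eqP; rewrite eq_le p2 E p1.
have /esym d0 := @derive_val _ _ _ _ _ _ _ (dP y).
have : 'D_1 P y = 0 :> R.
  have -> : P = cst (P X) by apply/funext; exact: PE.
  exact: derive_cst.
by rewrite -d0 => h1; rewrite h1 ltxx in hy.
Qed.
End CutPrimitive.

Section ChordMass.
Variables (R : realType) (e : R).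
Hypothesis e0 : 0 < e.
Local Notation mu := (@lebesgue_measure R).

Lemma chord_primitive_mono t s s' : s < s' -> chord_primitive e 0 t s < chord_primitive e 0 t s'.
Proof.
move=> ss; have dQ := fun s => @chord_primitive_derive R e e0 0 t s isT.
have [c _ E] := MVT ss (fun x _ => dQ x) (continuous_subspaceT (is_derive_continuous dQ)).
by rewrite -subr_gt0 E mulr_gt0 ?subr_gt0// chord_density_gt0.
Qed.

Lemma chord_mass_gt0 t : -1 < t < 1 -> 0 < chord_mass e 0 t.
Proof. by move=> /half_chord_gt0 b0; rewrite subr_gt0 chord_primitive_mono//; lra. Qed.

Lemma chord_mass_ge0 t : 0 <= chord_mass e 0 t.
Proof.
have [/chord_mass_gt0/ltW//|/negP/half_chord_eq0 b0] := boolP (-1 < t < 1).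
by rewrite /chord_mass b0 oppr0 subrr.
Qed.

(** On the disk [|y|^2 + e] is at most [1 + e]. This is the domination hypothesis under which
    moments are pushed forward. *)
Lemma chord_mass_le j t : (j <= 4)%N -> -1 <= t <= 1 ->
  `|chord_mass e j t| <= (1 + e) ^+ j * chord_mass e 0 t.
Proof.
move=> j4 ht; have e1 : 0 <= 1 + e by have := e0; lra.
rewrite !chord_massE//.
have ci i : mu.-integrable `[- half_chord t, half_chord t] (EFin \o chord_density e i t).
  by apply: continuous_compact_integrable; [exact: segment_compact|apply: continuous_subspaceT; exact: chord_density_continuous].
rewrite ger0_norm; last by apply: Rintegral_ge0 => s _; rewrite ltW// chord_density_gt0.
rewrite -RintegralZl//; apply: le_Rintegral => //.
  apply: continuous_compact_integrable; first exact: segment_compact.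
  apply: continuous_subspaceT => s; apply: cvgM; first exact: cvg_cst.
  exact: chord_density_continuous.
move=> s; rewrite /= in_itv/= => hs; have h := in_chord ht hs; have q0 := sqDe_gt0 e0 t s.
rewrite /chord_density expr0 mulr1 mulrA ler_wpM2r//.
  by rewrite invr_ge0 sqr_ge0.
rewrite mulrC ler_wpM2r ?sqr_ge0// lerXn2r ?nnegrE//; [exact: ltW|].
by rewrite lerD2r.
Qed.
End ChordMass.

(** * Construction of the triangular map *)

Section Knothe.
Variables (R : realType) (e X C : R) (g : R * R -> R).
Local Notation mu := (@lebesgue_measure R).
Local Notation R2 := (measurableTypeR R * measurableTypeR R)%type.
Hypotheses (e0 : 0 < e) (X0 : 0 < X) (cg : continuous g) (g0 : forall z, 0 <= g z)
  (gC : forall z, g z <= C) (gX : forall z, g z != 0 -> (- X < z.1 < X) && (- X < z.2 < X))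
  (gZ : \int[@leb2 R]_(z in box X) g z = disk_moment e 0).

Definition marginal (x : R) : R := \int[mu]_(y in seg X) g (x, y).
Local Notation m := marginal.

Let bg : bm (T := R2) (box X) g.
Proof.
split; first exact: continuous_measurable2.
by exists C => z _; rewrite ger0_norm.
Qed.

Lemma row_continuous x : continuous (fun y => g (x, y)).
Proof.
move=> y; apply: (@continuous_comp _ _ _ (fun y => (x, y)) g); last exact: cg.
exact: (cvg_pair (cvg_cst x) cvg_id).
Qed.

Lemma col_continuous y : continuous (fun x => g (x, y)).
Proof.
move=> x; apply: (@continuous_comp _ _ _ (fun x => (x, y)) g); last exact: cg.
exact: (cvg_pair cvg_id (cvg_cst y)).
Qed.

Lemma row_cut x y : ~ (- X < y < X) -> g (x, y) = 0.
Proof. by move=> h; apply/eqP/negPn/negP => /gX /= /andP[_]. Qed.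

Lemma marginal_continuous : continuous m.
Proof.
move=> x.
have := @continuity_under_integral R _ (measurableTypeR R) mu (fun x y => g (x, y)) (seg X) (measurable_seg X) (x - 1) (x + 1).
move=> /(_ _ _ (fun=> C)); apply.
- move=> z _; apply: continuous_compact_integrable; first exact: segment_compact.
  by apply: continuous_subspaceT; exact: row_continuous.
- by apply: aeW => y _ z _; exact: col_continuous.
- apply: continuous_compact_integrable; first exact: segment_compact.
  by apply: continuous_subspaceT => ?; exact: cvg_cst.
- by move=> z _; apply: aeW => y _; rewrite ger0_norm.
- by rewrite inE/= in_itv/=; apply/andP; split; lra.
Qed.

Lemma marginal_ge0 x : 0 <= m x.
Proof. by apply: Rintegral_ge0. Qed.

Lemma marginal_cut x : ~ (- X < x < X) -> m x = 0.
Proof.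
move=> h; rewrite /m (@eq_Rintegral _ _ _ mu (seg X) (fun=> 0)) => [|y _].
  by rewrite Rintegral_cst ?mul0r//; exact: measurable_seg.
by apply/eqP/negPn/negP => /gX /= /andP[].
Qed.

Lemma marginal_gt0 x y : 0 < g (x, y) -> 0 < m x.
Proof.
move=> gxy; have [P dP] := primitive (@row_continuous x).
exact: (@cut_total_gt0 R X (fun y => g (x, y)) P X0 (@row_continuous x) (fun y => g0 _) (@row_cut x) dP y).
Qed.

Lemma marginal_total : \int[mu]_(x in seg X) m x = disk_moment e 0.
Proof. by rewrite -gZ fubini_box1. Qed.

(** The marginal of [g] and the chord masses of the bubble have equal totals by [gZ]; shifting the
    primitive of the marginal makes both distribution functions run between the same two values. *)
Lemma knothe_first : exists A Mc T1 : R -> R, [/\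
  (forall x : R, is_derive x (1:R) A (m x)), (forall t : R, is_derive t (1:R) Mc (chord_mass e 0 t)),
  (forall x, Mc (-1) <= A x <= Mc 1), A (- X) = Mc (-1) /\ A X = Mc 1 &
  (forall x, -1 <= T1 x <= 1) /\ (forall x, Mc (T1 x) = A x)].
Proof.
have [PA dA] := primitive marginal_continuous.
have [PM dM] := primitive (@chord_mass_continuous R e e0 0 isT).
have tot : PM 1 - PM (-1) = PA X - PA (- X).
  rewrite (cut_primitive_total X0 marginal_continuous dA) marginal_total.
  by rewrite -(@chord_mass_integral R e e0 0 isT) (FTC2 _ (@chord_mass_continuous R e e0 0 isT) dM)//; lra.
have bnd := cut_primitive_bound X0 marginal_ge0 marginal_cut dA.
pose A x := PA x - PA (- X) + PM (-1).
have dA' (x : R) : is_derive x (1:R) A (m x).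
  by have := dA x => h; apply: is_derive_eq; rewrite subr0 addr0.
have AB x : PM (-1) <= A x <= PM 1.
  by have := bnd x => /andP[? ?]; rewrite /A; apply/andP; split; lra.
have N11 : -1 < 1 :> R by lra.
have [T1 HT] := @transport_exists R (-1) 1 (chord_mass e 0) A PM N11 (chord_mass_gt0 e0) dM AB.
exists A, PM, T1; split => //.
  by rewrite /A subrr add0r; split => //; lra.
by split=> x; have [] := HT x.
Qed.

Lemma marginal_eq0 x y : m x = 0 -> g (x, y) = 0.
Proof.
move=> m0; apply/eqP; rewrite eq_le g0 andbT leNgt; apply/negP => /marginal_gt0.
by rewrite m0 ltxx.
Qed.

Section Maps.
Variables (A Mc T1 : R -> R).
Hypotheses (dA : forall x : R, is_derive x (1:R) A (m x))
  (dM : forall t : R, is_derive t (1:R) Mc (chord_mass e 0 t))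
  (AB : forall x, Mc (-1) <= A x <= Mc 1) (AX : A (- X) = Mc (-1) /\ A X = Mc 1)
  (T1b : forall x, -1 <= T1 x <= 1) (T1E : forall x, Mc (T1 x) = A x).

Lemma knothe1_continuous : continuous T1.
Proof. exact: (transport_continuous (chord_mass_gt0 e0) dA dM T1b T1E). Qed.

Lemma knothe1_homo x x' : x <= x' -> T1 x <= T1 x'.
Proof. exact: (transport_homo marginal_ge0 (chord_mass_gt0 e0) dA dM T1b T1E). Qed.

Lemma knothe1_in x : 0 < m x -> -1 < T1 x < 1.
Proof.
by move=> mx; apply/negPn/negP => /negP/(transport_edge dA AB T1b T1E) h; rewrite h ltxx in mx.
Qed.

Lemma knothe1_left : T1 (- X) = -1.
Proof.
have /andP[h1 h2] := T1b (- X); apply/eqP; rewrite eq_le h1 andbT leNgt; apply/negP => h3.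
have := target_cdf_mono (chord_mass_gt0 e0) dM (lexx _) h2 h3.
by rewrite T1E AX.1 ltxx.
Qed.

Lemma knothe1_right : T1 X = 1.
Proof.
have /andP[h1 h2] := T1b X; apply/eqP; rewrite eq_le h2/= leNgt; apply/negP => h3.
have := target_cdf_mono (chord_mass_gt0 e0) dM h1 (lexx _) h3.
by rewrite T1E AX.2 ltxx.
Qed.

(** The derivative of [T1] over columns that carry mass; the value is 0 over the other columns. *)
Definition stretch1 (x : R) : R := m x / chord_mass e 0 (T1 x).
Local Notation a := stretch1.

Lemma knothe1_derive x : 0 < m x -> is_derive x (1:R) T1 (a x).
Proof. by move=> /knothe1_in h; exact: (transport_derive (chord_mass_gt0 e0) dA dM T1b T1E h). Qed.

Lemma stretch1_continuous x : 0 < m x -> {for x, continuous a}.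
Proof.
move=> mx; apply: cvgM; first exact: marginal_continuous.
apply: cvgV; first by rewrite gt_eqF// chord_mass_gt0// knothe1_in.
by apply: (@continuous_comp _ _ _ T1 (chord_mass e 0)); [exact: knothe1_continuous|exact: chord_mass_continuous].
Qed.

Lemma stretch1_gt0 x : 0 < m x -> 0 < a x.
Proof. by move=> mx; rewrite divr_gt0// chord_mass_gt0// knothe1_in. Qed.

Definition row_cdf x y : R := \int[mu]_(s in seg X) (if (s <= y)%R then g (x, s) else 0).

Local Notation Q x := (chord_primitive e 0 (T1 x)).
Local Notation b x := (half_chord (T1 x)).
Local Notation dens x := (chord_density e 0 (T1 x)).

Lemma slice_cdf x : 0 < m x -> exists G : R -> R, [/\
  (forall y : R, is_derive y (1:R) G ((a x)^-1 * g (x, y))),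
  (forall y, Q x (- b x) <= G y <= Q x (b x)),
  (forall y, G y = (a x)^-1 * row_cdf x y + Q x (- b x)) & G (- X) = Q x (- b x) /\ G X = Q x (b x)].
Proof.
move=> mx; have [P dP] := primitive (@row_continuous x).
have hs := @row_cut x; have h0 := fun y => g0 (x, y).
pose G y := (a x)^-1 * (P y - P (- X)) + Q x (- b x).
have ax := stretch1_gt0 mx; have ai : 0 <= (a x)^-1 by rewrite invr_ge0 ltW.
have GX : G X = Q x (b x).
  rewrite /G (cut_primitive_total X0 (@row_continuous x) dP) -/(m x) invf_div mulfVK ?gt_eqF//.
  by rewrite /chord_mass subrK.
have bnd y : P (- X) <= P y <= P X := cut_primitive_bound X0 h0 hs dP y.
exists G; split.
- by move=> y; have := dP y => h; apply: is_derive_eq; rewrite /GRing.scale/= subr0 addr0.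
- move=> y; rewrite -GX /G lerD2r lerDr mulr_ge0//=; last by rewrite subr_ge0; case/andP: (bnd y).
  by rewrite ler_wpM2l// lerD2r; case/andP: (bnd y).
- by move=> y; rewrite /G (cut_primitiveE X0 (@row_continuous x) hs dP).
- by rewrite {1}/G subrr mulr0 add0r.
Qed.

Lemma dens_gt0 x s : - b x < s < b x -> 0 < dens x s.
Proof. by move=> _; exact: chord_density_gt0. Qed.

Lemma knothe_second : exists T2 : R * R -> R, forall z,
  (0 < m z.1 -> - b z.1 <= T2 z <= b z.1 /\ Q z.1 (T2 z) = (a z.1)^-1 * row_cdf z.1 z.2 + Q z.1 (- b z.1)) /\
  (~ (0 < m z.1) -> T2 z = 0).
Proof.
suff h z : exists s, (0 < m z.1 -> - b z.1 <= s <= b z.1 /\ Q z.1 s = (a z.1)^-1 * row_cdf z.1 z.2 + Q z.1 (- b z.1)) /\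
  (~ (0 < m z.1) -> s = 0) by have [T HT] := boolp.choice h; exists T.
(* Columns without mass are sent to height 0, which keeps the image in the disk since [T1] lies
   between -1 and 1. *)
have [mx|mx] := pselect (0 < m z.1); last by exists 0.
have [G [dG GB GE _]] := slice_cdf mx.
have b0 := half_chord_gt0 (knothe1_in mx).
have bb : - b z.1 < b z.1 by lra.
have [T HT] := transport_exists bb (@dens_gt0 z.1) (fun s => @chord_primitive_derive R e e0 0 (T1 z.1) s isT) GB.
by exists (T z.2); have [h1 h2] := HT z.2; split => // _; rewrite h1 h2 GE.
Qed.

Variable T2 : R * R -> R.
Hypothesis T2P : forall z,
  (0 < m z.1 -> - b z.1 <= T2 z <= b z.1 /\ Q z.1 (T2 z) = (a z.1)^-1 * row_cdf z.1 z.2 + Q z.1 (- b z.1)) /\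
  (~ (0 < m z.1) -> T2 z = 0).

Lemma knothe2_disk z : T1 z.1 ^+ 2 + T2 z ^+ 2 <= 1.
Proof.
have [mx|mx] := pselect (0 < m z.1).
  by apply: in_chord => //; have [/(_ mx)[]] := T2P z.
rewrite ((T2P z).2 mx) expr0n addr0; have /andP[h1 h2] := T1b z.1; nra.
Qed.

Section Slice.
Variable x : R.
Hypothesis mx : 0 < m x.

Lemma slice_transport : exists G : R -> R, [/\
  (forall y : R, is_derive y (1:R) G ((a x)^-1 * g (x, y))),
  (forall y, Q x (- b x) <= G y <= Q x (b x)),
  (forall y, - b x <= T2 (x, y) <= b x), (forall y, Q x (T2 (x, y)) = G y) &
  T2 (x, - X) = - b x /\ T2 (x, X) = b x].
Proof.
have [G [dG GB GE [G1 G2]]] := slice_cdf mx; exists G.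
have h1 y : - b x <= T2 (x, y) <= b x by have [/(_ mx)[]] := T2P (x, y).
have h2 y : Q x (T2 (x, y)) = G y by have [/(_ mx)[_ ->]] := T2P (x, y).
have inj s s' : Q x s = Q x s' -> s = s'.
  by move=> E; case: (ltgtP s s') => // /(chord_primitive_mono e0 (T1 x)); rewrite E ltxx.
by split=> //; split; apply: inj; rewrite h2.
Qed.

Let src_continuous : continuous (fun y => (a x)^-1 * g (x, y)).
Proof. by move=> y; apply: cvgM; [exact: cvg_cst|exact: row_continuous]. Qed.

Let src_ge0 y : 0 <= (a x)^-1 * g (x, y).
Proof. by rewrite mulr_ge0// invr_ge0 ltW// stretch1_gt0. Qed.

Let dQ s := @chord_primitive_derive R e e0 0 (T1 x) s isT.
Let cD := @chord_density_continuous R e e0 0 (T1 x).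

Lemma slice_moment j : (j <= 4)%N ->
  \int[mu]_(y in seg X) (g (x, y) * (T1 x ^+ 2 + T2 (x, y) ^+ 2 + e) ^+ j) = a x * chord_mass e j (T1 x).
Proof.
move=> j4; have [G [dG GB Tb TE [Tl Tr]]] := slice_transport.
have b0 := half_chord_gt0 (knothe1_in mx); have bb : - b x < b x by lra.
have mXX : - X <= X by have x1 := X0; lra.
have ax := stretch1_gt0 mx.
have e1 : 0 <= 1 + e by have := e0; lra.
have bnd s : - b x <= s <= b x -> `|chord_density e j (T1 x) s| <= (1 + e) ^+ j * dens x s.
  move=> hs; have h := in_chord (T1b x) hs; have q0 := sqDe_gt0 e0 (T1 x) s.
  rewrite gtr0_norm ?chord_density_gt0// /chord_density expr0 mulr1 mulrA ler_wpM2r ?invr_ge0 ?sqr_ge0//.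
  rewrite mulrC ler_wpM2r ?sqr_ge0// lerXn2r ?nnegrE//; [exact: ltW|].
  by rewrite lerD2r.
have := push_forward bb src_continuous src_ge0 cD (@dens_gt0 x) dG dQ GB Tb TE
  (@chord_density_continuous R e e0 j (T1 x)) bnd (fun s => @chord_primitive_derive R e e0 j (T1 x) s j4) mXX Tl Tr.
rewrite -chord_massE// => <-; rewrite -RintegralZl//; last first.
  apply: continuous_compact_integrable; first exact: segment_compact.
  apply: continuous_subspaceT.
  exact: (push_continuous src_continuous src_ge0 cD (@dens_gt0 x) dG dQ GB Tb TE (@chord_density_continuous R e e0 j (T1 x)) bnd).
apply: eq_Rintegral => y _.
have q0 := sqDe_gt0 e0 (T1 x) (T2 (x, y)).
rewrite /chord_density expr0 mulr1; field.
by rewrite gt_eqF//= gt_eqF//=; have := e0; lra.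
Qed.

Lemma slice_by_parts (f f' : R -> R) (K : set R) :
  (forall y : R, is_derive y (1:R) f (f' y)) -> continuous f' -> closed K ->
  (forall y, K y -> 0 < g (x, y)) -> (forall y, ~ K y -> f y = 0) ->
  \int[mu]_(y in seg X) (f' y * T2 (x, y) + f y * ((a x)^-1 * g (x, y) / dens x (T2 (x, y)))) = 0.
Proof.
move=> df cf' clK gK fK; have [G [dG GB Tb TE _]] := slice_transport.
have mXX : - X <= X by have x1 := X0; lra.
have edge y : ~ (- X < y < X) -> ~ K y by move=> h /gK; rewrite row_cut// ltxx.
apply: (transport_by_parts src_continuous cD (@dens_gt0 x) dG dQ GB Tb TE df cf' clK _ fK mXX).
- by move=> y Ky; rewrite mulr_gt0 ?gK// invr_gt0 stretch1_gt0.
- by apply: edge; rewrite ltxx.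
- by apply: edge; rewrite ltxx andbF.
Qed.
End Slice.

(** The bound [s <= y] moves with the point, so the integrand is viewed as a measurable function on
    a triple product and Tonelli's theorem is applied in the last variable. *)
Lemma row_cdf_measurable : measurable_fun setT (fun z : R2 => row_cdf z.1 z.2).
Proof.
pose f (w : R2 * measurableTypeR R) : \bar R :=
  (if ((w.2 : R) <= w.1.2) && (((- X : R) <= w.2) && ((w.2 : R) <= X)) then g (w.1.1, w.2) else 0)%:E.
have mf : measurable_fun setT f.
  apply/measurable_EFinP; apply: measurable_fun_ifT => //.
    apply: measurable_and; first by apply: measurable_fun_ler => //; exact: (measurableT_comp measurable_snd measurable_fst).
    by apply: measurable_and; apply: measurable_fun_ler.
  have mp : measurable_fun setT (fun w : R2 * measurableTypeR R => (w.1.1, w.2) : R2).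
    by apply: measurable_fun_pair => //; exact: (measurableT_comp measurable_fst measurable_fst).
  exact: (measurableT_comp (continuous_measurable2 cg) mp).
have f0 w : (0 <= f w)%E by rewrite lee_fin; case: ifP.
have mF := measurable_fun_fubini_tonelli_F (m2 := mu) f mf f0.
have -> : (fun z : R2 => row_cdf z.1 z.2) = fine \o fubini_F mu f.
  apply/funext => -[x y]; rewrite /row_cdf /= /Rintegral /fubini_F; congr fine.
  rewrite [LHS]integral_mkcond; apply: eq_integral => s _.
  rewrite patchE /f /=; case: ifPn; rewrite ?inE ?notin_setE /seg /= in_itv/=.
    by move=> ->; rewrite andbT.
  by move=> /negP/negbTE ->; rewrite andbF.
exact: (measurableT_comp (fine_measurable measurableT) mF).
Qed.

Lemma fst_measurable (f : R -> R) : continuous f -> measurable_fun setT (fun z : R2 => f z.1).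
Proof. by move=> cf; exact: (measurableT_comp (continuous_measurable_fun cf) measurable_fst). Qed.

(** The chord primitive is strictly increasing, so [T2 z > s] is an inequality between distribution
    functions. Cleared of the division by [a], it compares two measurable functions of [z]. *)
Lemma knothe2_measurable : measurable_fun setT (T2 : R2 -> R).
Proof.
apply: (measurability _ (RGenOInfty.measurableE R)) => //.
move=> _ [_ [s ->] <-]; rewrite setTI.
pose U : set R2 := [set z | chord_mass e 0 (T1 z.1) * row_cdf z.1 z.2 <= m z.1 * (Q z.1 s - Q z.1 (- b z.1))].
pose V : set R2 := [set z | m z.1 <= 0].
have -> : T2 @^-1` `]s, +oo[%classic = (~` V `&` ~` U) `|` (V `&` [set z | s < 0]).
  apply/seteqP; split=> z; rewrite /= in_itv/= andbT.
    move=> sT; have [mx|mx] := pselect (0 < m z.1).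
      left; split; first by apply/negP; rewrite -ltNge.
      apply/negP; rewrite -ltNge.
      have [/(_ mx)[_ E] _] := T2P z.
      have := chord_primitive_mono e0 (T1 z.1) sT; rewrite E -ltrBlDr.
      by rewrite invf_div mulrAC ltr_pdivlMr// mulrC.
    right; split; first by rewrite /V/= leNgt; exact/negP.
    by move: sT; rewrite ((T2P z).2 mx).
  move=> [[/negP mx /negP]|[mx s0]]; last first.
    by rewrite ((T2P z).2 _)//; apply/negP; rewrite -leNgt.
  rewrite -ltNge in mx; rewrite -ltNge => h; have [/(_ mx)[_ E] _] := T2P z.
  rewrite ltNge; apply/negP => Ts.
  have : Q z.1 (T2 z) <= Q z.1 s.
    by move: Ts; rewrite le_eqVlt => /predU1P[->//|/(chord_primitive_mono e0 (T1 z.1))/ltW].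
  rewrite E -lerBrDr invf_div mulrAC ler_pdivrMr// [X in _ <= X]mulrC.
  by rewrite leNgt h.
have mm : measurable_fun setT (fun z : R2 => m z.1) by apply: fst_measurable; exact: marginal_continuous.
have mV : measurable V.
  by rewrite -[V]setTI; apply: measurable_fun_le.
have cQ (c : R -> R) : continuous c -> measurable_fun setT (fun z : R2 => Q z.1 (c (T1 z.1))).
  move=> cc; apply: (@fst_measurable (fun x => Q x (c (T1 x)))).
  apply: (@continuous_compR _ T1 (fun t => chord_primitive e 0 t (c t))); first exact: knothe1_continuous.
  exact: chord_primitive_continuous.
have mU : measurable U.
  rewrite -[U]setTI; apply: measurable_fun_le => //.
    apply: measurable_funM; last exact: row_cdf_measurable.
    apply: (@fst_measurable (fun x => chord_mass e 0 (T1 x))).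
    by apply: continuous_compR; [exact: knothe1_continuous|exact: chord_mass_continuous].
  apply: measurable_funM => //; apply: measurable_funB.
    by apply: (cQ (fun=> s)) => t; exact: cvg_cst.
  apply: (cQ (fun t => - half_chord t)) => t; apply: cvgN; exact: half_chord_continuous.
apply: measurableU; apply: measurableI => //; try exact: measurableC.
have [s0|s0] := boolP (s < 0).
  by rewrite (_ : [set z | _] = setT)//; apply/seteqP.
by rewrite (_ : [set z | _] = set0)//; apply/seteqP; split=> // z /=; rewrite (negbTE s0).
Qed.

Definition stretch2 (z : R * R) : R := (a z.1)^-1 * g z / dens z.1 (T2 z).

(** The Monge-Ampere equation of the map: the factor [a] of the first stretch cancels its inverse in
    the second. Over columns without mass [g] vanishes, and both sides are 0. *)
Lemma knothe_det z : a z.1 * stretch2 z = g z * (T1 z.1 ^+ 2 + T2 z ^+ 2 + e) ^+ 2 / (1 + e) ^+ 2.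
Proof.
have q0 := sqDe_gt0 e0 (T1 z.1) (T2 z); have e1 := e0.
have [mx|mx] := pselect (0 < m z.1).
  have ax := stretch1_gt0 mx; rewrite /stretch2 /chord_density expr0 mulr1; field.
  by apply/and3P; split; apply: lt0r_neq0 => //; lra.
have gz : g z = 0.
  case: z mx {q0} => x y /= mx; apply: marginal_eq0; apply/eqP; rewrite eq_le marginal_ge0 andbT leNgt.
  exact/negP.
by rewrite /stretch2 gz !(mulr0, mul0r).
Qed.

Lemma knothe_moment j : (j <= 4)%N ->
  \int[@leb2 R]_(z in box X) (g z * (T1 z.1 ^+ 2 + T2 z ^+ 2 + e) ^+ j) = disk_moment e j.
Proof.
move=> j4; have e1 : 0 <= 1 + e by have := e0; lra.
have bT : bm (T := R2) (box X) (fun z => T1 z.1 ^+ 2 + T2 z ^+ 2 + e).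
  split.
    apply: measurable_funD; last exact: measurable_cst.
    apply: measurable_funD; apply: measurable_funX; first exact: (@fst_measurable T1 knothe1_continuous).
    exact: knothe2_measurable.
  exists (1 + e) => z _; rewrite ger0_norm; last exact/ltW/sqDe_gt0.
  by rewrite lerD2r knothe2_disk.
rewrite fubini_box1; last by apply: bmM => //; exact: bmX.
have mXX : - X <= X by have x1 := X0; lra.
have N11 : -1 < 1 :> R by lra.
have [N dN] := primitive (@chord_mass_continuous R e e0 j j4).
have := push_forward N11 marginal_continuous marginal_ge0 (@chord_mass_continuous R e e0 0 isT)
  (chord_mass_gt0 e0) dA dM AB T1b T1E (@chord_mass_continuous R e e0 j j4)
  (fun s hs => @chord_mass_le R e e0 j s j4 hs) dN mXX knothe1_left knothe1_right.
rewrite chord_mass_integral// => <-; apply: eq_Rintegral => x _.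
have [mx|mx] := pselect (0 < m x).
  by rewrite slice_moment// /stretch1 mulrAC mulrA.
have m0 : m x = 0 by apply/eqP; rewrite eq_le marginal_ge0 andbT leNgt; exact/negP.
rewrite m0 mul0r (@eq_Rintegral _ _ _ mu (seg X) (fun=> 0)) => [|y _].
  by rewrite Rintegral_cst ?mul0r//; exact: measurable_seg.
by rewrite (marginal_eq0 y m0) mul0r.
Qed.

Lemma knothe_by_parts1 y (f f' : R -> R) (K : set R) :
  (forall x : R, is_derive x (1:R) f (f' x)) -> continuous f' -> closed K ->
  (forall x, K x -> 0 < g (x, y)) -> (forall x, ~ K x -> f x = 0) ->
  \int[mu]_(x in seg X) (f' x * T1 x + f x * a x) = 0.
Proof.
move=> df cf' clK gK fK.
have mXX : - X <= X by have x1 := X0; lra.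
have edge x : ~ (- X < x < X) -> ~ K x by move=> h /gK/marginal_gt0; rewrite marginal_cut// ltxx.
apply: (transport_by_parts marginal_continuous (@chord_mass_continuous R e e0 0 isT) (chord_mass_gt0 e0) dA dM AB T1b T1E df cf' clK _ fK mXX).
- by move=> x /gK/marginal_gt0.
- by apply: edge; rewrite ltxx.
- by apply: edge; rewrite ltxx andbF.
Qed.

Lemma invr_measurable d (U : measurableType d) (f : U -> R) :
  measurable_fun setT f -> (forall x, 0 <= f x) -> measurable_fun setT (fun x => (f x)^-1).
Proof.
move=> mf f0; rewrite (_ : (fun x => _) = (fun x => f x `^ (-1))); last first.
  by apply/funext => x; rewrite powR_inv1.
exact: (measurableT_comp (measurable_powR (-1)) mf).
Qed.

Lemma stretch1_ge0 x : 0 <= a x.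
Proof. by rewrite divr_ge0 ?marginal_ge0 ?chord_mass_ge0. Qed.

Lemma stretch1_measurable : measurable_fun setT (a : measurableTypeR R -> R).
Proof.
apply: measurable_funM; first by apply: continuous_measurable_fun; exact: marginal_continuous.
apply: (@invr_measurable _ (measurableTypeR R) (fun x => chord_mass e 0 (T1 x))); last by move=> x; exact: chord_mass_ge0.
apply: continuous_measurable_fun.
by apply: continuous_compR; [exact: knothe1_continuous|exact: chord_mass_continuous].
Qed.

Lemma stretch2_ge0 z : 0 <= stretch2 z.
Proof.
apply: divr_ge0; last exact/ltW/chord_density_gt0.
by rewrite mulr_ge0// invr_ge0 stretch1_ge0.
Qed.

Lemma stretch2_measurable : measurable_fun setT (stretch2 : R2 -> R).
Proof.
apply: measurable_funM.
  apply: measurable_funM; last exact: continuous_measurable2.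
  apply: (@invr_measurable _ R2 (fun z => a z.1)); last by move=> z; exact: stretch1_ge0.
  exact: (measurableT_comp stretch1_measurable measurable_fst).
apply: (@invr_measurable _ R2 (fun z => dens z.1 (T2 z))); last by move=> z; exact/ltW/chord_density_gt0.
have mq : measurable_fun setT (fun z : R2 => T1 z.1 ^+ 2 + T2 z ^+ 2 + e).
  apply: measurable_funD; last exact: measurable_cst.
  apply: measurable_funD; apply: measurable_funX; last exact: knothe2_measurable.
  exact: (@fst_measurable T1 knothe1_continuous).
apply: measurable_funM; first by apply: measurable_funM; [exact: measurable_cst|exact: measurable_funX].
apply: (@invr_measurable _ R2 (fun z => (T1 z.1 ^+ 2 + T2 z ^+ 2 + e) ^+ 2)); first exact: measurable_funX.
by move=> z; exact: sqr_ge0.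
Qed.

(** On the projection of [K] the function [a] is continuous and positive, hence bounded above and
    away from 0. The second stretch contains [1 / a], and its denominator is at least 1 because the
    bubble density is at least 1 on the disk. *)
Lemma stretch_bounded (K : set (R * R)) : compact K -> (forall z, K z -> 0 < g z) ->
  exists B, forall z, K z -> a z.1 <= B /\ stretch2 z <= B.
Proof.
move=> cK gK; have e1 : 0 < 1 + e by have := e0; lra.
have cK1 : compact (fst @` K).
  by apply: continuous_compact => //; apply: continuous_subspaceT => z; exact: cvg_fst.
have mK x : (fst @` K) x -> 0 < m x by move=> [[x' y] /gK gz <-]; exact: marginal_gt0 gz.
have ca : {within fst @` K, continuous a}.
  by apply: continuous_in_subspaceT => x; rewrite inE => /mK; exact: stretch1_continuous.
have cai : {within fst @` K, continuous (fun x => (a x)^-1)}.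
  apply: continuous_in_subspaceT => x; rewrite inE => /mK mx; apply: cvgV.
    exact/lt0r_neq0/stretch1_gt0.
  exact: stretch1_continuous.
have [B1 [_ HB1]] := compact_bounded (continuous_compact ca cK1).
have [B2 [_ HB2]] := compact_bounded (continuous_compact cai cK1).
exists (Num.max (B1 + 1) ((B2 + 1) * C)) => z Kz.
have zK : (fst @` K) z.1 by exists z.
have h1 : a z.1 <= B1 + 1.
  by apply: le_trans (ler_norm _) _; apply: (HB1 (B1 + 1)); [lra|exists z.1].
have h2 : (a z.1)^-1 <= B2 + 1.
  by apply: le_trans (ler_norm _) _; apply: (HB2 (B2 + 1)); [lra|exists z.1].
split; first by rewrite le_max h1.
rewrite le_max; apply/orP; right.
have d1 : 1 <= dens z.1 (T2 z).
  have q0 := sqDe_gt0 e0 (T1 z.1) (T2 z); have t1 := knothe2_disk z.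
  rewrite /chord_density expr0 mulr1 ler_pdivlMr ?exprn_gt0// mul1r lerXn2r ?nnegrE ?lerD2r//; exact: ltW.
have ai : 0 <= (a z.1)^-1 by rewrite invr_ge0 stretch1_ge0.
rewrite /stretch2 ler_pdivrMr ?(lt_le_trans ltr01)//.
apply: (@le_trans _ _ ((B2 + 1) * C)); first by rewrite ler_pM.
rewrite ler_peMr//; rewrite mulr_ge0//; first exact: le_trans ai h2.
exact: le_trans (g0 z) (gC z).
Qed.

End Maps.
End Knothe.

(** The interface between transport and the functional inequality. [T1] has a genuine derivative [a]
    where [g] is positive; [T2] is a bounded measurable function whose vertical derivative [b] is
    felt only through integration by parts in [y]. *)
Record knothe_map (R : realType) (e X : R) (g : R * R -> R) (T1 a : R -> R) (T2 b : R * R -> R) : Prop := KnotheMap {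
  km_continuous : continuous T1;
  km_homo : forall x x', x <= x' -> T1 x <= T1 x';
  km_left : T1 (- X) = -1;
  km_right : T1 X = 1;
  km_disk : forall z, T1 z.1 ^+ 2 + T2 z ^+ 2 <= 1;
  km_measurable2 : measurable_fun setT (T2 : measurableTypeR R * measurableTypeR R -> R);
  km_measurable_a : measurable_fun setT (a : measurableTypeR R -> R);
  km_measurable_b : measurable_fun setT (b : measurableTypeR R * measurableTypeR R -> R);
  km_a_ge0 : forall x, 0 <= a x;
  km_b_ge0 : forall z, 0 <= b z;
  km_det : forall z, a z.1 * b z = g z * (T1 z.1 ^+ 2 + T2 z ^+ 2 + e) ^+ 2 / (1 + e) ^+ 2;
  km_derive : forall x y, 0 < g (x, y) -> is_derive x (1:R) T1 (a x);
  km_a_continuous : forall x y, 0 < g (x, y) -> {for x, continuous a};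
  km_moment : forall j, (j <= 4)%N ->
    \int[@leb2 R]_(z in box X) (g z * (T1 z.1 ^+ 2 + T2 z ^+ 2 + e) ^+ j) = disk_moment e j;
  km_by_parts1 : forall y (f f' : R -> R) (K : set R),
    (forall x : R, is_derive x (1:R) f (f' x)) -> continuous f' -> closed K ->
    (forall x, K x -> 0 < g (x, y)) -> (forall x, ~ K x -> f x = 0) ->
    \int[@lebesgue_measure R]_(x in seg X) (f' x * T1 x + f x * a x) = 0;
  km_by_parts2 : forall x (f f' : R -> R) (K : set R),
    (forall y : R, is_derive y (1:R) f (f' y)) -> continuous f' -> closed K ->
    (forall y, K y -> 0 < g (x, y)) -> (forall y, ~ K y -> f y = 0) ->
    \int[@lebesgue_measure R]_(y in seg X) (f' y * T2 (x, y) + f y * b (x, y)) = 0;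
  km_bounded : forall K : set (R * R), compact K -> (forall z, K z -> 0 < g z) ->
    exists B, forall z, K z -> a z.1 <= B /\ b z <= B }.

Theorem knothe_exists (R : realType) (e X C : R) (g : R * R -> R) :
  0 < e -> 0 < X -> continuous g -> (forall z, 0 <= g z) -> (forall z, g z <= C) ->
  (forall z, g z != 0 -> (- X < z.1 < X) && (- X < z.2 < X)) ->
  \int[@leb2 R]_(z in box X) g z = disk_moment e 0 ->
  exists T1 a T2 b, knothe_map e X g T1 a T2 b.
Proof.
move=> e0 X0 cg g0 gC gX gZ.
have [A [Mc [T1 [dA dM AB AX [T1b T1E]]]]] := knothe_first e0 X0 cg g0 gC gX gZ.
have [T2 T2P] := knothe_second e0 X0 cg g0 gX dA AB T1b T1E.
have mg x y : 0 < g (x, y) -> 0 < marginal X g x by move=> h; exact: (marginal_gt0 X0 cg g0 gX h).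
exists T1, (stretch1 e X g T1), T2, (stretch2 e X g T1 T2); split.
- exact: (knothe1_continuous e0 dA dM T1b T1E).
- exact: (knothe1_homo e0 g0 dA dM T1b T1E).
- by apply: (knothe1_left e0 dM AX T1b T1E).
- by apply: (knothe1_right e0 dM AX T1b T1E).
- exact: (knothe2_disk T1b T2P).
- exact: (knothe2_measurable e0 cg g0 gC dA dM T1b T1E T2P).
- exact: (stretch1_measurable e0 cg g0 gC dA dM T1b T1E).
- exact: (stretch2_measurable e0 cg g0 gC dA dM T1b T1E T2P).
- exact: (stretch1_ge0 X e0 g0 T1).
- exact: (stretch2_ge0 X e0 g0 T1 T2).
- exact: (knothe_det e0 X0 cg g0 gX dA AB T1b T1E T2).
- by move=> x y /mg mx; exact: (knothe1_derive e0 dA dM AB T1b T1E mx).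
- by move=> x y /mg mx; exact: (stretch1_continuous e0 cg g0 gC dA dM AB T1b T1E mx).
- exact: (knothe_moment e0 X0 cg g0 gC gX dA dM AB AX T1b T1E T2P).
- by move=> y f f' K; exact: (knothe_by_parts1 e0 X0 cg g0 gC gX dA dM AB T1b T1E).
- move=> x f f' K df cf' clK gK fK.
  have [mx|mx] := pselect (0 < marginal X g x).
    exact: (slice_by_parts e0 X0 cg g0 gX dA AB T1b T1E T2P mx df cf' clK gK fK).
  have nK y : ~ K y by move=> /gK /mg.
  have f0 : f = cst 0 by apply/funext => y; exact: fK.
  rewrite (@eq_Rintegral _ _ _ (@lebesgue_measure R) (seg X) (fun=> 0)) => [|y _].
    by rewrite Rintegral_cst ?mul0r//; exact: measurable_seg.
  have <- := @derive_val _ _ _ _ _ _ _ (df y).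
  by rewrite f0 derive_cst /cst !mul0r addr0.
- by move=> K cK gK; apply: (stretch_bounded e0 X0 cg g0 gC gX dA dM AB T1b T1E T2P cK gK).
Qed.

(** * The deficit inequality and its stability *)

Section CompactSupport.
Variable R : realType.
Implicit Types (f : R * R -> R) (K : set (R * R)).

Lemma compact_support_bounded K f : compact K -> continuous f -> (forall z, ~ K z -> f z = 0) ->
  exists C, forall z, `|f z| <= C.
Proof.
move=> cK cf fK.
have [B [_ HB]] := compact_bounded (continuous_compact (continuous_subspaceT cf) cK).
exists (Num.max (B + 1) 0) => z; have [Kz|Kz] := pselect (K z).
  have B1 : B < B + 1 by lra.
  by rewrite le_max (HB _ B1 (f z))//; exists z.
by rewrite fK// normr0 le_max lexx orbT.
Qed.

Lemma compact_closed2 K : compact K -> closed K.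
Proof. by apply: compact_closed; exact: norm_hausdorff. Qed.

Lemma deriv1_off_support K f f1 : closed K ->
  (forall x y : R, is_derive x (1:R) (fun t => f (t, y)) (f1 (x, y))) ->
  (forall z, ~ K z -> f z = 0) -> forall z, ~ K z -> f1 z = 0.
Proof.
move=> clK d fK [x y] Kz.
have nz : \forall t \near x, f (t, y) = 0.
  have oK : open (~` K) by exact: closed_openC.
  have nK : nbhs (x, y) (~` K) by exact: open_nbhs_nbhs.
  have ct : (fun t : R => (t, y)) t @[t --> x] --> (x, y) by exact: (cvg_pair cvg_id (cvg_cst y)).
  have h : \forall t \near x, (~` K) (t, y) := ct _ nK.
  by near=> t; apply: fK; near: t.
have dd := d x y.
have <- := @derive_val _ _ _ _ _ _ _ dd.
have d0 : is_derive x (1:R) (fun t => f (t, y)) 0.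
  apply: (@near_eq_is_derive _ _ _ (fun=> 0)).
  by apply: filterS nz => t ->.
exact: derive_val.
Unshelve. all: by end_near. Qed.

Lemma deriv2_off_support K f f2 : closed K ->
  (forall x y : R, is_derive y (1:R) (fun s => f (x, s)) (f2 (x, y))) ->
  (forall z, ~ K z -> f z = 0) -> forall z, ~ K z -> f2 z = 0.
Proof.
move=> clK d fK [x y] Kz.
have nz : \forall s \near y, f (x, s) = 0.
  have oK : open (~` K) by exact: closed_openC.
  have nK : nbhs (x, y) (~` K) by exact: open_nbhs_nbhs.
  have ct : (fun s : R => (x, s)) s @[s --> y] --> (x, y) by exact: (cvg_pair (cvg_cst x) cvg_id).
  have h : \forall s \near y, (~` K) (x, s) := ct _ nK.
  by near=> t; apply: fK; near: t.
have dd := d x y.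
have <- := @derive_val _ _ _ _ _ _ _ dd.
have d0 : is_derive y (1:R) (fun s => f (x, s)) 0.
  apply: (@near_eq_is_derive _ _ _ (fun=> 0)).
  by apply: filterS nz => t ->.
exact: derive_val.
Unshelve. all: by end_near. Qed.

Lemma row_continuous2 f x : continuous f -> continuous (fun y => f (x, y)).
Proof.
move=> cf y; apply: (@continuous_comp _ _ _ (fun y => (x, y)) f); last exact: cf.
exact: (cvg_pair (cvg_cst x) cvg_id).
Qed.

Lemma col_continuous2 f y : continuous f -> continuous (fun x => f (x, y)).
Proof.
move=> cf x; apply: (@continuous_comp _ _ _ (fun x => (x, y)) f); last exact: cf.
exact: (cvg_pair cvg_id (cvg_cst y)).
Qed.

Lemma row_closed K x : closed K -> closed [set y | K (x, y)].
Proof.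
move=> clK; rewrite (_ : [set y | _] = (fun y => (x, y)) @^-1` K)//.
by apply: preimage_closed => // y _; exact: (cvg_pair (cvg_cst x) cvg_id).
Qed.

Lemma col_closed K y : closed K -> closed [set x | K (x, y)].
Proof.
move=> clK; rewrite (_ : [set x | _] = (fun x => (x, y)) @^-1` K)//.
by apply: preimage_closed => // x _; exact: (cvg_pair cvg_id (cvg_cst y)).
Qed.
End CompactSupport.

(** One continuous derivative along each axis is what integration by parts on lines uses, and this
    class is easily seen to contain the compositions [expR (u / 2) - 1], [profile] and
    [soft_abs]. *)
Record C1c (R : realType) (K : set (R * R)) (u u1 u2 : R * R -> R) : Prop := MkC1c {
  c1_continuous : continuous u;
  c1_continuous1 : continuous u1;
  c1_continuous2 : continuous u2;
  c1_derive1 : forall x y : R, is_derive x (1:R) (fun t => u (t, y)) (u1 (x, y));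
  c1_derive2 : forall x y : R, is_derive y (1:R) (fun s => u (x, s)) (u2 (x, y));
  c1_support : forall z, ~ K z -> u z = 0 }.

Section KnotheParts.
Variables (R : realType) (X e : R) (g : R * R -> R) (T1 a : R -> R) (T2 b : R * R -> R)
  (Om K : set (R * R)).
Local Notation mu := (@lebesgue_measure R).
Local Notation R2 := (measurableTypeR R * measurableTypeR R)%type.
Hypotheses (km : knothe_map e X g T1 a T2 b) (mOm : measurable Om) (OmX : Om `<=` box X)
  (cK : compact K) (KOm : K `<=` Om) (gK : forall z, K z -> 0 < g z).

Let clK : closed K := compact_closed2 cK.

Lemma km_T1_bound x : `|T1 x| <= 1.
Proof.
have := km_disk km (x, 0) => /=; have := sqr_ge0 (T2 (x, 0)) => h1 h2.
by rewrite -ler_sqr ?nnegrE// expr1n real_normK ?num_real//; lra.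
Qed.

Lemma km_T2_bound z : `|T2 z| <= 1.
Proof.
have := km_disk km z; have := sqr_ge0 (T1 z.1) => h1 h2.
by rewrite -ler_sqr ?nnegrE// expr1n real_normK ?num_real//; lra.
Qed.

Lemma km_bm_T1 D : bm (T := R2) D (fun z => T1 z.1).
Proof.
split; first exact: (measurableT_comp (continuous_measurable_fun (km_continuous km)) measurable_fst).
by exists 1 => z _; exact: km_T1_bound.
Qed.

Lemma km_bm_T2 D : bm (T := R2) D T2.
Proof. by split; [exact: km_measurable2 km|exists 1 => z _; exact: km_T2_bound]. Qed.

Lemma supported_bm D (f h : R * R -> R) B : continuous f -> (forall z, ~ K z -> f z = 0) ->
  measurable_fun setT (h : R2 -> R) -> (forall z, K z -> `|h z| <= B) -> bm (T := R2) D (fun z => f z * h z).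
Proof.
move=> cf fK mh hB; have [C fC] := compact_support_bounded cK cf fK.
split; first by apply: measurable_funM => //; exact: continuous_measurable2.
exists (C * `|B|) => z _; have [Kz|Kz] := pselect (K z).
  by rewrite normrM ler_pM// (le_trans (hB z Kz))// ler_norm.
by rewrite fK// mul0r normr0 mulr_ge0// (le_trans _ (fC z)).
Qed.

Lemma km_bm_a D (f : R * R -> R) : continuous f -> (forall z, ~ K z -> f z = 0) -> bm (T := R2) D (fun z => f z * a z.1).
Proof.
move=> cf fK; have [B HB] := km_bounded km cK gK.
apply: (@supported_bm D f (fun z => a z.1) B) => //.
  exact: (measurableT_comp (km_measurable_a km) measurable_fst).
by move=> z /HB[h _]; rewrite ger0_norm// (km_a_ge0 km).
Qed.

Lemma km_bm_b D (f : R * R -> R) : continuous f -> (forall z, ~ K z -> f z = 0) -> bm (T := R2) D (fun z => f z * b z).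
Proof.
move=> cf fK; have [B HB] := km_bounded km cK gK.
apply: (@supported_bm D f b B) => //; first exact: km_measurable_b km.
by move=> z /HB[_ h]; rewrite ger0_norm// (km_b_ge0 km).
Qed.

Lemma bm_continuous_supported D (f : R * R -> R) : continuous f -> (forall z, ~ K z -> f z = 0) -> bm (T := R2) D f.
Proof.
move=> cf fK; have [C fC] := compact_support_bounded cK cf fK.
by split; [exact: continuous_measurable2|exists C].
Qed.

Lemma km_parts1 f f1 f2 : C1c K f f1 f2 ->
  \int[@leb2 R]_(z in Om) (f1 z * T1 z.1 + f z * a z.1) = 0.
Proof.
move=> c1; have fK := c1_support c1; have cf := c1_continuous c1.
have f1K := deriv1_off_support clK (c1_derive1 c1) fK.
rewrite (int_box_sub OmX); last by move=> z nz; rewrite f1K ?fK ?mul0r ?addr0// => /KOm.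
rewrite fubini_box2.
  rewrite (@eq_Rintegral _ _ _ mu (seg X) (fun=> 0)) => [|y _].
    by rewrite Rintegral_cst ?mul0r//; exact: measurable_seg.
  apply: (@km_by_parts1 _ _ _ _ _ _ _ _ km y (fun x => f (x, y)) (fun x => f1 (x, y)) [set x | K (x, y)]).
  - by move=> x; exact: c1_derive1 c1 x y.
  - exact: (@col_continuous2 _ f1 y (@c1_continuous1 _ _ _ _ _ c1)).
  - exact: col_closed.
  - by move=> x; exact: gK.
  - by move=> x; exact: fK.
apply: bmD; last exact: km_bm_a.
by apply: bmM; [exact: (bm_continuous_supported _ (c1_continuous1 c1))|exact: km_bm_T1].
Qed.

Lemma km_parts2 f f1 f2 : C1c K f f1 f2 ->
  \int[@leb2 R]_(z in Om) (f2 z * T2 z + f z * b z) = 0.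
Proof.
move=> c1; have fK := c1_support c1; have cf := c1_continuous c1.
have f2K := deriv2_off_support clK (c1_derive2 c1) fK.
rewrite (int_box_sub OmX); last by move=> z nz; rewrite f2K ?fK ?mul0r ?addr0// => /KOm.
rewrite fubini_box1.
  rewrite (@eq_Rintegral _ _ _ mu (seg X) (fun=> 0)) => [|x _].
    by rewrite Rintegral_cst ?mul0r//; exact: measurable_seg.
  apply: (@km_by_parts2 _ _ _ _ _ _ _ _ km x (fun y => f (x, y)) (fun y => f2 (x, y)) [set y | K (x, y)]).
  - by move=> y; exact: c1_derive2 c1 x y.
  - exact: (@row_continuous2 _ f2 x (@c1_continuous2 _ _ _ _ _ c1)).
  - exact: row_closed.
  - by move=> y; exact: gK.
  - by move=> y; exact: fK.
apply: bmD; last exact: km_bm_b.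
by apply: bmM; [exact: (bm_continuous_supported _ (c1_continuous2 c1))|exact: km_bm_T2].
Qed.

End KnotheParts.

Lemma deficit_algebra (F : realFieldType) (p e S L : F) : p != 0 -> 1 + e != 0 ->
  p * (1 + e) / 2 * (S / (16 * p) - L + 1 / (1 + e)) =
  (1 + e) / 32 * S + p * (1 + e) / 2 * (L - 1 / (1 + e)) - p * (1 + e) * L + p.
Proof. by move=> p0 e0; field; rewrite p0 e0. Qed.

Section Deficit.
Variables (R : realType) (X e : R) (T1 a : R -> R) (T2 b : R * R -> R)
  (Om K : set (R * R)) (u u1 u2 chi : R * R -> R).
Local Notation R2 := (measurableTypeR R * measurableTypeR R)%type.
Let g z := chi z * expR (u z).
Hypotheses (e0 : 0 < e) (km : knothe_map e X g T1 a T2 b) (mOm : measurable Om) (OmX : Om `<=` box X)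
  (areaOm : leb2 Om = (pi : R)%:E)
  (cK : compact K) (KOm : K `<=` Om) (c1 : C1c K u u1 u2) (u0 : forall z, 0 <= u z)
  (cchi : continuous chi) (chi0 : forall z, 0 <= chi z) (chi1 : forall z, chi z <= 1)
  (chiK : forall z, K z -> chi z = 1) (chiOm : forall z, ~ Om z -> chi z = 0).

Local Notation I f := (\int[@leb2 R]_(z in Om) f z).
Local Notation bmO := (bm (T := R2) Om).

Let finOm : (@leb2 R Om < +oo)%E. Proof. by rewrite areaOm ltry. Qed.
Lemma intD f h : bmO f -> bmO h -> I (fun z => f z + h z) = I f + I h.
Proof. exact: (@bm_intD _ R2 R (@leb2 R) Om mOm finOm). Qed.
Lemma intB f h : bmO f -> bmO h -> I (fun z => f z - h z) = I f - I h.
Proof. exact: (@bm_intB _ R2 R (@leb2 R) Om mOm finOm). Qed.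
Lemma intZ c f : bmO f -> I (fun z => c * f z) = c * I f.
Proof. exact: (@bm_intZ _ R2 R (@leb2 R) Om mOm finOm). Qed.
Lemma int_le f h : bmO f -> bmO h -> (forall z, Om z -> f z <= h z) -> I f <= I h.
Proof. exact: (@bm_le_int _ R2 R (@leb2 R) Om mOm finOm). Qed.
Lemma int_cst c : I (fun=> c) = c * pi.
Proof. by rewrite Rintegral_cst//; congr (_ * _); exact: (congr1 fine areaOm). Qed.

Definition tau2 z : R := T1 z.1 ^+ 2 + T2 z ^+ 2.
(** The square root of the Jacobian determinant [a * b], written through [g] and [|T|^2]: in this
    form it is defined and bounded everywhere and its integrals are disk moments. *)
Definition jac z : R := Num.sqrt (g z) * (tau2 z + e) / (1 + e).
Local Notation tau := tau2.
Local Notation d := jac.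
Let w z := expR (u z / 2).
Let f z := w z - 1.

Let e1 : 0 < 1 + e. Proof. by move: e0 => h; lra. Qed.
Let gK z : K z -> 0 < g z. Proof. by move=> /chiK h; rewrite /g h mul1r expR_gt0. Qed.
Let g0 z : 0 <= g z. Proof. by rewrite mulr_ge0// expR_ge0. Qed.
Let tau0 z : 0 <= tau z. Proof. by rewrite addr_ge0// sqr_ge0. Qed.
Let tau1 z : tau z <= 1. Proof. exact: km_disk km z. Qed.
Let clK : closed K := compact_closed2 cK.
Let uK := c1_support c1.
Let cu : continuous u := @c1_continuous _ _ _ _ _ c1.
Let cu1 : continuous u1 := @c1_continuous1 _ _ _ _ _ c1.
Let cu2 : continuous u2 := @c1_continuous2 _ _ _ _ _ c1.
Let u1K := deriv1_off_support clK (c1_derive1 c1) uK.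
Let u2K := deriv2_off_support clK (c1_derive2 c1) uK.
Let w2 z : w z ^+ 2 = expR (u z). Proof. by rewrite /w -expRM_natl mulr_natl; congr expR; field. Qed.
Let w1 z : 1 <= w z. Proof. by rewrite -expR0 ler_expR divr_ge0. Qed.
Let sqrtgK z : K z -> Num.sqrt (g z) = w z.
Proof. by move=> Kz; rewrite /g chiK// mul1r -w2 sqrtr_sqr ger0_norm// (le_trans ler01). Qed.
Let sqrtg1 z : ~ K z -> Num.sqrt (g z) <= 1.
Proof. by move=> Kz; rewrite /g uK// expR0 mulr1 -sqrtr1 ler_wsqrtr. Qed.

Lemma weight_continuous : continuous w.
Proof.
move=> z; apply: (@continuous_comp _ _ _ (fun z => u z / 2) (@expR R)); last exact: continuous_expR.
by apply: cvgM; [exact: cu|exact: cvg_cst].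
Qed.

Lemma weight_C1c : C1c K f (fun z => 2^-1 * w z * u1 z) (fun z => 2^-1 * w z * u2 z).
Proof.
have cw := weight_continuous.
split.
- by move=> z; apply: cvgB; [exact: cw|exact: cvg_cst].
- move=> z; apply: cvgM; last exact: cu1.
  by apply: cvgM; [exact: cvg_cst|exact: cw].
- move=> z; apply: cvgM; last exact: cu2.
  by apply: cvgM; [exact: cvg_cst|exact: cw].
- move=> x y; have du := c1_derive1 c1 x y.
  have d2 : is_derive x (1:R) (fun t => u (t, y) / 2) (u1 (x, y) / 2).
    by apply: is_derive_eq; rewrite /GRing.scale/=; ring.
  have := @is_derive1_comp _ (@expR R) (fun t => u (t, y) / 2) x _ _ (is_derive_expR _) d2 => dd.
  rewrite /f /w; apply: is_derive_eq; rewrite subr0 /=; ring.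
- move=> x y; have du := c1_derive2 c1 x y.
  have d2 : is_derive y (1:R) (fun t => u (x, t) / 2) (u2 (x, y) / 2).
    by apply: is_derive_eq; rewrite /GRing.scale/=; ring.
  have := @is_derive1_comp _ (@expR R) (fun t => u (x, t) / 2) y _ _ (is_derive_expR _) d2 => dd.
  rewrite /f /w; apply: is_derive_eq; rewrite subr0 /=; ring.
- by move=> z /uK uz; rewrite /f /w uz mul0r expR0 subrr.
Qed.

Let g_continuous : continuous g.
Proof.
move=> z; apply: cvgM; first exact: cchi.
apply: (@continuous_comp _ _ _ u (@expR R)); [exact: cu|exact: continuous_expR].
Qed.

Lemma bm_u1 : bmO u1. Proof. exact: (bm_continuous_supported cK _ (c1_continuous1 c1) u1K). Qed.
Lemma bm_u2 : bmO u2. Proof. exact: (bm_continuous_supported cK _ (c1_continuous2 c1) u2K). Qed.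
Lemma bm_f : bmO f. Proof. exact: (bm_continuous_supported cK _ (c1_continuous weight_C1c) (c1_support weight_C1c)). Qed.

Lemma bm_w : bmO w.
Proof.
have := bmD bm_f (bm_cst Om 1); congr bm; apply/funext => z.
by rewrite /f subrK.
Qed.

Lemma bm_g : bmO g.
Proof.
have [C HC] := compact_support_bounded cK (c1_continuous c1) uK.
split; first exact: (continuous_measurable2 g_continuous).
exists (expR C) => z _; rewrite ger0_norm// /g -[leRHS]mul1r ler_pM ?expR_ge0// ler_expR.
exact: le_trans (ler_norm _) (HC z).
Qed.

Lemma bm_sqrtg : bmO (fun z => Num.sqrt (g z)).
Proof.
have [mg [C HC]] := bm_g; split.
  by apply: continuous_measurable2 => z; apply: (@continuous_comp _ _ _ g Num.sqrt); [exact: g_continuous|exact: sqrt_continuous].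
exists (Num.sqrt C) => z /HC h; rewrite ger0_norm ?sqrtr_ge0// ler_wsqrtr//.
exact: le_trans (ler_norm _) h.
Qed.

Lemma bm_T1 : bmO (fun z => T1 z.1). Proof. exact: (km_bm_T1 km). Qed.
Lemma bm_T2 : bmO T2. Proof. exact: (km_bm_T2 km). Qed.
Lemma bm_tau : bmO tau. Proof. by apply: bmD; apply: bmX; [exact: bm_T1|exact: bm_T2]. Qed.
Lemma bm_jac : bmO d.
Proof.
apply: bmM; last exact: bm_cst.
by apply: bmM; [exact: bm_sqrtg|apply: bmD; [exact: bm_tau|exact: bm_cst]].
Qed.

Lemma jac_ge0 z : 0 <= d z.
Proof.
apply: divr_ge0; last exact: ltW.
by apply: mulr_ge0; [exact: sqrtr_ge0|apply: addr_ge0; [exact: tau0|exact: ltW]].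
Qed.

Lemma jac_sqr z : d z ^+ 2 = g z * (tau z + e) ^+ 2 / (1 + e) ^+ 2.
Proof. by rewrite /jac !exprMn exprVn sqr_sqrtr. Qed.

Lemma jac_det z : a z.1 * b z = d z ^+ 2.
Proof. by rewrite jac_sqr (km_det km). Qed.

Lemma moment_Om j : (j <= 4)%N -> I (fun z => g z * (tau z + e) ^+ j) = disk_moment e j.
Proof.
move=> j4; rewrite -(km_moment km j4); apply: int_box_sub OmX _ => z nz.
by rewrite /g chiOm// !mul0r.
Qed.

Local Notation L := (ln (1 + e) - ln e).

Lemma int_g : I g = pi * (1 + e) / e.
Proof.
have := moment_Om (isT : (0 <= 4)%N); under eq_fun do rewrite expr0 mulr1.
by move=> ->; rewrite /disk_moment; field; rewrite !gt_eqF.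
Qed.

Lemma int_jac_sqr : I (fun z => d z ^+ 2) = pi.
Proof.
under eq_fun do rewrite jac_sqr mulrC.
rewrite intZ; last by apply: bmM; [exact: bm_g|apply: bmX; apply: bmD; [exact: bm_tau|exact: bm_cst]].
by rewrite moment_Om// /disk_moment; field; rewrite gt_eqF.
Qed.

Lemma int_sqrtg_jac : I (fun z => Num.sqrt (g z) * d z) = pi * (1 + e) * L.
Proof.
have E z : Num.sqrt (g z) * d z = (1 + e)^-1 * (g z * (tau z + e) ^+ 1).
  rewrite /jac expr1 -{3}(sqr_sqrtr (g0 z)); ring.
under eq_fun do rewrite E.
rewrite intZ; last by apply: bmM; [exact: bm_g|apply: bmX; apply: bmD; [exact: bm_tau|exact: bm_cst]].
by rewrite moment_Om// /disk_moment; field; rewrite gt_eqF.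
Qed.

Lemma int_g_tau : I (fun z => g z * tau z) = pi * (1 + e) ^+ 2 * (L - 1 / (1 + e)).
Proof.
have E z : g z * tau z = g z * (tau z + e) ^+ 1 - e * g z by ring.
under eq_fun do rewrite E.
rewrite intB; first last.
- by apply: bmM; [exact: bm_cst|exact: bm_g].
- by apply: bmM; [exact: bm_g|apply: bmX; apply: bmD; [exact: bm_tau|exact: bm_cst]].
rewrite intZ; last exact: bm_g.
by rewrite int_g moment_Om// /disk_moment; field; rewrite !gt_eqF.
Qed.

(* The slacks in the arithmetic-geometric mean inequality [a + b >= 2 d], in [int d <= (pi int d^2)^(1/2)]
   and in Young's inequality. *)
Definition agm_deficit : R := I (fun z => f z * (2^-1 * (a z.1 + b z) - d z)).
Definition jac_deficit : R := pi - I d.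
Definition young1 z : R := \1_K z * (u1 z + 4 * w z * T1 z.1 / (1 + e)).
Definition young2 z : R := \1_K z * (u2 z + 4 * w z * T2 z / (1 + e)).
Definition young_deficit : R := (1 + e) / 32 * I (fun z => young1 z ^+ 2 + young2 z ^+ 2).
Definition dirichlet : R := I (fun z => u1 z ^+ 2 + u2 z ^+ 2).

Lemma agm_ge z : 0 <= 2^-1 * (a z.1 + b z) - d z.
Proof.
have h1 := km_a_ge0 km z.1; have h2 := km_b_ge0 km z; have h3 := jac_ge0 z; have E := jac_det z.
rewrite subr_ge0 -ler_sqr ?nnegrE//; last by rewrite mulr_ge0// addr_ge0.
by rewrite -E; have := sqr_ge0 (a z.1 - b z); nra.
Qed.

Lemma bm_fa : bmO (fun z => f z * a z.1).
Proof. exact: (km_bm_a km cK gK _ (c1_continuous weight_C1c) (c1_support weight_C1c)). Qed.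
Lemma bm_fb : bmO (fun z => f z * b z).
Proof. exact: (km_bm_b km cK gK _ (c1_continuous weight_C1c) (c1_support weight_C1c)). Qed.

Lemma bm_agm : bmO (fun z => f z * (2^-1 * (a z.1 + b z) - d z)).
Proof.
rewrite (_ : (fun z => _) = (fun z => 2^-1 * (f z * a z.1) + 2^-1 * (f z * b z) - f z * d z)); last first.
  by apply/funext => z; ring.
apply: bmB; last by apply: bmM; [exact: bm_f|exact: bm_jac].
by apply: bmD; apply: bmM; [exact: bm_cst|exact: bm_fa|exact: bm_cst|exact: bm_fb].
Qed.

Lemma bm_1K : bmO (fun z => \1_K z : R).
Proof.
split; first by apply: measurable_indic; exact: closed_measurable2.
by exists 1 => z _; rewrite indicE; case: (_ \in _); rewrite ?normr1 ?normr0.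
Qed.

Lemma bm_young1 : bmO young1.
Proof.
apply: bmM; first exact: bm_1K.
apply: bmD; first exact: bm_u1.
apply: bmM; last exact: bm_cst.
by apply: bmM; [apply: bmM; [exact: bm_cst|exact: bm_w]|exact: bm_T1].
Qed.

Lemma bm_young2 : bmO young2.
Proof.
apply: bmM; first exact: bm_1K.
apply: bmD; first exact: bm_u2.
apply: bmM; last exact: bm_cst.
by apply: bmM; [apply: bmM; [exact: bm_cst|exact: bm_w]|exact: bm_T2].
Qed.

Lemma agm_deficit_ge0 : 0 <= agm_deficit.
Proof. by apply: Rintegral_ge0 => z _; rewrite mulr_ge0 ?agm_ge// subr_ge0. Qed.

Lemma young_deficit_ge0 : 0 <= young_deficit.
Proof.
apply: mulr_ge0; first by rewrite divr_ge0// ltW.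
apply: Rintegral_ge0 => z _.
by rewrite addr_ge0// sqr_ge0.
Qed.

(** Expansion of the square, using that [int d^2] and the area of [Om] are both [pi]. *)
Lemma jac_deficitE : I (fun z => (d z - 1) ^+ 2) = 2 * jac_deficit.
Proof.
have E z : (d z - 1) ^+ 2 = d z ^+ 2 - 2 * d z + 1 by ring.
under eq_fun do rewrite E.
have b1 : bmO (fun z => d z ^+ 2) by apply: bmX; exact: bm_jac.
have b2 : bmO (fun z => 2 * d z) by apply: bmM; [exact: bm_cst|exact: bm_jac].
rewrite intD; [|exact: bmB|exact: bm_cst].
rewrite intB// intZ; last exact: bm_jac.
by rewrite int_jac_sqr int_cst /jac_deficit; ring.
Qed.

(** On [K] this is an identity. The weights in [young1] and [young2] are those of the bubble, for
    which [grad u = - 4 x / (|x|^2 + e) = - 4 w x / (1 + e)], so that the square vanishes when [T]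
    is the identity. Off [K] one has [u = 0] and [sqrt g <= 1], so the left side is nonpositive and
    the right side nonnegative. *)
Lemma deficit_pointwise z : Om z ->
  f z * (2^-1 * (a z.1 + b z) - d z) + (1 + e) / 32 * (young1 z ^+ 2 + young2 z ^+ 2) + (Num.sqrt (g z) - 1) * d z
  <= 2^-1 * ((2^-1 * w z * u1 z * T1 z.1 + f z * a z.1) + (2^-1 * w z * u2 z * T2 z + f z * b z))
     + (1 + e) / 32 * (u1 z ^+ 2 + u2 z ^+ 2) + (2 * (1 + e))^-1 * (g z * tau z).
Proof.
move=> _; have [Kz|Kz] := pselect (K z).
  rewrite le_eqVlt; apply/orP; left; apply/eqP.
  rewrite sqrtgK// /young1 /young2 indicE mem_set// /f /tau2 -[g z](sqr_sqrtr (g0 z)) sqrtgK//.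
  have -> : (true%:R : R) = 1 by [].
  by field; rewrite gt_eqF.
rewrite /young1 /young2 indicE memNset// !mul0r u1K// u2K// /f /w uK// mul0r expR0 subrr !(mul0r, mulr0, expr0n, addr0, add0r) /=.
apply: (@le_trans _ _ 0); first by rewrite mulr_le0_ge0 ?jac_ge0// subr_le0 sqrtg1.
by apply: mulr_ge0; [rewrite invr_ge0 mulr_ge0// ltW|exact: mulr_ge0].
Qed.

(** Integrating [deficit_pointwise]: the two brackets with [a] and [b] integrate to 0, being
    integrations by parts of [f] against [T1] and [T2], and all remaining terms are disk moments,
    the Dirichlet energy or deficits. *)
Theorem deficit_bound :
  agm_deficit + jac_deficit + young_deficit <= pi * (1 + e) / 2 * (dirichlet / (16 * pi) - L + 1 / (1 + e)).
Proof.
have bsd : bmO (fun z => Num.sqrt (g z) * d z) by apply: bmM; [exact: bm_sqrtg|exact: bm_jac].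
have by12 : bmO (fun z => young1 z ^+ 2 + young2 z ^+ 2).
  by apply: bmD; apply: bmX; [exact: bm_young1|exact: bm_young2].
have bD : bmO (fun z => u1 z ^+ 2 + u2 z ^+ 2).
  by apply: bmD; apply: bmX; [exact: bm_u1|exact: bm_u2].
have bgt : bmO (fun z => g z * tau z) by apply: bmM; [exact: bm_g|exact: bm_tau].
have bp1 : bmO (fun z => 2^-1 * w z * u1 z * T1 z.1 + f z * a z.1).
  apply: bmD; last exact: bm_fa.
  by apply: bmM; [apply: bmM; [apply: bmM; [exact: bm_cst|exact: bm_w]|exact: bm_u1]|exact: bm_T1].
have bp2 : bmO (fun z => 2^-1 * w z * u2 z * T2 z + f z * b z).
  apply: bmD; last exact: bm_fb.
  by apply: bmM; [apply: bmM; [apply: bmM; [exact: bm_cst|exact: bm_w]|exact: bm_u2]|exact: bm_T2].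
have bZ c h : bmO h -> bmO (fun z => c * h z) by move=> bh; apply: bmM => //; exact: bm_cst.
have bs1 : bmO (fun z => (Num.sqrt (g z) - 1) * d z).
  by apply: bmM; [apply: bmB; [exact: bm_sqrtg|exact: bm_cst]|exact: bm_jac].
pose lhs z := f z * (2^-1 * (a z.1 + b z) - d z) + (1 + e) / 32 * (young1 z ^+ 2 + young2 z ^+ 2) + (Num.sqrt (g z) - 1) * d z.
pose rhs z := 2^-1 * ((2^-1 * w z * u1 z * T1 z.1 + f z * a z.1) + (2^-1 * w z * u2 z * T2 z + f z * b z))
     + (1 + e) / 32 * (u1 z ^+ 2 + u2 z ^+ 2) + (2 * (1 + e))^-1 * (g z * tau z).
have bl : bmO lhs by apply: bmD; [apply: bmD; [exact: bm_agm|exact: bZ]|exact: bs1].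
have br : bmO rhs by apply: bmD; [apply: bmD; apply: bZ; [exact: (bmD bp1 bp2)|exact: bD]|exact: bZ].
have h := int_le bl br deficit_pointwise.
have Il : I lhs = agm_deficit + young_deficit + (pi * (1 + e) * L - I d).
  rewrite /lhs intD; [|apply: bmD; [exact: bm_agm|exact: bZ]|exact: bs1].
  rewrite intD; [|exact: bm_agm|exact: bZ].
  congr (_ + _ + _); first by rewrite intZ.
  have E z : (Num.sqrt (g z) - 1) * d z = Num.sqrt (g z) * d z - d z by ring.
  under eq_fun do rewrite E.
  by rewrite intB//; [rewrite int_sqrtg_jac|exact: bm_jac].
have Ir : I rhs = 2^-1 * (0 + 0) + (1 + e) / 32 * dirichlet + (2 * (1 + e))^-1 * (pi * (1 + e) ^+ 2 * (L - 1 / (1 + e))).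
  rewrite /rhs intD; [|apply: bmD; apply: bZ; [exact: (bmD bp1 bp2)|exact: bD]|exact: bZ].
  rewrite intD; [|apply: bZ; exact: (bmD bp1 bp2)|exact: bZ].
  congr (_ + _ + _).
  - rewrite intZ; last exact: (bmD bp1 bp2).
    rewrite intD//; congr (_ * (_ + _)).
      exact: (km_parts1 km OmX cK KOm gK weight_C1c).
    exact: (km_parts2 km OmX cK KOm gK weight_C1c).
  - by rewrite intZ.
  - by rewrite intZ// int_g_tau.
rewrite Il Ir in h.
have p0 := pi_gt0 R.
have E : (2 * (1 + e))^-1 * (pi * (1 + e) ^+ 2 * (L - 1 / (1 + e))) = pi * (1 + e) / 2 * (L - 1 / (1 + e)).
  by field; rewrite gt_eqF.
rewrite E in h.
have -> : pi * (1 + e) / 2 * (dirichlet / (16 * pi) - L + 1 / (1 + e)) = (1 + e) / 32 * dirichlet + pi * (1 + e) / 2 * (L - 1 / (1 + e)) - pi * (1 + e) * L + pi.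
  have p1 : pi != 0 :> R by apply: lt0r_neq0.
  have p2 : 1 + e != 0 by apply: lt0r_neq0.
  exact: deficit_algebra.
rewrite /jac_deficit; lra.
Qed.

(* With [v = exp (- u / 2)], the transport map of an optimal [u] is the identity and [profile] is [1 - |x|^2]. *)
Definition profile z : R := (1 + e) * (1 - expR (- (u z / 2))).
Definition profile1 z : R := (1 + e) / 2 * expR (- (u z / 2)) * u1 z.
Definition profile2 z : R := (1 + e) / 2 * expR (- (u z / 2)) * u2 z.
Local Notation W := profile.
Local Notation W1 := profile1.
Local Notation W2 := profile2.
Let v z := expR (- (u z / 2)).
Let v0 z : 0 < v z. Proof. exact: expR_gt0. Qed.
Let v1 z : v z <= 1. Proof. by rewrite /v -expR0 ler_expR oppr_le0 divr_ge0. Qed.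
Let vw z : v z * w z = 1. Proof. by rewrite /v /w mulrC -expRD addrN expR0. Qed.

Lemma profile_C1c : C1c K W W1 W2.
Proof.
have cv : continuous v.
  move=> z; apply: (@continuous_comp _ _ _ (fun z => - (u z / 2)) (@expR R)); last exact: continuous_expR.
  by apply: cvgN; apply: cvgM; [exact: cu|exact: cvg_cst].
split.
- move=> z; apply: cvgM; first exact: cvg_cst.
  by apply: cvgB; [exact: cvg_cst|exact: cv].
- move=> z; apply: cvgM; last exact: cu1.
  by apply: cvgM; [exact: cvg_cst|exact: cv].
- move=> z; apply: cvgM; last exact: cu2.
  by apply: cvgM; [exact: cvg_cst|exact: cv].
- move=> x y; have du := c1_derive1 c1 x y.
  have d2 : is_derive x (1:R) (fun t => - (u (t, y) / 2)) (- (u1 (x, y) / 2)).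
    by apply: is_derive_eq; rewrite /GRing.scale/=; ring.
  have := @is_derive1_comp _ (@expR R) (fun t => - (u (t, y) / 2)) x _ _ (is_derive_expR _) d2 => dd.
  rewrite /profile /profile1; apply: is_derive_eq; rewrite /GRing.scale /=; ring.
- move=> x y; have du := c1_derive2 c1 x y.
  have d2 : is_derive y (1:R) (fun t => - (u (x, t) / 2)) (- (u2 (x, y) / 2)).
    by apply: is_derive_eq; rewrite /GRing.scale/=; ring.
  have := @is_derive1_comp _ (@expR R) (fun t => - (u (x, t) / 2)) y _ _ (is_derive_expR _) d2 => dd.
  rewrite /profile /profile2; apply: is_derive_eq; rewrite /GRing.scale /=; ring.
- by move=> z /uK uz; rewrite /profile uz mul0r oppr0 expR0 subrr mulr0.
Qed.

Let cW : continuous W := @c1_continuous _ _ _ _ _ profile_C1c.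
Let cW1 : continuous W1 := @c1_continuous1 _ _ _ _ _ profile_C1c.
Let cW2 : continuous W2 := @c1_continuous2 _ _ _ _ _ profile_C1c.
Let WK := c1_support profile_C1c.
Let W1K := deriv1_off_support clK (c1_derive1 profile_C1c) WK.
Let W2K := deriv2_off_support clK (c1_derive2 profile_C1c) WK.
Let bW D : bm (T := R2) D W. Proof. exact: (bm_continuous_supported cK D (c1_continuous profile_C1c) WK). Qed.
Let bW1 D : bm (T := R2) D W1. Proof. exact: (bm_continuous_supported cK D (c1_continuous1 profile_C1c) W1K). Qed.
Let bW2 D : bm (T := R2) D W2. Proof. exact: (bm_continuous_supported cK D (c1_continuous2 profile_C1c) W2K). Qed.

Let W0 z : 0 <= W z. Proof. by apply: mulr_ge0; [exact: ltW|rewrite subr_ge0; exact: v1]. Qed.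

(** * Consequences of small deficits *)

Hypothesis e_le1 : e <= 1.
Variable kap : R.
Hypotheses (X0 : 0 < X) (k0 : 0 < kap) (k1 : kap <= 1) (agm_le : agm_deficit <= kap ^+ 2)
  (jac_le : jac_deficit <= kap ^+ 2) (young_le : young_deficit <= kap ^+ 2).

Lemma profile_le2 z : W z <= 2.
Proof. by rewrite /profile -/(v z); move: (v0 z) e_le1 e0 => h h1 h2; nra. Qed.

Let bW' := bW Om. Let bd := bm_jac. Let bT1 := bm_T1. Let bT2 := bm_T2. Let btau := bm_tau.

(** The deficits are of order [kap^2] and control squares; this splitting turns them into bounds of
    order [kap] on first powers. *)
Lemma norm_split x : `|x| <= kap / 2 + (2 * kap)^-1 * x ^+ 2 :> R.
Proof.
rewrite -subr_ge0 (_ : _ - _ = (2 * kap)^-1 * (kap - `|x|) ^+ 2); last first.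
  by rewrite -(real_normK (num_real x)); field; rewrite gt_eqF.
by rewrite mulr_ge0 ?sqr_ge0// invr_ge0 mulr_ge0// ltW.
Qed.

Lemma int_norm_split h C : bmO h -> I (fun z => h z ^+ 2) <= C * kap ^+ 2 ->
  I (fun z => `|h z|) <= kap * (pi / 2 + C / 2).
Proof.
move=> bh hC.
have := @int_le (fun z => `|h z|) (fun z => kap / 2 + (2 * kap)^-1 * h z ^+ 2).
move=> /(_ ltac:(bm_auto) ltac:(bm_auto) (fun z _ => norm_split (h z))) /le_trans; apply.
rewrite intD; [|by bm_auto|by bm_auto].
rewrite int_cst intZ; last by bm_auto.
have : (2 * kap)^-1 * I (fun z => h z ^+ 2) <= (2 * kap)^-1 * (C * kap ^+ 2).
  by rewrite ler_wpM2l// invr_ge0 mulr_ge0// ltW.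
have -> : (2 * kap)^-1 * (C * kap ^+ 2) = kap * (C / 2) by field; rewrite gt_eqF.
set J := (X in X <= _) => J1.
have -> : kap * (pi / 2 + C / 2) = kap / 2 * pi + kap * (C / 2) by move: (pi : R) => q; ring.
by rewrite lerD2l.
Qed.

Lemma jac_dev : I (fun z => `|d z - 1|) <= kap * (pi / 2 + 1).
Proof.
have := @int_norm_split (fun z => d z - 1) 2 ltac:(bm_auto).
rewrite (_ : 2 / 2 = 1 :> R); last by field.
by apply; rewrite jac_deficitE ler_wpM2l.
Qed.

Lemma jac_dev_sqr : I (fun z => (d z - 1) ^+ 2) <= 2 * kap ^+ 2.
Proof. by rewrite jac_deficitE ler_wpM2l. Qed.

Lemma int_jac_le : I d <= pi.
Proof.
have : 0 <= I (fun z => (d z - 1) ^+ 2) by apply: Rintegral_ge0 => z _; exact: sqr_ge0.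
by rewrite jac_deficitE pmulr_rge0// /jac_deficit subr_ge0.
Qed.

(** On [K], [(1 + e) * v * d = |T|^2 + e] because [v * w = 1], so the difference is exactly
    [(1 + e) * v * (d - 1)]. Off [K], [W = 0] and the root [s] of [g] is at most 1: either [s] is
    below 1/2 and [d] is far from 1, or [1 - |T|^2] is comparable with [1 - d]. *)
Lemma tau_profile z : Om z -> `|tau z - (1 - W z)| <= 4 * `|d z - 1|.
Proof.
move=> _; move: e_le1 e0 (tau0 z) (tau1 z) => he1 he0 t0 t1.
have [Kz|Kz] := pselect (K z).
  have -> : tau z - (1 - W z) = (1 + e) * v z * (d z - 1).
    have E : (1 + e) * v z * d z = (v z * w z) * (tau z + e).
      by rewrite /jac sqrtgK//; field; rewrite gt_eqF.
    rewrite mulrBr E vw mul1r mulr1 /profile -/(v z); ring.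
  rewrite normrM ler_wpM2r// ger0_norm; last by rewrite mulr_ge0// ltW.
  by move: (v0 z) (v1 z) => h1 h2; nra.
rewrite WK// subr0 /jac; set s := Num.sqrt _.
have s0 : 0 <= s by exact: sqrtr_ge0.
have s1 : s <= 1 by exact: sqrtg1.
rewrite distrC [X in 4 * X]distrC ger0_norm; last by rewrite subr_ge0.
set q := s * _ / _.
have q1 : q <= s by rewrite /q ler_pdivrMr// ler_wpM2l// lerD2r.
have qE : (1 + e) * q = s * (tau z + e) by rewrite /q mulrC divfK// gt_eqF.
rewrite ger0_norm; last by rewrite subr_ge0 (le_trans q1).
have [sl|sl] := leP (1 / 2) s; last by lra.
have : (1 + e) * (1 - q) >= s * (1 - tau z) by rewrite [leRHS]mulrBr qE mulr1; nra.
by nra.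
Qed.

(** The error in [grad W = - 2 T]. By [R1E] it is [young1] times a factor between 0 and 1, hence
    small by the Young deficit. *)
Let R1 z : R := \1_K z * (W1 z + 2 * T1 z.1).
Let R2' z : R := \1_K z * (W2 z + 2 * T2 z).
Let b1K : bmO (fun z => \1_K z : R) := bm_1K.
Let bR1 : bmO R1. Proof. by apply: bmM => //; apply: bmD => //; apply: bmM => //; exact: bm_cst. Qed.
Let bR2 : bmO R2'. Proof. by apply: bmM => //; apply: bmD => //; apply: bmM => //; exact: bm_cst. Qed.

Let R1E z : R1 z = (1 + e) / 2 * v z * young1 z.
Proof.
have -> : R1 z = \1_K z * (W1 z + v z * w z * (2 * T1 z.1)) by rewrite vw mul1r.
rewrite /young1 /profile1 -/(v z); field.
by rewrite gt_eqF.
Qed.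
Let R2E z : R2' z = (1 + e) / 2 * v z * young2 z.
Proof.
have -> : R2' z = \1_K z * (W2 z + v z * w z * (2 * T2 z)) by rewrite vw mul1r.
rewrite /young2 /profile2 -/(v z); field.
by rewrite gt_eqF.
Qed.
Let Rfac z : 0 <= (1 + e) / 2 * v z <= 1.
Proof.
move: e_le1 e0 (v0 z) (v1 z) => he1 he0 h0 h1; apply/andP; split; last by nra.
by apply: mulr_ge0; lra.
Qed.

Lemma young_sqr : I (fun z => young1 z ^+ 2 + young2 z ^+ 2) <= 32 * kap ^+ 2.
Proof.
have := young_le; rewrite /young_deficit; set J := Rintegral _ _ _ => h.
have J0 : 0 <= J by apply: Rintegral_ge0 => z _; rewrite addr_ge0// sqr_ge0.
by move: e0 => h0; nra.
Qed.

Let R1sqr : I (fun z => R1 z ^+ 2) <= 32 * kap ^+ 2.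
Proof.
have b1 := bm_young1; have b2 := bm_young2.
apply: le_trans young_sqr; apply: int_le; [by bm_auto|by bm_auto|move=> z _].
rewrite R1E exprMn; have /andP[h1 h2] := Rfac z.
have : ((1 + e) / 2 * v z) ^+ 2 <= 1 by rewrite expr_le1.
by move: (sqr_ge0 (young1 z)) (sqr_ge0 (young2 z)) => s1 s2 s3; nra.
Qed.
Let R2sqr : I (fun z => R2' z ^+ 2) <= 32 * kap ^+ 2.
Proof.
have b1 := bm_young1; have b2 := bm_young2.
apply: le_trans young_sqr; apply: int_le; [by bm_auto|by bm_auto|move=> z _].
rewrite R2E exprMn; have /andP[h1 h2] := Rfac z.
have : ((1 + e) / 2 * v z) ^+ 2 <= 1 by rewrite expr_le1.
by move: (sqr_ge0 (young1 z)) (sqr_ge0 (young2 z)) => s1 s2 s3; nra.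
Qed.

Let s3 : R := I (fun z => `|R1 z|).
Let s3_le : s3 <= kap * (pi / 2 + 16).
Proof.
have := int_norm_split bR1 R1sqr; rewrite (_ : 32 / 2 = 16 :> R)//; by field.
Qed.
Let s3'_le : I (fun z => `|R2' z|) <= kap * (pi / 2 + 16).
Proof.
have := int_norm_split bR2 R2sqr; rewrite (_ : 32 / 2 = 16 :> R)//; by field.
Qed.
Let s3_ge0 : 0 <= s3. Proof. by apply: Rintegral_ge0. Qed.

Let bWa : bmO (fun z => W z * a z.1).
Proof. exact: (km_bm_a km cK gK Om (c1_continuous profile_C1c) WK). Qed.
Let bWb : bmO (fun z => W z * b z).
Proof. exact: (km_bm_b km cK gK Om (c1_continuous profile_C1c) WK). Qed.

Let Ws z := W z * (a z.1 + b z - 2 * d z).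
Let bWs : bmO Ws.
Proof.
rewrite (_ : Ws = fun z => W z * a z.1 + W z * b z - 2 * (W z * d z)); last by apply/funext => z; rewrite /Ws; ring.
by bm_auto.
Qed.
Let Ws_ge0 z : 0 <= Ws z.
Proof. by apply: mulr_ge0 => //; have := agm_ge z; lra. Qed.

Let Ws_le : I Ws <= 4 * kap ^+ 2.
Proof.
have bag := bm_agm.
apply: (@le_trans _ _ (4 * agm_deficit)); last by rewrite ler_wpM2l.
rewrite /agm_deficit -intZ//; apply: int_le => //; first by bm_auto.
move=> z _; rewrite /Ws.
have h : 0 <= a z.1 + b z - 2 * d z by have := agm_ge z; lra.
have Wf : W z <= 2 * f z.
  have : W z = (1 + e) * v z * f z by rewrite /profile -/(v z) /f -[RHS]mulrA [v z * _]mulrBr vw mulr1.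
  move=> ->; have /andP[h1 h2] := Rfac z; have f0 : 0 <= f z by rewrite subr_ge0.
  by nra.
by apply: (le_trans (ler_wpM2r h Wf)); lra.
Qed.

Let Wa_le : I (fun z => W z * a z.1) <= 4 + 4 * pi.
Proof.
apply: (@le_trans _ _ (I (fun z => Ws z + 4 * d z))).
  apply: int_le; [by []|by bm_auto|move=> z _].
  rewrite /Ws; have := profile_le2 z; have := W0 z; have := km_b_ge0 km z; have := jac_ge0 z => h1 h2 h3 h4.
  by nra.
rewrite intD; [|by bm_auto|by bm_auto]; rewrite intZ//.
have := int_jac_le; have := Ws_le; have : kap ^+ 2 <= 1 by rewrite expr_le1// ltW.
move: (I Ws) (I d) (pi : R) => p1 p2 p3; lra.
Qed.

Let bWa1 D : bm (T := R2) D (fun z => W z * `|a z.1 - 1|).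
Proof.
have h := bmB (km_bm_a km cK gK D (c1_continuous profile_C1c) WK) (bW D).
have := bm_norm h; congr bm; apply/funext => z.
by rewrite -[X in X - _]/(W z * a z.1) -{2}[W z]mulr1 -mulrBr normrM ger0_norm.
Qed.

Let s2 : R := I (fun z => W z * `|a z.1 - 1|).
(** Since [d^2 = a * b], one has [(a - d)^2 = a * (a + b - 2 * d)]: the slack of the
    arithmetic-geometric mean inequality bounds [a - d], with [int W a] under control by [Wa_le],
    and [d] is close to 1 by [jac_dev]. *)
Lemma stretch_dev : s2 <= kap * (6 + 3 * pi).
Proof.
apply: (@le_trans _ _ (I (fun z => kap / 2 * (W z * a z.1) + (2 * kap)^-1 * Ws z + 2 * `|d z - 1|))).
  apply: int_le; [exact: bWa1|by bm_auto|move=> z _].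
  have h : `|a z.1 - d z| <= kap / 2 * a z.1 + (2 * kap)^-1 * (a z.1 + b z - 2 * d z).
    have A0 := km_a_ge0 km z.1; have S0 : 0 <= a z.1 + b z - 2 * d z by have := agm_ge z; lra.
    have ik : 0 <= (2 * kap)^-1 by rewrite invr_ge0 mulr_ge0// ltW.
    have E : (a z.1 - d z) ^+ 2 = a z.1 * (a z.1 + b z - 2 * d z) by rewrite sqrrB -jac_det; ring.
    rewrite -ler_sqr ?nnegrE//; last by apply: addr_ge0; apply: mulr_ge0 => //; apply: mulr_ge0 => //; exact: ltW.
    rewrite real_normK ?num_real// E.
    rewrite -subr_ge0 (_ : _ - _ = (kap / 2 * a z.1 - (2 * kap)^-1 * (a z.1 + b z - 2 * d z)) ^+ 2) ?sqr_ge0//.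
    by field; rewrite gt_eqF.
  have h2 : `|a z.1 - 1| <= `|a z.1 - d z| + `|d z - 1| by have := ler_normD (a z.1 - d z) (d z - 1); rewrite subrKA.
  rewrite /Ws; have w0 := W0 z; have w2' := profile_le2 z.
  apply: (le_trans (ler_wpM2l w0 (le_trans h2 (lerD h (lexx _))))).
  rewrite mulrDr; apply: lerD; last by rewrite ler_wpM2r.
  by rewrite le_eqVlt; apply/orP; left; apply/eqP; ring.
rewrite intD; [|by bm_auto|by bm_auto]; rewrite intD; [|by bm_auto|by bm_auto].
rewrite !intZ//; last by bm_auto.
have h1 : kap / 2 * I (fun z => W z * a z.1) <= kap / 2 * (4 + 4 * pi) by rewrite ler_wpM2l// divr_ge0// ltW.
have h2 : (2 * kap)^-1 * I Ws <= (2 * kap)^-1 * (4 * kap ^+ 2).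
  by apply: ler_wpM2l; [rewrite invr_ge0 mulr_ge0// ltW|exact: Ws_le].
have h3 := jac_dev.
have E : (2 * kap)^-1 * (4 * kap ^+ 2) = 2 * kap by field; rewrite gt_eqF.
move: h1 h2 h3; rewrite E.
move: (Rintegral _ _ _) (Rintegral _ _ _) (Rintegral _ _ _) (pi : R) => p1 p2 p3 p4; lra.
Qed.

Let IboxE h : (forall z, ~ K z -> h z = 0) -> I h = \int[@leb2 R]_(z in box X) h z.
Proof. by move=> hK; apply: int_box_sub OmX _ => z nz; apply: hK => /KOm. Qed.

Let W_off z : ~ box X z -> W z = 0. Proof. by move=> nz; apply: WK => /KOm /OmX. Qed.

Let F x : R := \int[@lebesgue_measure R]_(y in seg X) W (x, y).
Let F_ge0 x : 0 <= F x. Proof. exact: Rintegral_ge0. Qed.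
Let F_bm D : bm (T := measurableTypeR R) D F.
Proof.
have F0 x : ~ seg X x -> F x = 0.
  move=> nx; rewrite /F (@eq_Rintegral _ _ _ (@lebesgue_measure R) (seg X) (fun=> 0)) => [|y _].
    by rewrite Rintegral_cst ?mul0r//; exact: measurable_seg.
  by apply: W_off => -[].
split.
  rewrite (_ : F = F \_ (seg X)).
    by apply: (@measurable_restrictT _ _ (measurableTypeR R) (measurableTypeR R) _ F (measurable_seg X)).1; exact: (measurable_inner_int (bW (box X))).
  by apply/funext => x; rewrite patchE; case: ifPn => //; rewrite notin_setE => /F0.
exists (2 * fine (@lebesgue_measure R (seg X))) => x _; rewrite ger0_norm//.
rewrite -(Rintegral_cst (@lebesgue_measure R) (measurable_seg X)).
have [sx|nx] := pselect (seg X x).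
  apply: (@bm_le_int _ (measurableTypeR R) R (@lebesgue_measure R) (seg X) (measurable_seg X) (seg_fin X)).
  - exact: (bm_row (bW (box X)) sx).
  - exact: bm_cst.
  - by move=> y _; exact: profile_le2.
by rewrite F0//; apply: Rintegral_ge0.
Qed.

Let sub_itv p q : - X <= p -> q <= X -> `[p, q]%classic `<=` seg X.
Proof. by move=> pX qX x /=; rewrite /seg /= !in_itv/= => /andP[h1 h2]; rewrite (le_trans pX h1) (le_trans h2 qX). Qed.

Let int_seg_itv p q (h : R -> R) : - X <= p -> q <= X ->
  \int[@lebesgue_measure R]_(x in seg X) (\1_`[p, q]%classic x * h x) = \int[@lebesgue_measure R]_(x in `[p, q]) h x.
Proof.
move=> pX qX; rewrite Rintegral_mkcond [RHS]Rintegral_mkcond; congr Rintegral; apply/funext => x.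
rewrite !patchE indicE; case: (boolP (x \in `[p, q]%classic)) => xp.
  rewrite ifT ?mul1r//; rewrite inE in xp; rewrite inE; exact: (sub_itv pX qX xp).
by rewrite mul0r; case: ifP.
Qed.

Let bm_itv D p q : bm (T := R2) D (fun z => \1_`[p, q]%classic z.1 : R).
Proof.
split; last by exists 1 => z _; rewrite indicE; case: (_ \in _); rewrite ?normr1 ?normr0.
by apply: (measurableT_comp _ measurable_fst); apply: measurable_indic; exact: measurable_itv.
Qed.

(* [F] varies in the wrong direction by at most [s3]: it is almost unimodal about the zero of [T1]. *)
Let drift (sg p q : R) : - X <= p -> p <= q -> q <= X -> `|sg| = 1 ->
  (forall t, p <= t <= q -> sg * T1 t <= 0) -> - s3 <= sg * (F q - F p).
Proof.
move=> pX pq qX sg1 sgT.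
have bR1' : bm (T := R2) (box X) R1.
  have [m1 _] := bm_1K; have : bm (T := R2) (box X) (fun z => \1_K z : R).
    by split=> //; exists 1 => z _; rewrite indicE; case: (_ \in _); rewrite ?normr1 ?normr0.
  have := km_bm_T1 km (box X); have := bW1 (box X) => ? ? ?.
  by rewrite /R1; bm_auto.
have bI := @bm_itv (box X) p q; have bW1b := bW1 (box X).
have FE : F q - F p = \int[@leb2 R]_(z in box X) (\1_`[p, q]%classic z.1 * W1 z).
  rewrite fubini_box2; last by bm_auto.
  rewrite /F -(@bm_intB _ (measurableTypeR R) R (@lebesgue_measure R) (seg X) (measurable_seg X) (seg_fin X)).
  - apply: eq_Rintegral => y _; rewrite int_seg_itv//.
    exact/esym/(FTC2 pq (@col_continuous2 _ W1 y cW1) (fun x => c1_derive1 profile_C1c x y)).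
  - by apply: bm_row (bW (box X)) _; rewrite /seg /= in_itv /=; rewrite (le_trans pX pq) qX.
  - by apply: bm_row (bW (box X)) _; rewrite /seg /= in_itv /=; rewrite pX (le_trans pq qX).
rewrite FE -(@bm_intZ _ R2 R (@leb2 R) (box X) (measurable_box X) (box_fin X)); last by bm_auto.
have -> : - s3 = \int[@leb2 R]_(z in box X) (-1 * `|R1 z|).
  rewrite (@bm_intZ _ R2 R (@leb2 R) (box X) (measurable_box X) (box_fin X)); last by bm_auto.
  rewrite /s3 IboxE ?mulN1r// => z Kz.
  by rewrite /R1 indicE memNset// mul0r normr0.
apply: (@bm_le_int _ R2 R (@leb2 R) (box X) (measurable_box X) (box_fin X)); [by bm_auto|by bm_auto|move=> z _].
rewrite mulN1r indicE; case: (boolP (z.1 \in _)) => xp; last by rewrite mul0r mulr0 oppr_le0.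
rewrite mul1r; have [Kz|Kz] := pselect (K z); last by rewrite W1K// mulr0 oppr_le0.
rewrite inE /= in_itv /= in xp.
have -> : `|R1 z| = `|sg * (W1 z + 2 * T1 z.1)| by rewrite [RHS]normrM sg1 mul1r /R1 indicE mem_set// mul1r.
have := sgT _ xp; have := ler_norm (- (sg * (W1 z + 2 * T1 z.1))); rewrite normrN; move: (T1 z.1) (W1 z) (`|_|); move=> *; lra.
Qed.

(** [T1] has derivative [a] on [[p, q]], as a column with [F > 0] meets the set where [g] is
    positive. Then [m] times the integral of [|a - 1|] is at most its integral against [F], which
    Fubini bounds by [s2], plus [s3] times the integral of [a + 1]. *)
Let disp (p q m : R) : - X <= p -> p <= q -> q <= X -> 0 <= m -> T1 q - T1 p <= 1 ->
  (forall t, p <= t <= q -> 0 < F t) -> (forall t, p <= t <= q -> m <= F t + s3) ->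
  m * `|T1 q - T1 p - (q - p)| <= s2 + s3 * (2 * X + 1).
Proof.
move=> pX pq qX m0 T1pq Fpos mF.
pose mu := @lebesgue_measure R.
pose D : set R := `[p, q]%classic.
have mD : measurable D by exact: measurable_itv.
have finD : (mu D < +oo)%E by rewrite /mu /D lebesgue_measure_itv/=; case: ifP => _; rewrite ?ltry// -EFinB ltry.
have gpos t : p <= t <= q -> exists y, 0 < g (t, y).
  move=> /Fpos Ft; apply: contrapT => /forallNP nh; move: Ft; rewrite /F.
  rewrite (@eq_Rintegral _ _ _ mu (seg X) (fun=> 0)) => [|y _].
    by rewrite Rintegral_cst ?mul0r ?ltxx//; exact: measurable_seg.
  by apply: WK => /gK; exact: nh.
have ca t : p <= t <= q -> {for t, continuous a} by move=> /gpos[y]; exact: km_a_continuous km t y.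
have da t : p <= t <= q -> is_derive t (1:R) T1 (a t) by move=> /gpos[y]; exact: km_derive km t y.
have ba : bm (T := measurableTypeR R) D a.
  split; first exact: km_measurable_a km.
  have cwa : {within D, continuous a}.
    by apply: continuous_in_subspaceT => t; rewrite inE /D /= in_itv /= => /ca.
  have [B [_ HB]] := compact_bounded (continuous_compact cwa (@segment_compact _ p q)).
  by exists (B + 1) => x Dx; apply: (HB (B + 1)); [lra|exists x].
have baN : bm (T := measurableTypeR R) D (fun x => `|a x - 1|) by bm_auto.
have FD := F_bm D.
have iT : \int[mu]_(x in D) (a x - 1) = T1 q - T1 p - (q - p).
  rewrite (@bm_intB _ (measurableTypeR R) R mu D mD finD)//; last exact: bm_cst.
  rewrite (FTC2in pq ca da) (FTC2in (F := id) pq)//.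
  by move=> x _; exact: cvg_cst.
have iA : \int[mu]_(x in D) `|a x - 1| <= 2 * X + 1.
  apply: (@le_trans _ _ (\int[mu]_(x in D) (a x + 1))).
    apply: (@bm_le_int _ (measurableTypeR R) R mu D mD finD) => //; first by bm_auto.
    by move=> x _; have h := km_a_ge0 km x; rewrite ler_norml; apply/andP; split; lra.
  rewrite (@bm_intD _ (measurableTypeR R) R mu D mD finD)//; last exact: bm_cst.
  rewrite (FTC2in pq ca da) (FTC2in (F := id) pq)//; first by lra.
  by move=> x _; exact: cvg_cst.
have iA0 : 0 <= \int[mu]_(x in D) `|a x - 1| by apply: Rintegral_ge0.
have nT : `|T1 q - T1 p - (q - p)| <= \int[mu]_(x in D) `|a x - 1|.
  rewrite -iT; apply: le_normr_Rintegral => //.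
  by apply: (@bm_integrable _ (measurableTypeR R) R mu D mD finD); bm_auto.
apply: (le_trans (ler_wpM2l m0 nT)).
rewrite -(@bm_intZ _ (measurableTypeR R) R mu D mD finD)//.
apply: (@le_trans _ _ (\int[mu]_(x in D) (`|a x - 1| * F x + s3 * `|a x - 1|))).
  apply: (@bm_le_int _ (measurableTypeR R) R mu D mD finD); [by bm_auto|by bm_auto|move=> x].
  rewrite /D /= in_itv /= => /mF h; by rewrite [s3 * _]mulrC -mulrDr [m * _]mulrC ler_wpM2l.
rewrite (@bm_intD _ (measurableTypeR R) R mu D mD finD); [|by bm_auto|by bm_auto].
rewrite (@bm_intZ _ (measurableTypeR R) R mu D mD finD)//.
apply: lerD; last by apply: ler_wpM2l.
have bI := @bm_itv (box X) p q; have bb := bWa1 (box X).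
have -> : \int[mu]_(x in D) (`|a x - 1| * F x) = \int[@leb2 R]_(z in box X) (\1_`[p, q]%classic z.1 * (W z * `|a z.1 - 1|)).
  rewrite fubini_box1; last by bm_auto.
  rewrite -int_seg_itv//; apply: eq_Rintegral => x; rewrite inE => sx.
  rewrite /= /F -(@bm_intZ _ (measurableTypeR R) R mu (seg X) (measurable_seg X) (seg_fin X)).
    rewrite -(@bm_intZ _ (measurableTypeR R) R mu (seg X) (measurable_seg X) (seg_fin X)).
      by apply: eq_Rintegral => y _; ring.
    have h := bm_row (bW (box X)) sx; by bm_auto.
  exact: bm_row (bW (box X)) sx.
rewrite /s2 IboxE => [|z Kz]; last by rewrite WK// mul0r.
apply: (@bm_le_int _ R2 R (@leb2 R) (box X) (measurable_box X) (box_fin X)); [by bm_auto|by []|move=> z _].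
have h : 0 <= W z * `|a z.1 - 1| by apply: mulr_ge0.
by rewrite indicE; case: (_ \in _); rewrite ?mul1r ?mul0r.
Qed.

Let seg_len : fine (@lebesgue_measure R (seg X)) = 2 * X.
Proof.
rewrite /seg lebesgue_measure_itv/= lte_fin ifT; last by move: X0 => h; lra.
by rewrite opprK -EFinD /=; ring.
Qed.

(** [c] is a zero of [T1], which runs from -1 to 1. Near unimodality of [F] about [c] lets the value
    [F x] bound [F] from below, up to [s3], all the way from [x] to [c]; [disp] then compares [T1 x]
    with [x - c], and [grad W = - 2 T] is inserted with error [R1]. *)
Lemma first_coordinate : exists2 c : R, `|c| <= X &
  I (fun z => W z * (W1 z + 2 * (z.1 - c)) ^+ 2) <=
    kap * (128 + 16 * X * (2 * X + 1) * (6 + 3 * pi + (pi / 2 + 16) * (2 * X + 1))).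
Proof.
move: X0 => hX0.
have [c cX Tc] : exists2 c, c \in `[- X, X] & T1 c = 0.
  apply: IVT; first by lra.
    exact: continuous_subspaceT (km_continuous km).
  by rewrite (km_left km) (km_right km) ge_min le_max; apply/andP; split; apply/orP; [left|right]; lra.
rewrite in_itv /= in cX; have /andP[c0 c1'] := cX.
exists c; first by rewrite ler_norml cX.
set Q := s2 + s3 * (2 * X + 1).
have key x : seg X x -> F x * `|T1 x - (x - c)| <= Q.
  rewrite /seg /= in_itv /= => /andP[x0 x1].
  have T1x := km_T1_bound km x.
  (* A column with [F x] at most [s3] is harmless by the crude bound on the displacement. Otherwise
     [drift] keeps [F] positive between [x] and [c], as [disp] requires. *)
  have [Fs|Fs] := leP (F x) s3.
    apply: (@le_trans _ _ (s3 * (2 * X + 1))).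
      apply: ler_pM => //.
      have := ler_normB (T1 x) (x - c); have : `|x - c| <= 2 * X by rewrite ler_norml; apply/andP; split; lra.
      by lra.
    rewrite /Q lerDr; apply: Rintegral_ge0 => z _; exact: mulr_ge0.
  have [xc|xc] := leP x c.
    have Fm t : x <= t <= c -> F x <= F t + s3.
      move=> /andP[t0 t1].
      have sT t' : x <= t' <= t -> 1 * T1 t' <= 0.
        by move=> /andP[_ h]; rewrite mul1r -Tc; apply: (km_homo km); exact: le_trans h t1.
      by have := drift x0 t0 (le_trans t1 c1') (normr1 _) sT; rewrite mul1r; move: (F t) (F x) (s3); move=> *; lra.
    have Tx : T1 c - T1 x <= 1 by move: T1x; rewrite ler_norml Tc => /andP[h _]; lra.
    have Fp t : x <= t <= c -> 0 < F t by move=> /Fm; move: Fs; move: (F t) (F x) (s3); move=> *; lra.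
    have := disp x0 xc c1' (F_ge0 x) Tx Fp Fm; rewrite Tc -normrN.
    by rewrite (_ : - (0 - T1 x - (c - x)) = T1 x - (x - c))//; ring.
  have cx := ltW xc.
  have Fm t : c <= t <= x -> F x <= F t + s3.
    move=> /andP[t0 t1].
    have sT t' : t <= t' <= x -> -1 * T1 t' <= 0.
      by move=> /andP[h _]; rewrite mulN1r oppr_le0 -Tc; apply: (km_homo km); exact: le_trans t0 h.
    by have := drift (le_trans c0 t0) t1 x1 (normrN1 _) sT; rewrite mulN1r; move: (F t) (F x) (s3); move=> *; lra.
  have Tx : T1 x - T1 c <= 1 by move: T1x; rewrite ler_norml Tc => /andP[_ h]; lra.
  have Fp t : c <= t <= x -> 0 < F t by move=> /Fm; move: Fs; move: (F t) (F x) (s3); move=> *; lra.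
  by have := disp c0 cx x1 (F_ge0 x) Tx Fp Fm; rewrite Tc subr0.
have Q0 : 0 <= Q.
  by rewrite addr_ge0//; [apply: Rintegral_ge0 => z _; exact: mulr_ge0|rewrite mulr_ge0//; lra].
pose h1 (z : R * R) := `|T1 z.1 - (z.1 - c)|.
have h1X z : box X z -> h1 z <= 2 * X + 1.
  move=> [+ _]; rewrite /seg /= in_itv /= => /andP[x0 x1].
  have T1x := km_T1_bound km z.1.
  have := ler_normB (T1 z.1) (z.1 - c); have : `|z.1 - c| <= 2 * X by rewrite ler_norml; apply/andP; split; lra.
  by rewrite /h1; lra.
have mh1 : measurable_fun setT (h1 : R2 -> R).
  apply: measurableT_comp => //; apply: measurable_funB; first by have [] := bT1.
  by apply: measurable_funB => //; exact: measurable_fst.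
have bh1 D : D `<=` box X -> bm (T := R2) D h1.
  by move=> DX; split=> //; exists (2 * X + 1) => z /DX zX; rewrite ger0_norm ?h1X// normr_ge0.
have bx : bmO (fun z => z.1).
  split; first exact: measurable_fst.
  by exists X => z /OmX[+ _]; rewrite /seg /= in_itv /= ler_norml.
have bhO := bh1 _ OmX; have bhX := bh1 (box X) (fun _ h => h).
have bWO := bW Om; have bWX := bW (box X); have bW1O := bW1 Om.
have Wh : I (fun z => W z * h1 z) <= 2 * X * Q.
  rewrite IboxE => [|z Kz]; last by rewrite WK// mul0r.
  rewrite fubini_box1; last by bm_auto.
  rewrite -seg_len [leRHS]mulrC -(Rintegral_cst (@lebesgue_measure R) (measurable_seg X)).
  have bh : bm (T := measurableTypeR R) (seg X) (fun x => F x * `|T1 x - (x - c)|).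
    apply: bmM; first exact: F_bm.
    split.
      apply: measurableT_comp => //; apply: measurable_funB; first exact: (continuous_measurable_fun (km_continuous km)).
      by apply: measurable_funB.
    by exists (2 * X + 1) => x sx; rewrite normr_id; apply: (h1X (x, x)).
  apply: (@le_trans _ _ (\int[@lebesgue_measure R]_(x in seg X) (F x * `|T1 x - (x - c)|))).
    rewrite le_eqVlt; apply/orP; left; apply/eqP; apply: eq_Rintegral => x; rewrite inE => sx.
    rewrite /F mulrC -(@bm_intZ _ (measurableTypeR R) R (@lebesgue_measure R) (seg X) (measurable_seg X) (seg_fin X)); last exact: bm_row bWX sx.
    by apply: eq_Rintegral => y _; rewrite /h1 /= mulrC.
  apply: (@bm_le_int _ (measurableTypeR R) R (@lebesgue_measure R) (seg X) (measurable_seg X) (seg_fin X)) => //.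
  exact: bm_cst.
apply: (@le_trans _ _ (I (fun z => 4 * R1 z ^+ 2 + 8 * (2 * X + 1) * (W z * h1 z)))).
  apply: int_le; [by bm_auto|by bm_auto|move=> z /OmX zX].
  have [Kz|Kz] := pselect (K z); last first.
    rewrite WK// !mul0r mulr0 addr0; apply: mulr_ge0 => //; exact: sqr_ge0.
  have -> : W1 z + 2 * (z.1 - c) = R1 z - 2 * (T1 z.1 - (z.1 - c)) by rewrite /R1 indicE mem_set// mul1r; ring.
  have hh : (T1 z.1 - (z.1 - c)) ^+ 2 <= (2 * X + 1) * h1 z.
    by rewrite -(real_normK (num_real (T1 _ - _))) expr2 ler_wpM2r// h1X.
  have w0 := W0 z; have w2' := profile_le2 z.
  have h3 : (R1 z - 2 * (T1 z.1 - (z.1 - c))) ^+ 2 <= 2 * R1 z ^+ 2 + 8 * ((2 * X + 1) * h1 z).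
    by move: hh; set p := T1 _ - _ => hh; have := sqr_ge0 (R1 z + 2 * p); lra.
  apply: (le_trans (ler_wpM2l w0 h3)); have := sqr_ge0 (R1 z) => h4.
  rewrite mulrDr; apply: lerD; last by rewrite le_eqVlt; apply/orP; left; apply/eqP; ring.
  by nra.
rewrite intD; [|by bm_auto|by bm_auto]; rewrite !intZ; [|by bm_auto|by bm_auto].
have hA : 4 * I (fun z => R1 z ^+ 2) <= kap * 128.
  have := R1sqr; have : kap ^+ 2 <= kap by rewrite expr2 ger_pMl.
  move: (Rintegral _ _ _) => J; lra.
have hB : 8 * (2 * X + 1) * I (fun z => W z * h1 z) <= 8 * (2 * X + 1) * (2 * X * Q).
  by apply: ler_wpM2l => //; lra.
have hQ : Q <= kap * (6 + 3 * pi + (pi / 2 + 16) * (2 * X + 1)).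
  rewrite [kap * _]mulrDr mulrA; apply: lerD; first exact: stretch_dev.
  by apply: ler_wpM2r; [lra|exact: s3_le].
have hC : 8 * (2 * X + 1) * (2 * X * Q) <= 8 * (2 * X + 1) * (2 * X * (kap * (6 + 3 * pi + (pi / 2 + 16) * (2 * X + 1)))).
  by apply: ler_wpM2l; [lra|apply: ler_wpM2l => //; lra].
apply: (le_trans (lerD hA (le_trans hB hC))).
rewrite le_eqVlt; apply/orP; left; apply/eqP; move: (pi : R) => p; ring.
Qed.

Let bV : bmO (fun z => 1 - W z). Proof. by bm_auto. Qed.

(** [d^2 dx] is carried by [T] to Lebesgue measure on the disk, so this and [jac_moment4] are the
    integrals of [|y|^2] and [|y|^4] over the disk. *)
Let jac_moment3 : I (fun z => d z ^+ 2 * tau z) = pi / 2.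
Proof.
have E z : d z ^+ 2 * tau z = ((1 + e) ^+ 2)^-1 * (g z * (tau z + e) ^+ 3) - e * d z ^+ 2.
  by rewrite jac_sqr; ring.
have bg := bm_g.
under eq_fun do rewrite E.
rewrite intB; [|by bm_auto|by bm_auto]; rewrite !intZ; [|by bm_auto|by bm_auto].
by rewrite moment_Om// int_jac_sqr /disk_moment; move: (pi : R) => p; field; rewrite gt_eqF.
Qed.

Let jac_moment4 : I (fun z => d z ^+ 2 * tau z ^+ 2) = pi / 3.
Proof.
have E z : d z ^+ 2 * tau z ^+ 2 = ((1 + e) ^+ 2)^-1 * (g z * (tau z + e) ^+ 4) - (2 * e) * (d z ^+ 2 * tau z) - e ^+ 2 * d z ^+ 2.
  by rewrite jac_sqr; ring.
have bg := bm_g.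
under eq_fun do rewrite E.
rewrite intB; [|by bm_auto|by bm_auto]; rewrite intB; [|by bm_auto|by bm_auto].
rewrite !intZ; [|by bm_auto|by bm_auto|by bm_auto].
by rewrite moment_Om// int_jac_sqr jac_moment3 /disk_moment; move: (pi : R) => p; field; rewrite gt_eqF.
Qed.

Let kap2 : kap ^+ 2 <= kap.
Proof. by rewrite expr2 ger_pMl. Qed.

Let jac_sqr_dev z : `|1 - d z ^+ 2| <= 2 * `|d z - 1| + (d z - 1) ^+ 2.
Proof.
rewrite -(real_normK (num_real (d z - 1))).
have -> : 1 - d z ^+ 2 = - ((d z - 1) * (2 + (d z - 1))) by ring.
rewrite normrN normrM; have := ler_normD 2 (d z - 1); rewrite [`|2|]ger0_norm// => h.
by have := normr_ge0 (d z - 1); nra.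
Qed.

Let moment_dev h C : bmO h -> 0 <= C -> (forall z, Om z -> `|h z| <= C * `|d z - 1| + `|1 - d z ^+ 2|) ->
  I h <= kap * ((C + 2) * (pi / 2 + 1) + 2).
Proof.
move=> bh C0 hC.
apply: (@le_trans _ _ (I (fun z => (C + 2) * `|d z - 1| + (d z - 1) ^+ 2))).
  apply: int_le; [by []|by bm_auto|move=> z /hC h1].
  by have := ler_norm (h z); have := jac_sqr_dev z; lra.
rewrite intD; [|by bm_auto|by bm_auto]; rewrite intZ; last by bm_auto.
have h1 := jac_dev_sqr; have h2 := jac_dev.
have h3 : (C + 2) * I (fun z => `|d z - 1|) <= (C + 2) * (kap * (pi / 2 + 1)).
  by apply: ler_wpM2l => //; lra.
apply: (le_trans (lerD h3 h1)); have := kap2; move: (pi : R) => p; lra.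
Qed.

(** [1 - W] is close to [|T|^2] by [tau_profile], and [d^2] to 1; its integral is therefore close to
    [jac_moment3]. *)
Lemma int_profile_ge : pi / 2 - kap * (6 * (pi / 2 + 1) + 2) <= I W.
Proof.
have bh : bmO (fun z => (1 - W z) - d z ^+ 2 * tau z) by bm_auto.
have h z : Om z -> `|(1 - W z) - d z ^+ 2 * tau z| <= 4 * `|d z - 1| + `|1 - d z ^+ 2|.
  move=> Oz; have t1 := tau_profile Oz.
  have -> : 1 - W z - d z ^+ 2 * tau z = - (tau z - (1 - W z)) + tau z * (1 - d z ^+ 2) by ring.
  apply: (le_trans (ler_normD _ _)); rewrite normrN lerD// normrM ger0_norm//.
  by rewrite ler_piMl.
have {h} := moment_dev bh _ h; rewrite (_ : 4 + 2 = 6 :> R); last by ring.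
move=> /(_ (ler0n _ _)); rewrite intB; [|by bm_auto|by bm_auto]; rewrite intB; [|by bm_auto|by bm_auto].
rewrite int_cst mul1r jac_moment3.
by move: (Rintegral _ _ _) (pi : R) => J p; lra.
Qed.

Lemma int_profile_le : I W <= pi / 2 + kap * (6 * (pi / 2 + 1) + 2).
Proof.
have bh : bmO (fun z => d z ^+ 2 * tau z - (1 - W z)) by bm_auto.
have h z : Om z -> `|d z ^+ 2 * tau z - (1 - W z)| <= 4 * `|d z - 1| + `|1 - d z ^+ 2|.
  move=> Oz; have t1 := tau_profile Oz.
  have -> : d z ^+ 2 * tau z - (1 - W z) = (tau z - (1 - W z)) - tau z * (1 - d z ^+ 2) by ring.
  apply: (le_trans (ler_normB _ _)); rewrite lerD// normrM ger0_norm//.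
  by rewrite ler_piMl.
have {h} := moment_dev bh _ h; rewrite (_ : 4 + 2 = 6 :> R); last by ring.
move=> /(_ (ler0n _ _)); rewrite intB; [|by bm_auto|by bm_auto]; rewrite intB; [|by bm_auto|by bm_auto].
rewrite int_cst mul1r jac_moment3.
by move: (Rintegral _ _ _) (pi : R) => J p; lra.
Qed.

(** In the limit [int W = pi/2], so [int (1 - W)^2] equals [int W^2]; it is compared with
    [jac_moment4]. *)
Lemma int_profile_sqr_le : I (fun z => W z ^+ 2) <= pi / 3 + kap * (22 * (pi / 2 + 1) + 6).
Proof.
have bh : bmO (fun z => (1 - W z) ^+ 2 - d z ^+ 2 * tau z ^+ 2) by bm_auto.
have h z : Om z -> `|(1 - W z) ^+ 2 - d z ^+ 2 * tau z ^+ 2| <= 8 * `|d z - 1| + `|1 - d z ^+ 2|.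
  move=> Oz; have t1 := tau_profile Oz.
  have -> : (1 - W z) ^+ 2 - d z ^+ 2 * tau z ^+ 2 = (- (1 - W z + tau z)) * (tau z - (1 - W z)) + tau z ^+ 2 * (1 - d z ^+ 2) by ring.
  apply: (le_trans (ler_normD _ _)); rewrite lerD// normrM.
    apply: (@le_trans _ _ (2 * (4 * `|d z - 1|))); last by lra.
    apply: ler_pM => //; rewrite normrN ler_norml.
    by have := profile_le2 z; have := W0 z; have := tau0 z; have := tau1 z => *; apply/andP; split; lra.
  by rewrite ger0_norm ?sqr_ge0// ler_piMl// expr_le1.
have {h} := moment_dev bh _ h; rewrite (_ : 8 + 2 = 10 :> R); last by ring.
move=> /(_ (ler0n _ _)).
have E z : (1 - W z) ^+ 2 - d z ^+ 2 * tau z ^+ 2 = (1 - 2 * W z + W z ^+ 2) - d z ^+ 2 * tau z ^+ 2 by ring.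
under eq_fun do rewrite E.
rewrite intB; [|by bm_auto|by bm_auto]; rewrite intD; [|by bm_auto|by bm_auto].
rewrite intB; [|by bm_auto|by bm_auto]; rewrite int_cst mul1r intZ// jac_moment4.
have := int_profile_le.
by move: (Rintegral _ _ _) (Rintegral _ _ _) (pi : R) => J J' p; lra.
Qed.

(** [|grad W|^2] is close to [4 |T|^2], hence to [4 (1 - W)]. *)
Lemma int_profile_grad : 4 * (I W - I (fun z => W z ^+ 2)) - kap * (32 * (pi / 2 + 1) + 16 * (pi / 2 + 16)) <=
  I (fun z => W z * (W1 z ^+ 2 + W2 z ^+ 2)).
Proof.
have bW1O := bW1 Om; have bW2O := bW2 Om.
apply: (@le_trans _ _ (I (fun z => 4 * (W z - W z ^+ 2) - (32 * `|d z - 1| + 8 * `|R1 z| + 8 * `|R2' z|)))).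
  have B1 : bmO (fun z => `|d z - 1|) by bm_auto.
  have B2 : bmO (fun z => `|R1 z|) by exact: bm_norm.
  have B3 : bmO (fun z => `|R2' z|) by exact: bm_norm.
  have B4 : bmO (fun z => W z - W z ^+ 2) by bm_auto.
  have bZ c h : bmO h -> bmO (fun z => c * h z) by move=> bh; bm_auto.
  rewrite intB; [|exact: bZ|apply: bmD; [apply: bmD|]; exact: bZ].
  rewrite intD; [|apply: bmD; exact: bZ|exact: bZ].
  rewrite intD; [|exact: bZ|exact: bZ].
  rewrite (intZ 4)// (intZ 32)// (intZ 8)// (intZ 8)// intB//; last by bm_auto.
  have := jac_dev; have := s3_le; have := s3'_le; rewrite /s3.
  move: (I (fun z => `|d z - 1|)) (I (fun z => `|R1 z|)) (I (fun z => `|R2' z|)) (pi : R) (I W) (I (fun z => W z ^+ 2)).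
  by move=> *; lra.
apply: int_le; [by bm_auto|by bm_auto|move=> z Oz].
have [Kz|Kz] := pselect (K z); last first.
  rewrite WK// expr0n subr0 !mul0r mulr0 sub0r oppr_le0.
  by rewrite !addr_ge0 ?mulr_ge0.
have -> : W1 z = R1 z - 2 * T1 z.1 by rewrite /R1 indicE mem_set// mul1r addrK.
have -> : W2 z = R2' z - 2 * T2 z by rewrite /R2' indicE mem_set// mul1r addrK.
have t1 := tau_profile Oz.
have aux r t : `|t| <= 1 -> 4 * t ^+ 2 - 4 * `|r| <= (r - 2 * t) ^+ 2 :> R.
  move=> h; have := sqr_ge0 r; have : r * t <= `|r|.
    by rewrite (le_trans (ler_norm _))// normrM ler_piMr.
  by lra.
have h1 := aux (R1 z) _ (km_T1_bound km z.1); have h2 := aux (R2' z) _ (km_T2_bound km z).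
have h3 : 4 * (1 - W z) - 16 * `|d z - 1| - 4 * `|R1 z| - 4 * `|R2' z| <= (R1 z - 2 * T1 z.1) ^+ 2 + (R2' z - 2 * T2 z) ^+ 2.
  move: t1; rewrite ler_norml /tau2 => /andP[t1 _]; lra.
apply: le_trans (ler_wpM2l (W0 z) h3).
have := profile_le2 z; have := normr_ge0 (d z - 1); have := normr_ge0 (R1 z); have := normr_ge0 (R2' z).
move: (`|_|) (`|_|) (`|_|) (W0 z) => p q r ww hp hq hr hw.
by nra.
Qed.

Hypothesis OmX' : forall z, Om z -> (- X < z.1 < X) && (- X < z.2 < X).

Let IBP1 c : I (fun z => 2 * (W z * W1 z * (z.1 - c)) + W z ^+ 2) = 0.
Proof.
rewrite IboxE => [|z Kz]; last by rewrite WK// !mul0r mulr0 expr0n addr0.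
have bx : bm (T := R2) (box X) (fun z => z.1).
  split; first exact: measurable_fst.
  by exists X => z [+ _]; rewrite /seg /= in_itv /= ler_norml.
have bWX := bW (box X); have bW1X := bW1 (box X).
rewrite fubini_box2; last by bm_auto.
rewrite (@eq_Rintegral _ _ _ (@lebesgue_measure R) (seg X) (fun=> 0)) => [|y _].
  by rewrite Rintegral_cst ?mul0r//; exact: measurable_seg.
have XX : - X <= X by move: X0 => h; lra.
have cf : continuous (fun t => 2 * (W (t, y) * W1 (t, y) * (t - c)) + W (t, y) ^+ 2).
  move=> t; have h1 : {for t, continuous (fun t => W (t, y))} by exact: (@col_continuous2 _ W y cW).
  have h2 : {for t, continuous (fun t => W1 (t, y))} by exact: (@col_continuous2 _ W1 y cW1).
  apply: cvgD; last by apply: cvgM.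
  apply: cvgM; first exact: cvg_cst.
  apply: cvgM; first exact: cvgM.
  by apply: cvgB; [exact: cvg_id|exact: cvg_cst].
have df (t : R) : is_derive t (1:R) (fun t => W (t, y) ^+ 2 * (t - c)) (2 * (W (t, y) * W1 (t, y) * (t - c)) + W (t, y) ^+ 2).
  have dW := c1_derive1 profile_C1c t y.
  by apply: is_derive_eq; rewrite /GRing.scale /=; ring.
rewrite /seg (FTC2 XX cf df).
have W0' t : ~~ (- X < t < X) -> W (t, y) = 0.
  by move=> h; apply: WK => /KOm /OmX' /andP[h2 _]; rewrite h2 in h.
by rewrite !W0' ?ltxx ?andbF// !expr0n !mul0r subrr.
Qed.

Let IBP2 c : I (fun z => 2 * (W z * W2 z * (z.2 - c)) + W z ^+ 2) = 0.
Proof.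
rewrite IboxE => [|z Kz]; last by rewrite WK// !mul0r mulr0 expr0n addr0.
have bx : bm (T := R2) (box X) (fun z => z.2).
  split; first exact: measurable_snd.
  by exists X => z [_]; rewrite /seg /= in_itv /= ler_norml.
have bWX := bW (box X); have bW1X := bW2 (box X).
rewrite fubini_box1; last by bm_auto.
rewrite (@eq_Rintegral _ _ _ (@lebesgue_measure R) (seg X) (fun=> 0)) => [|x _].
  by rewrite Rintegral_cst ?mul0r//; exact: measurable_seg.
have XX : - X <= X by move: X0 => h; lra.
have cf : continuous (fun t => 2 * (W (x, t) * W2 (x, t) * (t - c)) + W (x, t) ^+ 2).
  move=> t; have h1 : {for t, continuous (fun t => W (x, t))} by exact: (@row_continuous2 _ W x cW).
  have h2 : {for t, continuous (fun t => W2 (x, t))} by exact: (@row_continuous2 _ W2 x cW2).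
  apply: cvgD; last by apply: cvgM.
  apply: cvgM; first exact: cvg_cst.
  apply: cvgM; first exact: cvgM.
  by apply: cvgB; [exact: cvg_id|exact: cvg_cst].
have df (t : R) : is_derive t (1:R) (fun t => W (x, t) ^+ 2 * (t - c)) (2 * (W (x, t) * W2 (x, t) * (t - c)) + W (x, t) ^+ 2).
  have dW := c1_derive2 profile_C1c x t.
  by apply: is_derive_eq; rewrite /GRing.scale /=; ring.
rewrite /seg (FTC2 XX cf df).
have W0' t : ~~ (- X < t < X) -> W (x, t) = 0.
  by move=> h; apply: WK => /KOm /OmX' /andP[_ h2]; rewrite h2 in h.
by rewrite !W0' ?ltxx ?andbF// !expr0n !mul0r subrr.
Qed.

(** Expanding the squares and using [2 int W (d_i W) (z_i - p_i) = - int W^2] ([IBP1], [IBP2]) gives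
    an upper bound on [int W |z - p|^2], close to [pi/6] when [int W] and [int W^2] are close to
    [pi/2] and [pi/3]. With [P] the positive part of [1 - |z - p|^2], the inequality [P^2 >= 2 P W -
    W^2 >= 2 (1 - |z - p|^2) W - W^2] then yields [pi - pi/3 - pi/3]. *)
Lemma near_paraboloid (p1 p2 M1 M2 : R) :
  I (fun z => W z * (W1 z + 2 * (z.1 - p1)) ^+ 2) <= kap * M1 ->
  I (fun z => W z * (W2 z + 2 * (z.2 - p2)) ^+ 2) <= kap * M2 ->
  pi / 3 - kap * (134 * (pi / 2 + 1) + 38 + (M1 + M2 + 32 * (pi / 2 + 1) + 16 * (pi / 2 + 16)) / 2) <=
  I (fun z => Num.max 0 (1 - dist2 (p1, p2) z) ^+ 2).
Proof.
move=> h1 h2.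
have bx : bmO (fun z => z.1).
  split; first exact: measurable_fst.
  by exists X => z /OmX[+ _]; rewrite /seg /= in_itv /= ler_norml.
have by_ : bmO (fun z => z.2).
  split; first exact: measurable_snd.
  by exists X => z /OmX[_]; rewrite /seg /= in_itv /= ler_norml.
have bW1O := bW1 Om; have bW2O := bW2 Om.
have bq : bmO (dist2 (p1, p2)) by rewrite /dist2; bm_auto.
have bP : bmO (fun z => Num.max 0 (1 - dist2 (p1, p2) z)).
  under eq_fun do rewrite maxr_absE.
  by bm_auto.
have E1 z : W z * (W1 z + 2 * (z.1 - p1)) ^+ 2 + W z * (W2 z + 2 * (z.2 - p2)) ^+ 2 =
  W z * (W1 z ^+ 2 + W2 z ^+ 2) + 4 * (W z * dist2 (p1, p2) z) + 2 * (2 * (W z * W1 z * (z.1 - p1)) + W z ^+ 2) +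
  2 * (2 * (W z * W2 z * (z.2 - p2)) + W z ^+ 2) - 4 * W z ^+ 2 by rewrite /dist2 /=; ring.
have := lerD h1 h2; rewrite -intD; [|by bm_auto|by bm_auto].
under eq_fun do rewrite E1.
rewrite intB; [|by bm_auto|by bm_auto]; do 3 (rewrite intD; [|by bm_auto|by bm_auto]).
do 4 (rewrite intZ; last by bm_auto).
rewrite IBP1 IBP2 => h3.
have h4 : 2 * I W - 2 * I (fun z => W z * dist2 (p1, p2) z) - I (fun z => W z ^+ 2) <= I (fun z => Num.max 0 (1 - dist2 (p1, p2) z) ^+ 2).
  do 2 (rewrite -intZ; last by bm_auto).
  do 2 (rewrite -intB; [|by bm_auto|by bm_auto]).
  apply: int_le; [by bm_auto|by bm_auto|move=> z _].
  set p := Num.max _ _.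
  have pp : 1 - dist2 (p1, p2) z <= p by rewrite /p le_max lexx orbT.
  have := sqr_ge0 (p - W z); have := ler_wpM2l (W0 z) pp; move: (dist2 _ _) (W z) (p) => q1 q2 q3; lra.
have := int_profile_ge; have := int_profile_sqr_le; have := int_profile_grad; move: h3 h4.
move: (Rintegral _ _ _) (Rintegral _ _ _) (Rintegral _ _ _) (Rintegral _ _ _) (Rintegral _ _ _) (pi : R) => i1 i2 i3 i4 i5 q.
lra.
Qed.

End Deficit.

(** * Exchange of the two coordinates *)

Section Swap.
Variable R : realType.
Local Notation mu := (@lebesgue_measure R).
Local Notation R2 := (measurableTypeR R * measurableTypeR R)%type.
Implicit Types (f h : R * R -> R) (K A Om : set (R * R)) (X : R).

Definition swp (z : R * R) : R * R := (z.2, z.1).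

Lemma swpK : involutive swp. Proof. by case. Qed.

Lemma continuous_swp : continuous swp.
Proof.
move=> z; have h1 : (fun z : R * R => z.1) w @[w --> z] --> z.1 by exact: cvg_fst.
have h2 : (fun z : R * R => z.2) w @[w --> z] --> z.2 by exact: cvg_snd.
exact: (cvg_pair h2 h1).
Qed.

Lemma measurable_swp : measurable_fun setT (swp : R2 -> R2).
Proof. by apply: measurable_fun_pair; [exact: measurable_snd|exact: measurable_fst]. Qed.

Lemma continuous_comp_swp f : continuous f -> continuous (f \o swp).
Proof. by move=> cf z; apply: continuous_comp; [exact: continuous_swp|exact: cf]. Qed.

Lemma box_swp X z : box X (swp z) <-> box X z.
Proof. by case: z => x y; split=> -[]; split. Qed.

Lemma int_box_swp X f : bm (T := R2) (box X) f ->
  \int[@leb2 R]_(z in box X) f (swp z) = \int[@leb2 R]_(z in box X) f z.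
Proof.
move=> bf; rewrite [RHS]fubini_box2// fubini_box1//.
have [mf [C HC]] := bf; split; first exact: (measurableT_comp mf measurable_swp).
by exists C => z /box_swp /HC.
Qed.

Lemma int_swp X Om f : Om `<=` box X -> bm (T := R2) (box X) f -> (forall z, ~ Om z -> f z = 0) ->
  \int[@leb2 R]_(z in swp @^-1` Om) f (swp z) = \int[@leb2 R]_(z in Om) f z.
Proof.
move=> OmX bf f0; rewrite [RHS](int_box_sub OmX)// -int_box_swp//.
by apply: int_box_sub => [z /OmX /box_swp//|z]; apply: f0.
Qed.

Lemma measurable_swp_preimage A : measurable (A : set R2) -> measurable (swp @^-1` A : set R2).
Proof. by move=> mA; rewrite -[X in measurable X]setTI; exact: measurable_swp. Qed.

Lemma area_sub_box X A : measurable A -> A `<=` box X ->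
  (@leb2 R A = (\int[@leb2 R]_(z in box X) (\1_A z : R))%:E)%E.
Proof.
move=> mA AX; rewrite -(@bm_intE _ R2 R (@leb2 R) (box X) (measurable_box X) (box_fin X)).
  by rewrite integral_indic ?setIidl//; exact: measurable_box.
split; first exact: measurable_indic.
by exists 1 => z _; rewrite indicE; case: (_ \in _); rewrite ?normr1 ?normr0.
Qed.

Lemma area_swp X A : measurable A -> A `<=` box X -> (@leb2 R (swp @^-1` A) = @leb2 R A)%E.
Proof.
move=> mA AX; rewrite (area_sub_box mA AX) (@area_sub_box X).
- congr EFin; rewrite -[RHS]int_box_swp//; split; first exact: measurable_indic.
  by exists 1 => z _; rewrite indicE; case: (_ \in _); rewrite ?normr1 ?normr0.
- exact: measurable_swp_preimage.
- by move=> z /AX /box_swp.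
Qed.

Lemma compact_swp K : compact K -> compact (swp @^-1` K).
Proof.
move=> cK; rewrite (_ : swp @^-1` K = swp @` K).
  by apply: continuous_compact => //; apply: continuous_subspaceT; exact: continuous_swp.
apply/seteqP; split=> [z Kz|_ [z Kz <-]]; first by exists (swp z) => //; rewrite swpK.
by rewrite /preimage /= swpK.
Qed.

Lemma C1c_swp K f f1 f2 : C1c K f f1 f2 -> C1c (swp @^-1` K) (f \o swp) (f2 \o swp) (f1 \o swp).
Proof.
move=> c; split.
- exact: (continuous_comp_swp (@c1_continuous _ _ _ _ _ c)).
- exact: (continuous_comp_swp (@c1_continuous2 _ _ _ _ _ c)).
- exact: (continuous_comp_swp (@c1_continuous1 _ _ _ _ _ c)).
- by move=> x y; exact: (c1_derive2 c y x).
- by move=> x y; exact: (c1_derive1 c y x).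
- by move=> z; exact: (c1_support c).
Qed.

End Swap.

(** The defining function stands in for the distance to the boundary. At [z1] it is maximal over
    [K], so [rho / rho z1] is at least 1 on [K] and at most 0 outside the domain; it is clipped to
    [[0, 1]]. *)
Lemma cutoff_exists (R : realType) (rho : R * R -> R) (K : set (R * R)) :
  continuous rho -> compact K -> (forall z, K z -> rho z < 0) ->
  exists chi : R * R -> R, [/\ continuous chi, forall z, 0 <= chi z, forall z, chi z <= 1,
    forall z, K z -> chi z = 1 & forall z, 0 <= rho z -> chi z = 0].
Proof.
move=> crho cK Kneg; have [K0|/set0P[z0 Kz0]] := eqVneq K set0.
  by exists (fun=> 0); split=> //; [move=> z; exact: cvg_cst|move=> z; rewrite K0].
have [z1 Kz1 Hz1] := @compact_EVT_max _ _ rho K (ex_intro _ z0 Kz0) cK (continuous_subspaceT crho).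
rewrite inE in Kz1; have m0 : 0 < - rho z1 by rewrite oppr_gt0 Kneg.
exists (fun z => Num.min 1 (Num.max 0 (rho z / rho z1))); split.
- move=> z; apply: (@continuous_min R _ (fun=> 1) (fun z => Num.max 0 (rho z / rho z1))); first exact: cvg_cst.
  apply: (@continuous_max R _ (fun=> 0) (fun z => rho z / rho z1)); first exact: cvg_cst.
  by apply: cvgM; [exact: crho|exact: cvg_cst].
- by move=> z; rewrite le_min ler01 le_max lexx.
- by move=> z; rewrite ge_min lexx.
- move=> z Kz; apply/min_idPl; rewrite le_max; apply/orP; right.
  by rewrite ler_ndivlMr ?mul1r ?Hz1 ?mem_set// Kneg.
- move=> z rz; rewrite max_l ?min_r//.
  by rewrite mulr_ge0_le0// invr_le0 ltW// Kneg.
Qed.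

(** * Stability in both coordinates *)

Section Stability.
Variable R : realType.
Local Notation R2 := (measurableTypeR R * measurableTypeR R)%type.
Implicit Types (X e : R) (Om K : set (R * R)) (u chi : R * R -> R).

(* [datum X e Om K u u1 u2 chi] gathers what the transport of [chi * exp u] onto the disk needs;
   [e] is fixed by the total mass. *)
Record datum X e Om K (u u1 u2 chi : R * R -> R) : Prop := MkDatum {
  dat_X : 0 < X;
  dat_e : 0 < e;
  dat_measurable : measurable Om;
  dat_box : forall z, Om z -> (- X < z.1 < X) && (- X < z.2 < X);
  dat_area : leb2 Om = (pi : R)%:E;
  dat_compact : compact K;
  dat_sub : K `<=` Om;
  dat_C1c : C1c K u u1 u2;
  dat_ge0 : forall z, 0 <= u z;
  dat_chi : continuous chi;
  dat_chi0 : forall z, 0 <= chi z;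
  dat_chi1 : forall z, chi z <= 1;
  dat_chiK : forall z, K z -> chi z = 1;
  dat_chiOm : forall z, ~ Om z -> chi z = 0;
  dat_mass : \int[@leb2 R]_(z in Om) (chi z * expR (u z)) = pi * (1 + e) / e }.

Lemma open_box X Om : (forall z, Om z -> (- X < z.1 < X) && (- X < z.2 < X)) -> Om `<=` box X.
Proof.
move=> h z /h /andP[/andP[h1 h2] /andP[h3 h4]].
by split; rewrite /seg /= in_itv /= !ltW.
Qed.

Lemma datum_bm X e Om K u u1 u2 chi D : datum X e Om K u u1 u2 chi -> bm (T := R2) D (fun z => chi z * expR (u z)).
Proof.
move=> dt; have [C HC] := compact_support_bounded (dat_compact dt) (c1_continuous (dat_C1c dt)) (c1_support (dat_C1c dt)).
split.
  apply: continuous_measurable2 => z; apply: cvgM; first exact: (dat_chi dt).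
  apply: (@continuous_comp _ _ _ u (@expR R)); last exact: continuous_expR.
  exact: (c1_continuous (dat_C1c dt)).
exists (expR C) => z _; rewrite ger0_norm; last by rewrite mulr_ge0 ?expR_ge0 ?(dat_chi0 dt).
rewrite -[leRHS]mul1r ler_pM ?expR_ge0 ?(dat_chi0 dt) ?(dat_chi1 dt)// ler_expR.
exact: le_trans (ler_norm _) (HC z).
Qed.

Lemma datum_swp X e Om K u u1 u2 chi : datum X e Om K u u1 u2 chi ->
  datum X e (@swp R @^-1` Om) (@swp R @^-1` K) (u \o @swp R) (u2 \o @swp R) (u1 \o @swp R) (chi \o @swp R).
Proof.
move=> dt; split.
- exact: dat_X dt.
- exact: dat_e dt.
- exact: (measurable_swp_preimage (dat_measurable dt)).
- by move=> z /(dat_box dt); rewrite andbC.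
- by rewrite (area_swp (dat_measurable dt) (open_box (dat_box dt))) (dat_area dt).
- exact: compact_swp (dat_compact dt).
- by move=> z; apply: (dat_sub dt).
- exact: C1c_swp (dat_C1c dt).
- by move=> z; apply: (dat_ge0 dt).
- exact: (continuous_comp_swp (@dat_chi _ _ _ _ _ _ _ _ dt)).
- by move=> z; apply: (dat_chi0 dt).
- by move=> z; apply: (dat_chi1 dt).
- by move=> z; apply: (dat_chiK dt).
- by move=> z; apply: (dat_chiOm dt).
- rewrite -(dat_mass dt); apply: (@int_swp R X Om (fun z => chi z * expR (u z))).
  + exact: open_box (dat_box dt).
  + exact: datum_bm dt.
  + by move=> z /(dat_chiOm dt) ->; rewrite mul0r.
Qed.

(** With [z = (1 + e) / e] the two last terms are [- ln z + 1 - 1/z]: the functional plus 1 for the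
    cut mass [pi z], less [1/z]. *)
Definition excess e Om (u1 u2 : R * R -> R) : R :=
  dirichlet Om u1 u2 / (16 * pi) - (ln (1 + e) - ln e) + 1 / (1 + e).

Definition displacement_bound X : R := 128 + 16 * X * (2 * X + 1) * (6 + 3 * pi + (pi / 2 + 16) * (2 * X + 1)).

(** The last conclusion leaves both centres and both constants free, because the estimate in the
    second coordinate is supplied by another transport map, that of the swapped datum. *)
Lemma datum_deficit X e Om K u u1 u2 chi : datum X e Om K u u1 u2 chi ->
  0 <= excess e Om u1 u2 /\ forall kap, e <= 1 -> 0 < kap -> kap <= 1 -> pi * excess e Om u1 u2 <= kap ^+ 2 ->
  (exists2 c : R, `|c| <= X & \int[@leb2 R]_(z in Om) (profile e u z * (profile1 e u u1 z + 2 * (z.1 - c)) ^+ 2) <=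
    kap * displacement_bound X) /\
  (forall p1 p2 M1 M2 : R,
    \int[@leb2 R]_(z in Om) (profile e u z * (profile1 e u u1 z + 2 * (z.1 - p1)) ^+ 2) <= kap * M1 ->
    \int[@leb2 R]_(z in Om) (profile e u z * (profile2 e u u2 z + 2 * (z.2 - p2)) ^+ 2) <= kap * M2 ->
    pi / 3 - kap * (134 * (pi / 2 + 1) + 38 + (M1 + M2 + 32 * (pi / 2 + 1) + 16 * (pi / 2 + 16)) / 2) <=
    \int[@leb2 R]_(z in Om) (Num.max 0 (1 - dist2 (p1, p2) z) ^+ 2)).
Proof.
case=> X0 e0 mOm OmX' areaOm cK KOm c1 u0 cchi chi0 chi1 chiK chiOm mass.
have OmX := open_box OmX'.
pose g z := chi z * expR (u z).
have cg : continuous g.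
  move=> z; apply: cvgM; first exact: cchi.
  apply: (@continuous_comp _ _ _ u (@expR R)); [exact: (c1_continuous c1)|exact: continuous_expR].
have [C HC] := compact_support_bounded cK (c1_continuous c1) (c1_support c1).
have g0 z : 0 <= g z by rewrite mulr_ge0// expR_ge0.
have gC z : g z <= expR C.
  by rewrite -[leRHS]mul1r ler_pM ?expR_ge0// ler_expR (le_trans (ler_norm _) (HC z)).
have gX z : g z != 0 -> (- X < z.1 < X) && (- X < z.2 < X).
  move=> gz; apply: OmX'; apply: contrapT => /chiOm h; move: gz.
  by rewrite /g h mul0r eqxx.
have gZ : \int[@leb2 R]_(z in box X) g z = disk_moment e 0.
  rewrite -(int_box_sub OmX); last by move=> z /chiOm h; rewrite /g h mul0r.
  rewrite mass /disk_moment; field; rewrite !gt_eqF//; lra.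
have [T1 [a [T2 [b km]]]] := knothe_exists e0 X0 cg g0 gC gX gZ.
have db := deficit_bound e0 km mOm OmX areaOm cK KOm c1 u0 cchi chi0 chi1 chiK chiOm.
have d1 := agm_deficit_ge0 Om e0 km u0 chi0.
have d3 := young_deficit_ge0 T1 T2 Om K u u1 u2 e0.
have d2 : 0 <= jac_deficit e T1 T2 Om u chi.
  have := jac_deficitE e0 km mOm OmX areaOm cK c1 cchi chi0 chi1 chiOm.
  set J := Rintegral _ _ _ => JE.
  have : 0 <= J by apply: Rintegral_ge0 => z _; exact: sqr_ge0.
  by rewrite JE pmulr_rge0.
rewrite -/(excess e Om u1 u2) in db.
have p0 := pi_gt0 R.
have ex0 : 0 <= excess e Om u1 u2.
  have : 0 <= pi * (1 + e) / 2 * excess e Om u1 u2 by lra.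
  by rewrite pmulr_rge0// divr_gt0// mulr_gt0//; lra.
split=> // kap e1 k0 k1 hk.
have sum_le : agm_deficit e T1 a T2 b Om u chi + jac_deficit e T1 T2 Om u chi + young_deficit e T1 T2 Om K u u1 u2 <= kap ^+ 2.
  apply: (le_trans db); apply: le_trans hk; apply: ler_wpM2r => //.
  rewrite -[leRHS]mulr1 -mulrA ler_wpM2l ?pi_ge0//; lra.
have l1 : agm_deficit e T1 a T2 b Om u chi <= kap ^+ 2 by lra.
have l2 : jac_deficit e T1 T2 Om u chi <= kap ^+ 2 by lra.
have l3 : young_deficit e T1 T2 Om K u u1 u2 <= kap ^+ 2 by lra.
split; first exact: (first_coordinate e0 km mOm OmX areaOm cK KOm c1 u0 cchi chi0 chi1 chiK chiOm e1 X0 k0 k1 l1 l2 l3).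
move=> p1 p2 M1 M2.
exact: (near_paraboloid e0 km mOm OmX areaOm cK KOm c1 u0 cchi chi0 chi1 chiK chiOm e1 X0 k0 k1 l2 l3 OmX').
Qed.

(** Exchanging the coordinates preserves [e] and the excess and carries [W] to its mirror image, so
    the first-coordinate estimate for the swapped datum is the second-coordinate estimate for the
    same [W]. *)
Lemma datum_stability X e Om K u u1 u2 chi kap : datum X e Om K u u1 u2 chi ->
  e <= 1 -> 0 < kap -> kap <= 1 -> pi * excess e Om u1 u2 <= kap ^+ 2 ->
  exists c : R * R, [/\ `|c.1| <= X, `|c.2| <= X &
    pi / 3 - kap * (134 * (pi / 2 + 1) + 38 + (displacement_bound X + displacement_bound X + 32 * (pi / 2 + 1) + 16 * (pi / 2 + 16)) / 2) <=
    \int[@leb2 R]_(z in Om) (Num.max 0 (1 - dist2 c z) ^+ 2)].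
Proof.
move=> dt e1 k0 k1 hk.
have [_ /(_ kap e1 k0 k1 hk)[[c1 c1X h1] near]] := datum_deficit dt.
have OmX := open_box (dat_box dt).
have clK := compact_closed2 (dat_compact dt).
have cu := dat_C1c dt.
have cP := profile_C1c e cu.
have sD f : continuous f -> (forall z, ~ K z -> f z = 0) ->
    \int[@leb2 R]_(z in @swp R @^-1` Om) f (swp z) = \int[@leb2 R]_(z in Om) f z.
  move=> cf f0; apply: (int_swp OmX).
    exact: (bm_continuous_supported (dat_compact dt) _ cf f0).
  by move=> z nz; apply: f0 => /(dat_sub dt).
have exE : excess e (@swp R @^-1` Om) (u2 \o @swp R) (u1 \o @swp R) = excess e Om u1 u2.
  rewrite /excess /dirichlet -(sD (fun z => u1 z ^+ 2 + u2 z ^+ 2)).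
  - by congr (_ / _ - _ + _); apply: eq_Rintegral => z _; rewrite addrC.
  - move=> z; have h := c1_continuous1 cu (x := z); have h' := c1_continuous2 cu (x := z).
    by apply: cvgD; apply: cvgM.
  - move=> z Kz; rewrite (deriv1_off_support clK (c1_derive1 cu) (c1_support cu))//.
    by rewrite (deriv2_off_support clK (c1_derive2 cu) (c1_support cu))// expr0n addr0.
have [_ /(_ kap e1 k0 k1)] := datum_deficit (datum_swp dt).
rewrite exE => /(_ hk)[[c2 c2X h2] _].
exists (c1, c2); split=> //; apply: near h1 _; apply: le_trans h2.
rewrite -(sD (fun z => profile e u z * (profile2 e u u2 z + 2 * (z.2 - c2)) ^+ 2))//.
- move=> z; have h := c1_continuous cP (x := z); have h' := c1_continuous2 cP (x := z).
  have h2 : (profile2 e u u2 w + 2 * (w.2 - c2)) @[w --> z] --> (profile2 e u u2 z + 2 * (z.2 - c2)).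
    apply: cvgD => //; apply: cvgM; first exact: cvg_cst.
    by apply: cvgB; [exact: cvg_snd|exact: cvg_cst].
  by apply: cvgM => //; apply: cvgM.
- by move=> z Kz; rewrite (c1_support cP)// mul0r.
Qed.

End Stability.

(** * From small deficit to the disk *)

Section C1Stability.
Variable R : realType.
Local Notation R2 := (measurableTypeR R * measurableTypeR R)%type.
Implicit Types (X e : R) (Om K : set (R * R)) (u chi rho : R * R -> R).

(** [exp (t - 1/36) >= (1 + t/2)^2 * 35/36], and the right side is at least [1 + t] for [t] between
    1/2 and 1. Only positivity of the constant matters. *)
Lemma log_gap (t : R) : 1 / 2 <= t -> t <= 1 -> 1 / 36 <= t - ln (1 + t).
Proof.
move=> t0 t1; suff : ln (1 + t) <= t - 1 / 36 by lra.
have p0 : 0 < 1 + t by lra.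
rewrite -[leRHS]expRK ler_ln ?posrE ?expR_gt0//.
have -> : t - 1 / 36 = t / 2 + t / 2 + (- (1 / 36)) by field.
rewrite !expRD; have h1 := expR_ge1Dx (t / 2); have h2 := expR_ge1Dx (- (1 / 36) : R).
have h3 : (1 + t / 2) ^+ 2 <= expR (t / 2) * expR (t / 2) by rewrite -expr2 ler_sqr ?nnegrE ?expR_ge0//; lra.
apply: (@le_trans _ _ ((1 + t / 2) ^+ 2 * (35 / 36))); first by nra.
by apply: ler_pM => //; [exact: sqr_ge0|lra].
Qed.

Lemma open_sublevel rho : continuous rho -> open [set z | rho z < 0].
Proof.
move=> crho; rewrite (_ : [set z | _] = rho @^-1` `]-oo, 0[%classic).
  by apply: open_comp => [z _|]; [exact: crho|exact: interval_open].
by apply/seteqP; split=> z /=; rewrite in_itv.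
Qed.

Definition gap Om u (u1 u2 : R * R -> R) : R :=
  dirichlet Om u1 u2 / (16 * pi) - ln (pi^-1 * \int[@leb2 R]_(z in Om) expR (u z)) + 1.

Definition stability_bound X : R :=
  134 * (pi / 2 + 1) + 38 + (displacement_bound X + displacement_bound X + 32 * (pi / 2 + 1) + 16 * (pi / 2 + 16)) / 2.

(** Let [t = 1/z = e / (1 + e)]. The cutoff loses mass at most [pi], so the true mass is at most
    [pi z (1 + t)], whence [gap >= excess + (t - ln (1 + t))]. The last bracket is nonnegative, and
    it exceeds 1/36 when [e > 1], which is how a small gap forces [e <= 1]. *)
Lemma gap_stability X rho K u u1 u2 (Om := [set z | rho z < 0]) : 0 < X -> continuous rho ->
  (forall z, Om z -> (- X < z.1 < X) && (- X < z.2 < X)) -> leb2 Om = (pi : R)%:E ->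
  compact K -> K `<=` Om -> C1c K u u1 u2 -> (forall z, 0 <= u z) ->
  0 <= gap Om u u1 u2 /\ forall kap, gap Om u u1 u2 < 1 / 36 -> 0 < kap -> kap <= 1 -> pi * gap Om u u1 u2 <= kap ^+ 2 ->
  exists c : R * R, [/\ `|c.1| <= X, `|c.2| <= X &
    pi / 3 - kap * stability_bound X <= \int[@leb2 R]_(z in Om) (Num.max 0 (1 - dist2 c z) ^+ 2)].
Proof.
move=> X0 crho OmX' areaOm cK KOm c1 u0.
have [chi [cchi chi0 chi1 chiK chirho]] := cutoff_exists crho cK KOm.
have chiOm z : ~ Om z -> chi z = 0 by move=> /negP; rewrite -leNgt => /chirho.
have mOm : measurable (Om : set R2) := open_measurable2 (open_sublevel crho).
have finOm : (@leb2 R Om < +oo)%E by rewrite areaOm ltry.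
have cu := c1_continuous c1; have uK := c1_support c1.
have bexp D : bm (T := R2) D (fun z => expR (u z)).
  have [C HC] := compact_support_bounded cK cu uK; split.
    apply: continuous_measurable2 => z.
    by apply: (@continuous_comp _ _ _ u (@expR R)); [exact: cu|exact: continuous_expR].
  exists (expR C) => z _; rewrite ger0_norm ?expR_ge0// ler_expR.
  exact: le_trans (ler_norm _) (HC z).
have bchi D : bm (T := R2) D chi.
  by split; [exact: continuous_measurable2|exists 1 => z _; rewrite ger0_norm].
have bO := bexp Om; have bc := bchi Om.
pose N := \int[@leb2 R]_(z in Om) expR (u z).
pose Z := \int[@leb2 R]_(z in Om) (chi z * expR (u z)).
have p0 := pi_gt0 R.
have cstE c : \int[@leb2 R]_(z in Om) c = c * pi.
  by rewrite Rintegral_cst//; congr (_ * _); exact: (congr1 fine areaOm).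
have NZ : N <= Z + pi.
  have -> : pi = \int[@leb2 R]_(z in Om) (1 : R) by rewrite cstE mul1r.
  rewrite /Z -(@bm_intD _ R2 R (@leb2 R) Om mOm finOm); [|by bm_auto|by bm_auto].
  apply: (@bm_le_int _ R2 R (@leb2 R) Om mOm finOm); [by []|by bm_auto|move=> z _].
  have [Kz|Kz] := pselect (K z); first by rewrite chiK// mul1r lerDl.
  by rewrite uK// expR0 mulr1 lerDr.
have N0 : pi <= N.
  have -> : pi = \int[@leb2 R]_(z in Om) (1 : R) by rewrite cstE mul1r.
  apply: (@bm_le_int _ R2 R (@leb2 R) Om mOm finOm); [exact: bm_cst|by []|move=> z _].
  by rewrite -expR0 ler_expR.
have S0 : 0 <= dirichlet Om u1 u2 / (16 * pi).
  apply: divr_ge0; last by rewrite mulr_ge0// ltW.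
  by apply: Rintegral_ge0 => z _; rewrite addr_ge0// sqr_ge0.
rewrite /gap -/N.
have N1 : 0 < pi^-1 * N by rewrite mulr_gt0 ?invr_gt0// (lt_le_trans p0).
have [Zp|Zp] := leP Z pi.
  have lnN : ln (pi^-1 * N) <= ln (1 + 1).
    have p2 : 0 < 1 + 1 :> R by lra.
    rewrite ler_ln ?posrE// mulrC ler_pdivrMr//; lra.
  have := @log_gap 1; rewrite !lexx => /(_ _ isT).
  have -> : 1 / 2 <= 1 :> R by lra.
  move=> /(_ isT) h; split; first by lra.
  by move=> kap h2; exfalso; lra.
pose e := pi / (Z - pi).
have Zp' : 0 < Z - pi by rewrite subr_gt0.
have e0 : 0 < e by rewrite divr_gt0.
have mass : Z = pi * (1 + e) / e.
  by rewrite /e; move: Zp' p0; move: (pi : R) => p h1 h2; field; rewrite !gt_eqF.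
have dt : datum X e Om K u u1 u2 chi by split.
have [H0 _] := datum_deficit dt.
pose t := e / (1 + e).
have e1 : 0 < 1 + e by lra.
have t0 : 0 < t by rewrite divr_gt0.
have lnN : ln (pi^-1 * N) <= (ln (1 + e) - ln e) + ln (1 + t).
  have -> : ln (1 + e) - ln e = ln ((1 + e) / e) by rewrite ln_div ?posrE.
  rewrite -lnM ?posrE//; [|by rewrite divr_gt0|by lra].
  rewrite ler_ln ?posrE//; last by rewrite mulr_gt0 ?divr_gt0//; lra.
  apply: (@le_trans _ _ (pi^-1 * (Z + pi))); first by rewrite ler_wpM2l// invr_ge0 ltW.
  rewrite mass /t le_eqVlt; apply/orP; left; apply/eqP.
  by move: p0; move: (pi : R) => p h2; field; rewrite !gt_eqF.
have tE : 1 / (1 + e) = 1 - t by rewrite /t; field; rewrite gt_eqF.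
have lt : ln (1 + t) <= t by apply: le_ln1Dx; lra.
have HG : excess e Om u1 u2 + (t - ln (1 + t)) <= dirichlet Om u1 u2 / (16 * pi) - ln (pi^-1 * N) + 1.
  rewrite /excess tE; move: lnN.
  by move: (ln (pi^-1 * N)) (ln (1 + e)) (ln e) (ln (1 + t)) (dirichlet _ _ _ / _) => *; lra.
split; first by lra.
move=> kap h1 k0 k1 hk.
have el : e <= 1.
  rewrite leNgt; apply/negP => e2.
  have t2 : 1 / 2 <= t by rewrite /t ler_pdivlMr//; lra.
  have t3 : t <= 1 by rewrite /t ler_pdivrMr//; lra.
  by have := log_gap t2 t3; lra.
apply: (datum_stability dt el k0 k1); apply: le_trans hk.
by apply: ler_wpM2l; [exact: ltW|lra].
Qed.

End C1Stability.

(** * Domains that fill a unit disk *)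

Section DiskRigidity.
Variable R : realType.
Local Notation R2 := (measurableTypeR R * measurableTypeR R)%type.
Implicit Types (X : R) (Om K : set (R * R)) (rho : R * R -> R).

Lemma open_pos_measure (A : set (R * R)) : open A -> A !=set0 -> (0 < @leb2 R A)%E.
Proof.
move=> oA [z Az].
have : nbhs z A by exact: open_nbhs_nbhs.
rewrite -nbhs_ballE => -[r /= r0 zA].
have sub : `[z.1 - r / 2, z.1 + r / 2]%classic `*` `[z.2 - r / 2, z.2 + r / 2]%classic `<=` A.
  move=> w [] /=; rewrite !in_itv /= => /andP[h1 h2] /andP[h3 h4]; apply: zA.
  by split; rewrite /ball /= ltr_norml; apply/andP; split; lra.
have mA := open_measurable2 oA.
apply: lt_le_trans (le_measure (@leb2 R) _ _ sub); rewrite ?inE//; last first.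
  by apply: measurableX; exact: measurable_itv.
rewrite /leb2 [ltRHS]product_measure1E; [|exact: measurable_itv|exact: measurable_itv].
have pos (x : R) : (0 < @lebesgue_measure R `[(x - r / 2)%R, (x + r / 2)%R]%classic)%E.
  rewrite lebesgue_measure_itv /= lte_fin ifT; last by lra.
  by rewrite -EFinD lte_fin; lra.
by apply: mule_gt0; exact: pos.
Qed.

Definition cap_energy Om (c : R * R) : R := \int[@leb2 R]_(z in Om) (Num.max 0 (1 - dist2 c z) ^+ 2).

Lemma cap_bm X (c : R * R) : bm (T := R2) (box X) (fun z => Num.max 0 (1 - dist2 c z)).
Proof.
have bx : bm (T := R2) (box X) (fun z => z.1).
  split; first exact: measurable_fst.
  by exists X => z [+ _]; rewrite /seg /= in_itv /= ler_norml.
have by_ : bm (T := R2) (box X) (fun z => z.2).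
  split; first exact: measurable_snd.
  by exists X => z [_]; rewrite /seg /= in_itv /= ler_norml.
have bq : bm (T := R2) (box X) (dist2 c) by rewrite /dist2; bm_auto.
by under eq_fun do rewrite maxr_absE; bm_auto.
Qed.

Lemma cap_ge0 (c z : R * R) : 0 <= Num.max 0 (1 - dist2 c z). Proof. by rewrite le_max lexx. Qed.
Lemma cap_le1 (c z : R * R) : Num.max 0 (1 - dist2 c z) <= 1.
Proof. by rewrite ge_max ler01 /=; have := dist2_ge0 c z; lra. Qed.

Lemma bm_subset (A B : set (R * R)) (f : R * R -> R) : A `<=` B -> bm (T := R2) B f -> bm (T := R2) A f.
Proof. by move=> AB [mf [C HC]]; split=> //; exists C => z /AB /HC. Qed.

Lemma cap_energy_continuous X Om : measurable Om -> Om `<=` box X -> continuous (cap_energy Om).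
Proof.
move=> mOm OmX c.
have finOm : (@leb2 R Om < +oo)%E.
  by apply: le_lt_trans (box_fin X); apply: le_measure; rewrite ?inE//; exact: measurable_box.
pose lam := fine (@leb2 R Om).
pose B (w : R * R) : R := 2 * (`|w.1 - c.1| * (2 * X + `|c.1| + `|w.1|) + `|w.2 - c.2| * (2 * X + `|c.2| + `|w.2|)).
have capb w : bm (T := R2) Om (fun z => Num.max 0 (1 - dist2 w z)) by exact: bm_subset OmX (cap_bm X w).
have lip w : `|cap_energy Om w - cap_energy Om c| <= B w * lam.
  have bw := capb w; have bc := capb c.
  rewrite /cap_energy -(@bm_intB _ R2 R (@leb2 R) Om mOm finOm); [|by bm_auto|by bm_auto].
  apply: le_trans (le_normr_Rintegral _ _) _ => //.
    by apply: (@bm_integrable _ R2 R (@leb2 R) Om mOm finOm); bm_auto.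
  rewrite -(Rintegral_cst (@leb2 R) mOm).
  apply: (@bm_le_int _ R2 R (@leb2 R) Om mOm finOm); [by bm_auto|exact: bm_cst|move=> z /OmX[]].
  rewrite /seg /= !in_itv /= => zx zy.
  rewrite subr_sqr normrM mulrC /B.
  have c0 := cap_ge0 c z; have c1 := cap_le1 c z; have w0 := cap_ge0 w z; have w1 := cap_le1 w z.
  apply: ler_pM => //.
    by rewrite ger0_norm ?addr_ge0//; lra.
  have h : `|Num.max 0 (1 - dist2 w z) - Num.max 0 (1 - dist2 c z)| <= `|dist2 w z - dist2 c z|.
    rewrite ler_norml; have := ler_norm (dist2 w z - dist2 c z); have := ler_norm (- (dist2 w z - dist2 c z)).
    rewrite normrN => h1 h2; apply/andP; split.
    - by case: (leP 0 (1 - dist2 w z)) => ?; case: (leP 0 (1 - dist2 c z)) => ?; lra.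
    - by case: (leP 0 (1 - dist2 w z)) => ?; case: (leP 0 (1 - dist2 c z)) => ?; lra.
  apply: (le_trans h); rewrite /dist2.
  have -> : (z.1 - w.1) ^+ 2 + (z.2 - w.2) ^+ 2 - ((z.1 - c.1) ^+ 2 + (z.2 - c.2) ^+ 2) =
    (w.1 - c.1) * (w.1 + c.1 - 2 * z.1) + (w.2 - c.2) * (w.2 + c.2 - 2 * z.2) by ring.
  have aux (x a b : R) : - X <= x <= X -> `|a + b - 2 * x| <= 2 * X + `|b| + `|a|.
    move=> /andP[x1 x2]; rewrite ler_norml.
    have := ler_norm a; have := ler_norm b; have := ler_norm (- a); have := ler_norm (- b); rewrite !normrN => *.
    by apply/andP; split; lra.
  apply: (le_trans (ler_normD _ _)); rewrite !normrM.
  by apply: lerD; apply: ler_wpM2l => //; exact: aux.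
have cB : B w * lam @[w --> c] --> (0 : R).
  have -> : 0 = B c * lam by rewrite /B !subrr normr0 !mul0r addr0 mulr0 mul0r.
  have f1 : w.1 @[w --> c] --> c.1 by exact: cvg_fst.
  have f2 : w.2 @[w --> c] --> c.2 by exact: cvg_snd.
  apply: cvgM; last exact: cvg_cst.
  apply: cvgM; first exact: cvg_cst.
  by apply: cvgD; apply: cvgM; [apply: cvg_norm; apply: cvgB => //; exact: cvg_cst|apply: cvgD; [exact: cvg_cst|exact: cvg_norm]|apply: cvg_norm; apply: cvgB => //; exact: cvg_cst|apply: cvgD; [exact: cvg_cst|exact: cvg_norm]].
apply/cvgrPdist_le => eps eps0.
move/cvgrPdist_le: cB => /(_ _ eps0); apply: filterS => w.
rewrite sub0r normrN => h; rewrite distrC; apply: le_trans (lip w) _.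
exact: le_trans (ler_norm _) h.
Qed.

Lemma cap_energy_disk (c : R * R) : cap_energy (disk c 1) c = pi / 3.
Proof.
rewrite /cap_energy /Rintegral.
have -> : (\int[@leb2 R]_(z in disk c 1) (Num.max 0 (1 - dist2 c z) ^+ 2)%:E = ((pi : R)%:E * \int[@lebesgue_measure R]_(s in `[0%R, 1%R]) ((1 - s) ^+ 2)%:E))%E.
  rewrite -(@radial_integral R c (fun s => (1 - s) ^+ 2)).
  - apply: eq_integral => z; rewrite inE /disk /= expr1n => zd.
    by rewrite max_r// subr_ge0 ltW.
  - by apply: measurable_funX; apply: measurable_funB.
  - by move=> s; exact: sqr_ge0.
have mu1 : (@lebesgue_measure R `[0%R, 1%R]%classic < +oo)%E.
  by rewrite lebesgue_measure_itv /= lte_fin ltr01 -EFinD ltry.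
have bs : bm (T := measurableTypeR R) `[0%R, 1%R]%classic (fun s : R => (1 - s) ^+ 2).
  apply: bmX; apply: bmB; first exact: bm_cst.
  split; first exact: measurable_id.
  by exists 1 => x; rewrite /= in_itv /= ler_norml => /andP[h1 h2]; apply/andP; split => //; lra.
rewrite (@bm_intE _ (measurableTypeR R) R (@lebesgue_measure R) `[0%R, 1%R]%classic (measurable_itv _) mu1)//.
have cf : continuous (fun s : R => (1 - s) ^+ 2).
  by move=> s; apply: cvgM; apply: cvgB; [exact: cvg_cst|exact: cvg_id|exact: cvg_cst|exact: cvg_id].
have df (s : R) : is_derive s (1:R) (fun s => - (1 - s) ^+ 3 / 3) ((1 - s) ^+ 2).
  by apply: is_derive_eq; rewrite /GRing.scale /=; field.
rewrite (FTC2 ler01 cf df) -EFinM /= subrr subr0 expr1n expr0n /=.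
by move: (pi : R) => p; field.
Qed.

(** The integrand vanishes outside the disk and its integral over the disk is [pi/3], so nothing is
    left for the part of the disk outside [Om], where the integrand is positive. *)
Lemma cap_full_disk X Om (c : R * R) : measurable Om -> Om `<=` box X -> pi / 3 <= cap_energy Om c ->
  leb2 (disk c 1 `\` Om) = 0%E.
Proof.
move=> mOm OmX hc.
have mD : measurable (disk c 1 : set R2) := measurable_disk c 1.
pose f (z : R2) := Num.max 0 (1 - dist2 c z) ^+ 2.
have mf : measurable_fun setT (EFin \o f).
  apply/measurable_EFinP; apply: measurable_funX.
  by have [] := cap_bm X c.
have f0 z : (0 <= (EFin \o f) z)%E by rewrite lee_fin sqr_ge0.
have f1 z : ~ disk c 1 z -> f z = 0.
  rewrite /disk /= expr1n => /negP; rewrite -leNgt => h.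
  by rewrite /f max_l ?expr0n// subr_le0.
have finOm : (@leb2 R Om < +oo)%E.
  by apply: le_lt_trans (box_fin X); apply: le_measure; rewrite ?inE//; exact: measurable_box.
have IOm : (\int[@leb2 R]_(z in Om) (f z)%:E = (cap_energy Om c)%:E)%E.
  apply: (@bm_intE _ R2 R (@leb2 R) Om mOm finOm); apply: bmX.
  exact: bm_subset OmX (cap_bm X c).
have areaD := disk_area c.
have finD : (@leb2 R (disk c 1) < +oo)%E by rewrite areaD ltry.
have ID : (\int[@leb2 R]_(z in disk c 1) (f z)%:E = (pi / 3)%:E)%E.
  rewrite -(cap_energy_disk c); apply: (@bm_intE _ R2 R (@leb2 R) _ mD finD); apply: bmX.
  have [m _] := cap_bm X c; split=> //; exists 1 => z _.
  by rewrite ger0_norm ?cap_ge0// cap_le1.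
have IOD : (\int[@leb2 R]_(z in Om) (f z)%:E = \int[@leb2 R]_(z in disk c 1 `&` Om) (f z)%:E)%E.
  rewrite [LHS]integral_mkcond [RHS]integral_mkcond; apply: eq_integral => z _.
  rewrite !patchE; case: ifPn => zO; case: ifPn => // zD; rewrite ?inE ?notin_setE in zO zD.
  - by rewrite f1// => dz; apply: zD.
  - by case: zD => _ /zO.
have split_D : (\int[@leb2 R]_(z in disk c 1) (f z)%:E =
    \int[@leb2 R]_(z in disk c 1 `&` Om) (f z)%:E + \int[@leb2 R]_(z in disk c 1 `\` Om) (f z)%:E)%E.
  rewrite -{1}(setUIDK (disk c 1) Om).
  rewrite (@ge0_integral_setU _ R2 R (@leb2 R))//.
  - exact: measurableI.
  - exact: measurableD.
  - exact: measurable_funTS.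
  - by move=> z _; exact: f0.
  - by apply/disj_setPS => z [[_ h] [_]].
rewrite ID -IOD IOm in split_D.
have I0 : (\int[@leb2 R]_(z in disk c 1 `\` Om) (f z)%:E = 0)%E.
  apply/eqP; rewrite eq_le integral_ge0 ?andbT => [|z _]; last exact: f0.
  move: split_D; move: (\int[_]_(_ in _) _)%E => [r| |] //=.
  by rewrite -EFinD => -[h]; rewrite lee_fin; lra.
have mDO : measurable (disk c 1 `\` Om : set R2) by exact: measurableD.
apply: measure_negligible => //.
have := (@ae_eq_integral_abs _ R2 R (@leb2 R) _ mDO (EFin \o f) (measurable_funTS mf)).1.
have -> : (\int[@leb2 R]_(x in disk c 1 `\` Om) `|(EFin \o f) x| = 0)%E.
  by rewrite -I0; apply: eq_integral => z _; rewrite gee0_abs.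
move=> /(_ erefl) ae; apply: negligibleS ae => z [Dz nz] /= h.
have := h (conj Dz nz); rewrite /cst /= => -[] /eqP.
rewrite /f sqrf_eq0 => /eqP; move: Dz; rewrite /disk /= expr1n => Dz.
by rewrite max_r ?subr_ge0 ?ltW// => /eqP; rewrite subr_eq0 gt_eqF.
Qed.

(** Reduces the directional derivatives in which smoothness is stated to derivatives of functions of
    one variable. *)
Lemma pderiv_quotient1 (f : R * R -> R) (x y : R) :
  (fun h : R => h^-1 *: (f (h *: edir R false + (x, y)) - f (x, y))) =
  (fun h : R => h^-1 *: ((fun t => f (t, y)) (h *: 1 + x) - f (x, y))).
Proof.
apply/funext => h; congr (_ *: (f _ - _)).
by rewrite /edir [LHS]surjective_pairing /= scaler0 add0r.
Qed.

Lemma pderiv_quotient2 (f : R * R -> R) (x y : R) :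
  (fun h : R => h^-1 *: (f (h *: edir R true + (x, y)) - f (x, y))) =
  (fun h : R => h^-1 *: ((fun t => f (x, t)) (h *: 1 + y) - f (x, y))).
Proof.
apply/funext => h; congr (_ *: (f _ - _)).
by rewrite /edir [LHS]surjective_pairing /= scaler0 add0r.
Qed.

Lemma pderiv_is_derive1 (f : R * R -> R) (x y : R) : derivable f (x, y) (edir R false) ->
  is_derive x (1:R) (fun t => f (t, y)) (pderiv false f (x, y)).
Proof.
rewrite /derivable /pderiv /derive /= => df; split.
  by move: df; rewrite pderiv_quotient1.
by rewrite /derive pderiv_quotient1.
Qed.

Lemma pderiv_is_derive2 (f : R * R -> R) (x y : R) : derivable f (x, y) (edir R true) ->
  is_derive y (1:R) (fun t => f (x, t)) (pderiv true f (x, y)).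
Proof.
rewrite /derivable /pderiv /derive /= => df; split.
  by move: df; rewrite pderiv_quotient2.
by rewrite /derive pderiv_quotient2.
Qed.

Lemma open_disk (c : R * R) r : open (disk c r).
Proof.
rewrite (_ : disk c r = [set z | dist2 c z - r ^+ 2 < 0]).
  apply: open_sublevel => z; apply: cvgB; last exact: cvg_cst.
  exact: dist2_continuous.
by apply/seteqP; split=> z; rewrite /disk /= subr_lt0.
Qed.

(** Equal areas make both differences null. An open set in a null set is empty, so [rho <= 0] on the
    disk; a zero of [rho] inside it would be a local maximum with vanishing gradient, which the
    boundary condition forbids, so slits and punctures are excluded. Conversely [Om] lies in the
    closed disk and, being open, in the open one. *)
Lemma disk_of_cap X rho (c : R * R) (Om := [set z | rho z < 0]) :
  smooth rho -> (forall z, rho z = 0 -> (pderiv false rho z, pderiv true rho z) != 0) ->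
  Om `<=` box X -> leb2 Om = (pi : R)%:E -> pi / 3 <= cap_energy Om c -> Om = disk c 1.
Proof.
move=> srho grad OmX areaOm hc.
have crho : continuous rho := (srho [::]).1.
have drho b z : derivable rho z (edir R b) := (srho [::]).2 b z.
have oOm : open Om := open_sublevel crho.
have mOm : measurable (Om : set R2) := open_measurable2 oOm.
have mD : measurable (disk c 1 : set R2) := measurable_disk c 1.
have DO := cap_full_disk mOm OmX hc.
have null0 (A B : set (R * R)) : open A -> measurable (B : set R2) -> A `<=` B -> leb2 B = 0%E -> A = set0.
  move=> oA mB AB B0; apply: contrapT => /eqP /set0P /(open_pos_measure oA).
  apply/negP; rewrite -leNgt -B0; apply: le_measure; rewrite ?inE//; exact: open_measurable2.
have OD : leb2 (Om `\` disk c 1) = 0%E.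
  have h1 : (@leb2 R (disk c 1) = leb2 (disk c 1 `\` Om) + leb2 (disk c 1 `&` Om))%E by apply: measureDI.
  have h2 : (@leb2 R Om = leb2 (Om `\` disk c 1) + leb2 (Om `&` disk c 1))%E by apply: measureDI.
  move: h1 h2; rewrite DO add0e disk_area areaOm setIC => <-.
  move: (leb2 _) => [r| |] //=; rewrite -EFinD => -[h]; congr EFin; move: h; move: (pi : R) => p; lra.
have rho_le z : disk c 1 z -> rho z <= 0.
  move=> Dz; rewrite leNgt; apply/negP => rz.
  have : (disk c 1 `&` [set z | - rho z < 0]) = set0.
    apply: null0 DO.
    - apply: openI; first exact: open_disk.
      by apply: open_sublevel => w; apply: cvgN; exact: crho.
    - exact: measurableD.
    - by move=> w [Dw]; rewrite /= oppr_lt0 => rw; split=> //; rewrite /Om /= => h; have := lt_trans h rw; rewrite ltxx.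
  by move=> h; have : set0 z by rewrite -h; split=> //; rewrite /= oppr_lt0.
have sub1 z : disk c 1 z -> Om z.
  move=> Dz; rewrite /Om /= lt_neqAle rho_le// andbT; apply/negP => /eqP rz.
  have : nbhs z (disk c 1) by apply: open_nbhs_nbhs; split=> //; exact: open_disk.
  rewrite -nbhs_ballE => -[r /= r0 zD].
  move: rz zD; case: z Dz => x y Dz rz zD.
  have := grad _ rz; apply/negP; rewrite negbK; apply/eqP; congr pair.
    have d0 : is_derive x (1:R) (fun t => rho (t, y)) 0.
      apply: (@derive1_at_max _ _ (x - r) (x + r)); first by lra.
      - by move=> t _; have := pderiv_is_derive1 (drho false (t, y)) => -[].
      - by rewrite in_itv /=; apply/andP; split; lra.
      - move=> t; rewrite in_itv /= rz => /andP[t1 t2]; apply: rho_le; apply: zD; split=> /=.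
          by rewrite /ball /= ltr_norml; apply/andP; split; lra.
        by rewrite /ball /= subrr normr0.
    have d1 := pderiv_is_derive1 (drho false (x, y)).
    by rewrite -(@derive_val _ _ _ _ _ _ _ d1) (@derive_val _ _ _ _ _ _ _ d0).
  have d0 : is_derive y (1:R) (fun t => rho (x, t)) 0.
    apply: (@derive1_at_max _ _ (y - r) (y + r)); first by lra.
    - by move=> t _; have := pderiv_is_derive2 (drho true (x, t)) => -[].
    - by rewrite in_itv /=; apply/andP; split; lra.
    - move=> t; rewrite in_itv /= rz => /andP[t1 t2]; apply: rho_le; apply: zD; split=> /=.
        by rewrite /ball /= subrr normr0.
      by rewrite /ball /= ltr_norml; apply/andP; split; lra.
  have d1 := pderiv_is_derive2 (drho true (x, y)).
  by rewrite -(@derive_val _ _ _ _ _ _ _ d1) (@derive_val _ _ _ _ _ _ _ d0).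
apply/seteqP; split=> // z Oz.
have out_empty w : Om w -> dist2 c w <= 1.
  move=> Ow; rewrite leNgt; apply/negP => wq.
  have : (Om `&` [set w | 1 - dist2 c w < 0]) = set0.
    apply: null0 OD.
    - apply: openI => //; apply: open_sublevel => t; apply: cvgB; first exact: cvg_cst.
      exact: dist2_continuous.
    - exact: measurableD.
    - move=> t [Ot]; rewrite /= subr_lt0 => tq; split=> //; rewrite /disk /= expr1n => h.
      by have := lt_trans h tq; rewrite ltxx.
  by move=> h; have : set0 w by rewrite -h; split=> //; rewrite /= subr_lt0.
rewrite /disk /= expr1n lt_neqAle; have := out_empty z Oz; rewrite /dist2 => -> /=; rewrite andbT.
apply/negP => /eqP zq.
have : nbhs z Om by exact: open_nbhs_nbhs.
rewrite -nbhs_ballE => -[r /= r0 zO].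
have z1 : `|z.1 - c.1| <= 1.
  by rewrite -ler_sqr ?nnegrE// expr1n real_normK ?num_real//; have := sqr_ge0 (z.2 - c.2); lra.
have z2 : `|z.2 - c.2| <= 1.
  by rewrite -ler_sqr ?nnegrE// expr1n real_normK ?num_real//; have := sqr_ge0 (z.1 - c.1); lra.
(* A point of [Om] on the unit circle, moved outward by the factor [1 + r / 2], remains in [Om] but
   leaves the closed disk. *)
pose w := (z.1 + r / 2 * (z.1 - c.1), z.2 + r / 2 * (z.2 - c.2)).
have aux (x y : R) : `|x - y| <= 1 -> ball x r (x + r / 2 * (x - y)).
  move=> h; rewrite /ball /= opprD addNKr normrN normrM ger0_norm; last by lra.
  by apply: (@le_lt_trans _ _ (r / 2 * 1)); [apply: ler_wpM2l => //; lra|lra].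
have Ow : Om w by apply: zO; split; exact: aux.
have := out_empty w Ow; rewrite /dist2 /w /=.
have -> : (z.1 + r / 2 * (z.1 - c.1) - c.1) ^+ 2 + (z.2 + r / 2 * (z.2 - c.2) - c.2) ^+ 2 =
  (1 + r / 2) ^+ 2 * ((z.1 - c.1) ^+ 2 + (z.2 - c.2) ^+ 2) by ring.
rewrite zq mulr1; nra.
Qed.

End DiskRigidity.

(** * The dichotomy between disks and a uniform gap *)

Section RigidDomain.
Variable R : realType.
Local Notation R2 := (measurableTypeR R * measurableTypeR R)%type.

(** The bound is uniform in [u], so that it survives the closure in H^1; a strict inequality for
    each [u] would not. *)
Definition gap_ge (Om : set (R * R)) (delta : R) : Prop := forall K u u1 u2, compact K -> K `<=` Om ->
  C1c K u u1 u2 -> (forall z, 0 <= u z) -> delta <= gap Om u u1 u2.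

(** [c] maximises the continuous function [cap_energy Om] on the compact square. If no positive
    [delta] works, every [kap] admits some [u] with gap below [kap^2 / pi] and 1/36, hence a centre
    in the square with energy at least [pi/3 - kap * B]; the maximum is then at least [pi/3]. *)
Lemma gap_rigidity X rho (Om := [set z | rho z < 0]) : 0 < X -> smooth rho ->
  (forall z, rho z = 0 -> (pderiv false rho z, pderiv true rho z) != 0) ->
  (forall z, Om z -> (- X < z.1 < X) && (- X < z.2 < X)) -> leb2 Om = (pi : R)%:E ->
  gap_ge Om 0 /\ ((exists c, Om = disk c 1) \/ exists2 delta, 0 < delta & gap_ge Om delta).
Proof.
move=> X0 srho grad OmX' areaOm.
have crho : continuous rho := (srho [::]).1.
have OmX := open_box OmX'.
have mOm : measurable (Om : set R2) := open_measurable2 (open_sublevel crho).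
split.
  by move=> K u u1 u2 cK KOm c1 u0; have [] := gap_stability X0 crho OmX' areaOm cK KOm c1 u0.
have [[delta d0 gd]|nd] := pselect (exists2 delta, 0 < delta & gap_ge Om delta); first by right; exists delta.
left.
have cbox : compact (box X).
  by apply: compact_setX; exact: segment_compact.
have box0 : box X !=set0.
  by exists (0, 0); split; rewrite /seg /= in_itv /=; apply/andP; split; lra.
have [c _ cmax] := compact_EVT_max box0 cbox (continuous_subspaceT (cap_energy_continuous mOm OmX)).
exists c; apply: (disk_of_cap srho grad OmX areaOm).
have p0 := pi_gt0 R.
pose B := stability_bound X.
have key kap : 0 < kap -> kap <= 1 -> pi / 3 - kap * B <= cap_energy Om c.
  move=> k0 k1.
  pose delta := Num.min (1 / 36) (pi^-1 * kap ^+ 2).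
  have d0 : 0 < delta by rewrite lt_min; apply/andP; split; [lra|rewrite mulr_gt0 ?invr_gt0 ?exprn_gt0].
  have : ~ gap_ge Om delta by move=> h; apply: nd; exists delta.
  move=> /existsNP[K] /existsNP[u] /existsNP[u1] /existsNP[u2] /not_implyP[cK] /not_implyP[KOm] /not_implyP[c1] /not_implyP[u0] /negP.
  rewrite -ltNge lt_min => /andP[g1 g2].
  have [_ /(_ kap g1 k0 k1)] := gap_stability X0 crho OmX' areaOm cK KOm c1 u0.
  have hk : pi * gap Om u u1 u2 <= kap ^+ 2 by rewrite mulrC -ler_pdivlMr// mulrC ltW.
  move=> /(_ hk)[c' [c'1 c'2 hc']]; apply: le_trans hc' _; apply: cmax; rewrite inE.
  by split; rewrite /seg /= in_itv /= -ler_norml.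
apply/ler_addgt0Pr => eps eps0.
have B0 : 0 <= `|B| by [].
pose kap := Num.min 1 (eps / (`|B| + 1)).
have B1 : 0 < `|B| + 1 by lra.
have k0 : 0 < kap by rewrite lt_min ltr01 /= divr_gt0.
have k1 : kap <= 1 by rewrite ge_min lexx.
have := key kap k0 k1.
have : kap * B <= eps.
  apply: (@le_trans _ _ (kap * (`|B| + 1))).
    by apply: ler_wpM2l; [exact: ltW|have := ler_norm B; lra].
  apply: (@le_trans _ _ (eps / (`|B| + 1) * (`|B| + 1))); last by rewrite divfK// gt_eqF.
  by apply: ler_wpM2r; [exact: ltW|rewrite ge_min lexx orbT].
move: (kap * B) (cap_energy _ _) (pi / 3) => *; lra.
Qed.

End RigidDomain.

(** * The lower bound on H^1_0 *)

Section Smoothing.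
Variable R : realType.
Local Notation R2 := (measurableTypeR R * measurableTypeR R)%type.
Implicit Types (Om : set (R * R)) (phi : R * R -> R) (eta : R).

(* A nonnegative C^1 substitute for [phi] whose Dirichlet energy is no larger. *)
Definition soft_abs eta phi z : R := Num.sqrt (phi z ^+ 2 + eta ^+ 2) - eta.
Definition soft_abs_grad eta phi (psi : R * R -> R) z : R := phi z / Num.sqrt (phi z ^+ 2 + eta ^+ 2) * psi z.

Let root_gt0 eta phi z : 0 < eta -> 0 < phi z ^+ 2 + eta ^+ 2.
Proof. by move=> h; rewrite ltr_wpDl ?sqr_ge0// exprn_gt0. Qed.

Lemma soft_abs_ge0 eta phi z : 0 < eta -> 0 <= soft_abs eta phi z.
Proof.
move=> h; rewrite subr_ge0; apply: (@le_trans _ _ (Num.sqrt (eta ^+ 2))).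
  by rewrite sqrtr_sqr ler_norm.
by rewrite ler_wsqrtr// lerDr sqr_ge0.
Qed.

Lemma soft_abs_ge eta phi z : 0 < eta -> phi z <= soft_abs eta phi z + eta.
Proof.
move=> h; rewrite subrK (le_trans (ler_norm _))// -sqrtr_sqr ler_wsqrtr//.
by rewrite lerDl sqr_ge0.
Qed.

Lemma soft_abs_grad_sqr eta phi (psi : R * R -> R) z : 0 < eta -> soft_abs_grad eta phi psi z ^+ 2 <= psi z ^+ 2.
Proof.
move=> h; rewrite /soft_abs_grad exprMn ler_piMl ?sqr_ge0// exprMn exprVn sqr_sqrtr; last exact/ltW/root_gt0.
by rewrite ler_pdivrMr ?root_gt0// mul1r lerDl sqr_ge0.
Qed.

Lemma is_derive_soft_abs eta (f : R -> R) (x f1 : R) : 0 < eta -> is_derive x (1:R) f f1 ->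
  is_derive x (1:R) (fun t => Num.sqrt (f t ^+ 2 + eta ^+ 2) - eta) (f x / Num.sqrt (f x ^+ 2 + eta ^+ 2) * f1).
Proof.
move=> h df; have p : 0 < f x ^+ 2 + eta ^+ 2 by rewrite ltr_wpDl ?sqr_ge0// exprn_gt0.
have d2 : is_derive x (1:R) (fun t => f t ^+ 2 + eta ^+ 2) (2 * f x * f1).
  by apply: is_derive_eq; rewrite /GRing.scale /=; ring.
have := @is_derive1_comp _ Num.sqrt (fun t => f t ^+ 2 + eta ^+ 2) x _ _ (is_derive1_sqrt p) d2 => d3.
have s0 : Num.sqrt (f x ^+ 2 + eta ^+ 2) != 0 by rewrite gt_eqF// sqrtr_gt0.
by apply: is_derive_eq; rewrite subr0; field.
Qed.

Lemma soft_abs_C1c eta phi (K : set (R * R)) : 0 < eta -> smooth phi -> (forall z, ~ K z -> phi z = 0) ->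
  C1c K (soft_abs eta phi) (soft_abs_grad eta phi (pderiv false phi)) (soft_abs_grad eta phi (pderiv true phi)).
Proof.
move=> h sphi phiK.
have cphi : continuous phi := (sphi [::]).1.
have cs : continuous (fun z => Num.sqrt (phi z ^+ 2 + eta ^+ 2)).
  move=> z; apply: (@continuous_comp _ _ _ (fun z => phi z ^+ 2 + eta ^+ 2) Num.sqrt); last exact: sqrt_continuous.
  by apply: cvgD; [apply: cvgM; exact: cphi|exact: cvg_cst].
have cg psi : continuous psi -> continuous (soft_abs_grad eta phi psi).
  move=> cpsi z; apply: cvgM; last exact: cpsi.
  apply: cvgM; first exact: cphi.
  by apply: cvgV; [rewrite gt_eqF// sqrtr_gt0 root_gt0|exact: cs].
split.
- by move=> z; apply: cvgB; [exact: cs|exact: cvg_cst].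
- exact: cg (sphi [:: false]).1.
- exact: cg (sphi [:: true]).1.
- move=> x y; apply: (@is_derive_soft_abs eta (fun t => phi (t, y)) x _ h).
  exact: pderiv_is_derive1 ((sphi [::]).2 false (x, y)).
- move=> x y; apply: (@is_derive_soft_abs eta (fun t => phi (x, t)) y _ h).
  exact: pderiv_is_derive2 ((sphi [::]).2 true (x, y)).
- by move=> z /phiK phz; rewrite /soft_abs phz expr0n add0r sqrtr_sqr ger0_norm ?subrr// ltW.
Qed.

(** The gap bound concerns nonnegative functions. It is applied to [soft_abs eta phi], which has no
    more energy and satisfies [expR phi <= expR eta * expR (soft_abs eta phi)]; then [eta] tends to
    0. *)
Lemma moser_Cc_inf Om delta phi : measurable (Om : set R2) -> leb2 Om = (pi : R)%:E -> gap_ge Om delta -> Cc_inf Om phi ->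
  \int[@leb2 R]_(z in Om) expR (phi z) <=
  pi * expR (1 - delta + dirichlet Om (pderiv false phi) (pderiv true phi) / (16 * pi)).
Proof.
move=> mOm areaOm gd [sphi [K [cK KOm phiK]]].
have finOm : (@leb2 R Om < +oo)%E by rewrite areaOm ltry.
have cphi : continuous phi := (sphi [::]).1.
have p0 := pi_gt0 R.
have clK := compact_closed2 cK.
have d1 x y := pderiv_is_derive1 ((sphi [::]).2 false (x, y)).
have d2 x y := pderiv_is_derive2 ((sphi [::]).2 true (x, y)).
have bsup (f : R * R -> R) : continuous f -> (forall z, ~ K z -> f z = 0) -> bm (T := R2) Om f.
  exact: (bm_continuous_supported cK).
have b1 : bm (T := R2) Om (pderiv false phi) := bsup _ (sphi [:: false]).1 (deriv1_off_support clK d1 phiK).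
have b2 : bm (T := R2) Om (pderiv true phi) := bsup _ (sphi [:: true]).1 (deriv2_off_support clK d2 phiK).
have bexp (f : R * R -> R) : continuous f -> (forall z, ~ K z -> f z = 0) -> bm (T := R2) Om (fun z => expR (f z)).
  move=> cf fK; have [C HC] := compact_support_bounded cK cf fK; split.
    apply: continuous_measurable2 => z.
    by apply: (@continuous_comp _ _ _ f (@expR R)); [exact: cf|exact: continuous_expR].
  exists (expR C) => z _; rewrite ger0_norm ?expR_ge0// ler_expR.
  exact: le_trans (ler_norm _) (HC z).
pose S := dirichlet Om (pderiv false phi) (pderiv true phi) / (16 * pi).
pose N := \int[@leb2 R]_(z in Om) expR (phi z).
rewrite -/S -/N.
have key eta : 0 < eta -> N <= expR eta * (pi * expR (1 - delta + S)).
  move=> h; have c1 := soft_abs_C1c h sphi phiK.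
  have := gd _ _ _ _ cK KOm c1 (fun z => soft_abs_ge0 phi z h); rewrite /gap.
  set N' := \int[_]_(z in _) expR _; set S' := dirichlet _ _ _ / _ => hg.
  have bs := bexp _ (c1_continuous c1) (c1_support c1).
  have be := bexp _ cphi phiK.
  have SS : S' <= S.
    rewrite /S' /S; apply: ler_wpM2r; first by rewrite invr_ge0 mulr_ge0// ltW.
    have bg1 := bsup _ (c1_continuous1 c1) (deriv1_off_support clK (c1_derive1 c1) (c1_support c1)).
    have bg2 := bsup _ (c1_continuous2 c1) (deriv2_off_support clK (c1_derive2 c1) (c1_support c1)).
    have bD (h0 k0 : R2 -> R) : bm (T := R2) Om h0 -> bm (T := R2) Om k0 -> bm (T := R2) Om (fun z => h0 z ^+ 2 + k0 z ^+ 2).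
      by move=> bh bk; apply: bmD; exact: bmX.
    apply: (@bm_le_int _ R2 R (@leb2 R) Om mOm finOm); [exact: bD bg1 bg2|exact: bD b1 b2|move=> z _].
    by apply: lerD; exact: soft_abs_grad_sqr.
  have N'0 : pi <= N'.
    have -> : pi = \int[@leb2 R]_(z in Om) (1 : R) by rewrite Rintegral_cst// mul1r; exact: (esym (congr1 fine areaOm)).
    apply: (@bm_le_int _ R2 R (@leb2 R) Om mOm finOm); [exact: bm_cst|by []|move=> z _].
    by rewrite -expR0 ler_expR soft_abs_ge0.
  have N'le : N' <= pi * expR (1 - delta + S).
    rewrite mulrC -ler_pdivrMr// [_ / _]mulrC.
    have q0 : 0 < pi^-1 * N' by rewrite mulr_gt0 ?invr_gt0// (lt_le_trans p0).
    rewrite -[leLHS]lnK ?posrE// ler_expR; lra.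
  apply: (@le_trans _ _ (expR eta * N')); last by apply: ler_wpM2l; [exact: expR_ge0|].
  rewrite /N' -(@bm_intZ _ R2 R (@leb2 R) Om mOm finOm)//.
  apply: (@bm_le_int _ R2 R (@leb2 R) Om mOm finOm); [by []|by bm_auto|move=> z _].
  by rewrite -expRD ler_expR addrC soft_abs_ge.
pose M := pi * expR (1 - delta + S).
have M0 : 0 < M by rewrite mulr_gt0 ?expR_gt0.
rewrite -/M; have cM : expR eta * M @[eta --> 0^'+] --> M.
  rewrite -[X in _ --> X]mul1r -(expR0 R); apply: cvgM; last exact: cvg_cst.
  by apply: cvg_at_right_filter; exact: continuous_expR.
have <- := cvg_lim (@Rhausdorff R) cM.
apply: limr_ge; first by apply/cvg_ex; exists M.
by near=> eta; apply: key; near: eta; exact: nbhs_right_gt.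
Unshelve. all: by end_near. Qed.

End Smoothing.

(** * Passage from test functions to H^1_0 *)

Section Density.
Variable R : realType.
Local Notation R2 := (measurableTypeR R * measurableTypeR R)%type.
Implicit Types (Om : set (R * R)) (u : R * R -> R).

(** The bound reached when [phi] is within [s] of [u] in the H^1 sense. The truncation level [N]
    occurs only in a term that vanishes with [s]. *)
Let tol (N S M s : R) : R := M * expR (((1 + s) * S + (2 * s ^+ 2 + 2 * s) * 2) / (16 * pi)) + expR N * (s * pi + s).

(** The exponential lies above its tangent at [t = min (u0, N)], where its slope is at most
    [expR N]. Truncation thus makes L^2 closeness sufficient, although [exp] is not Lipschitz. *)
Lemma trunc_young (u0 phi0 N s : R) : 0 < s ->
  expR (Num.min u0 N) <= expR phi0 + (expR N * s + expR N / s * (phi0 - u0) ^+ 2).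
Proof.
move=> s0; set t := Num.min u0 N.
have tu : t <= u0 by rewrite ge_min lexx.
have tN : expR t <= expR N by rewrite ler_expR ge_min lexx orbT.
have h1 : expR t * (1 + (phi0 - t)) <= expR phi0.
  have := expR_ge1Dx (phi0 - t) => h; have := ler_wpM2l (expR_ge0 t) h.
  by rewrite -expRD [t + _]addrC subrK.
have h2 : `|phi0 - u0| <= s + s^-1 * (phi0 - u0) ^+ 2.
  rewrite -(real_normK (num_real (phi0 - u0))); set a := `|_|.
  have a0 : 0 <= a by exact: normr_ge0.
  have E : s + s^-1 * a ^+ 2 - a = s^-1 * ((s - a / 2) ^+ 2 + 3 / 4 * a ^+ 2) by field; rewrite gt_eqF.
  rewrite -subr_ge0 E mulr_ge0 ?invr_ge0 ?(ltW s0)// addr_ge0 ?sqr_ge0// mulr_ge0 ?sqr_ge0//; lra.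
have h3 : - `|phi0 - u0| <= phi0 - t by have := ler_norm (- (phi0 - u0)); rewrite normrN; lra.
have et := expR_gt0 t; have eN := expR_gt0 N.
apply: (@le_trans _ _ (expR phi0 + expR N * `|phi0 - u0|)).
  have a0 : 0 <= `|phi0 - u0| by [].
  by nra.
rewrite lerD2l -mulrA -mulrDr; apply: ler_wpM2l => //; exact: ltW.
Qed.

Lemma grad_young (a g s : R) : 0 < s -> a ^+ 2 <= (1 + s) * g ^+ 2 + (1 + s^-1) * (a - g) ^+ 2.
Proof.
move=> s0; rewrite -subr_ge0.
have -> : (1 + s) * g ^+ 2 + (1 + s^-1) * (a - g) ^+ 2 - a ^+ 2 = s^-1 * (s * g - (a - g)) ^+ 2 by field; rewrite gt_eqF.
by rewrite mulr_ge0 ?sqr_ge0// invr_ge0 ltW.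
Qed.

Lemma moser_trunc Om delta u g1 g2 (N s : R) : measurable (Om : set R2) -> leb2 Om = (pi : R)%:E -> gap_ge Om delta ->
  H10 Om u g1 g2 -> 0 < s ->
  (\int[@leb2 R]_(z in Om) (expR (Num.min (u z) N))%:E <=
   (tol N (fine (\int[@leb2 R]_(z in Om) (g1 z ^+ 2 + g2 z ^+ 2)%:E)) (pi * expR (1 - delta)) s)%:E)%E.
Proof.
move=> mOm areaOm gd [[mu_ mg1 mg2] [iu ig1 ig2] [phi [phiC [cv0 cv1 cv2]]]] s0.
have p0 := pi_gt0 R.
have finOm : (@leb2 R Om < +oo)%E by rewrite areaOm ltry.
have small f : f n @[n --> \oo] --> (0%E : \bar R) -> \forall n \near \oo, (f n < (s ^+ 2)%:E)%E.
  move=> cf; have s2 : (0 : R) < (fun _ : R => s ^+ 2) 0 by rewrite exprn_gt0.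
  by have nb := @nbhs_open_ereal_lt R 0 (fun=> s ^+ 2) s2; exact: (cf _ nb).
have [n [d0 [d1 d2]]] : exists n, (L2dist2 Om (phi n) u < (s ^+ 2)%:E)%E /\
    ((L2dist2 Om (pderiv false (phi n)) g1 < (s ^+ 2)%:E)%E /\ (L2dist2 Om (pderiv true (phi n)) g2 < (s ^+ 2)%:E)%E).
  apply: (@filter_ex _ \oo); apply: filterI; first exact: small.
  by apply: filterI; exact: small.
have [sphi [K [cK KOm phiK]]] := phiC n.
set f := phi n in d0 d1 d2 sphi phiK.
have cf : continuous f := (sphi [::]).1.
have clK := compact_closed2 cK.
have D1 x y := pderiv_is_derive1 ((sphi [::]).2 false (x, y)).
have D2 x y := pderiv_is_derive2 ((sphi [::]).2 true (x, y)).
have b1 : bm (T := R2) Om (pderiv false f) := bm_continuous_supported cK Om (sphi [:: false]).1 (deriv1_off_support clK D1 phiK).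
have b2 : bm (T := R2) Om (pderiv true f) := bm_continuous_supported cK Om (sphi [:: true]).1 (deriv2_off_support clK D2 phiK).
have be : bm (T := R2) Om (fun z => expR (f z)).
  have [C HC] := compact_support_bounded cK cf phiK; split.
    apply: continuous_measurable2 => z.
    by apply: (@continuous_comp _ _ _ f (@expR R)); [exact: cf|exact: continuous_expR].
  exists (expR C) => z _; rewrite ger0_norm ?expR_ge0// ler_expR.
  exact: le_trans (ler_norm _) (HC z).
have bf : bm (T := R2) Om f := bm_continuous_supported cK Om cf phiK.
have mbm h : bm (T := R2) Om h -> measurable_fun Om h by move=> [m _]; exact: measurable_funTS.
have mdist h g : measurable_fun Om (h : R2 -> R) -> measurable_fun Om (g : R2 -> R) -> measurable_fun Om (fun z => ((h z - g z) ^+ 2)%:E).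
  by move=> mh mg; apply/measurable_EFinP; apply: measurable_funX; exact: measurable_funB.
set Sg := fine _.
have iS : (@leb2 R).-integrable Om (fun z => (g1 z ^+ 2 + g2 z ^+ 2)%:E).
  by under eq_fun do rewrite EFinD; exact: integrableD.
have SgE : (\int[@leb2 R]_(z in Om) (g1 z ^+ 2 + g2 z ^+ 2)%:E = Sg%:E)%E.
  by rewrite fineK//; apply: integrable_fin_num.
have is0 : 0 <= s^-1 by rewrite invr_ge0 ltW.
have Sle : dirichlet Om (pderiv false f) (pderiv true f) <= (1 + s) * Sg + (2 * s ^+ 2 + 2 * s).
  rewrite -lee_fin /dirichlet -(@bm_intE _ R2 R (@leb2 R) Om mOm finOm); last by apply: bmD; exact: bmX.
  apply: (@le_trans _ _ (\int[@leb2 R]_(z in Om) (((1 + s)%:E * (g1 z ^+ 2 + g2 z ^+ 2)%:E) +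
     (1 + s^-1)%:E * (((pderiv false f z - g1 z) ^+ 2)%:E + ((pderiv true f z - g2 z) ^+ 2)%:E)))%E).
    apply: ge0_le_integral => //.
    - by move=> z _; rewrite lee_fin addr_ge0// sqr_ge0.
    - by apply/measurable_EFinP; apply: mbm; bm_auto.
    - apply: emeasurable_funD; apply: measurable_funeM.
        exact: measurable_int iS.
      by apply: emeasurable_funD; apply: mdist => //; exact: mbm.
    - move=> z _; rewrite -!(EFinM, EFinD) lee_fin.
      by have := grad_young (pderiv false f z) (g1 z) s0; have := grad_young (pderiv true f z) (g2 z) s0; lra.
  rewrite ge0_integralD//; first last.
  - by apply: measurable_funeM; apply: emeasurable_funD; apply: mdist => //; exact: mbm.
  - by move=> z _; rewrite -!(EFinM, EFinD) lee_fin mulr_ge0// addr_ge0 ?sqr_ge0.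
  - by apply: measurable_funeM; exact: measurable_int iS.
  - by move=> z _; rewrite -!(EFinM, EFinD) lee_fin mulr_ge0// addr_ge0 ?sqr_ge0// ltW.
  rewrite ge0_integralZl_EFin//; first last.
  - by rewrite addr_ge0// ltW.
  - exact: measurable_int iS.
  - by move=> z _; rewrite lee_fin addr_ge0// sqr_ge0.
  rewrite ge0_integralZl_EFin//; first last.
  - by rewrite addr_ge0.
  - by apply: emeasurable_funD; apply: mdist => //; exact: mbm.
  - by move=> z _; rewrite -EFinD lee_fin addr_ge0// sqr_ge0.
  rewrite ge0_integralD//; first last.
  - by apply: mdist => //; exact: mbm.
  - by move=> z _; rewrite lee_fin sqr_ge0.
  - by apply: mdist => //; exact: mbm.
  - by move=> z _; rewrite lee_fin sqr_ge0.
  rewrite SgE -EFinM [leRHS]EFinD leeD2l//.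
  have -> : 2 * s ^+ 2 + 2 * s = (1 + s^-1) * (s ^+ 2 + s ^+ 2) by field; rewrite gt_eqF.
  rewrite [leRHS]EFinM lee_wpmul2l ?lee_fin ?addr_ge0// EFinD.
  by apply: leeD; exact: ltW.
apply: (@le_trans _ _ (\int[@leb2 R]_(z in Om) ((expR (f z))%:E + ((expR N * s)%:E + (expR N / s)%:E * ((f z - u z) ^+ 2)%:E)))%E).
  apply: ge0_le_integral => //.
  - by apply/measurable_EFinP; apply: measurableT_comp => //; apply: measurable_minr.
  - apply: emeasurable_funD; first by apply/measurable_EFinP; exact: mbm.
    apply: emeasurable_funD => //; apply: measurable_funeM; apply: mdist => //; exact: mbm.
  - by move=> z _; rewrite -!(EFinM, EFinD) lee_fin trunc_young.
have eN := expR_gt0 N.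
have Ns : 0 <= expR N / s by rewrite mulr_ge0 ?expR_ge0.
have Ns' : 0 <= expR N * s by rewrite mulr_ge0 ?expR_ge0 ?(ltW s0).
have md : measurable_fun Om (fun z => ((f z - u z) ^+ 2)%:E) by apply: mdist => //; exact: mbm.
rewrite ge0_integralD//; first last.
- by apply: emeasurable_funD => //; apply: measurable_funeM.
- by move=> z _; rewrite -!(EFinM, EFinD) lee_fin addr_ge0// mulr_ge0// sqr_ge0.
- by apply/measurable_EFinP; exact: mbm.
rewrite ge0_integralD//; first last.
- by apply: measurable_funeM.
- by move=> z _; rewrite -!(EFinM, EFinD) lee_fin mulr_ge0// sqr_ge0.
rewrite ge0_integralZl_EFin//; last by move=> z _; rewrite lee_fin sqr_ge0.
have i1 : (\int[@leb2 R]_(z in Om) (expR N * s)%:E = (expR N * s * pi)%:E)%E.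
  by rewrite integral_cst// [RHS]EFinM; congr (_ * _)%E; exact: areaOm.
rewrite i1 (@bm_intE _ R2 R (@leb2 R) Om mOm finOm)// /tol !EFinD.
apply: leeD.
  rewrite lee_fin; apply: (le_trans (moser_Cc_inf mOm areaOm gd (phiC n))).
  rewrite -mulrA -expRD; apply: ler_wpM2l; first exact: ltW.
  rewrite ler_expR lerD2l; apply: ler_wpM2r; first by rewrite invr_ge0 mulr_ge0// ltW.
  apply: le_trans Sle _; have : 0 <= s ^+ 2 by exact: sqr_ge0.
  by lra.
have -> : expR N * (s * pi + s) = expR N * s * pi + expR N * s by move: (pi : R) => p; ring.
rewrite [leRHS]EFinD; apply: leeD => //.
apply: (@le_trans _ _ ((expR N / s)%:E * (s ^+ 2)%:E)%E).
  by apply: lee_wpmul2l; [rewrite lee_fin|exact: ltW].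
by rewrite -EFinM lee_fin le_eqVlt; apply/orP; left; apply/eqP; field; rewrite gt_eqF.
Qed.

(** The limits are taken in this order: [s] to 0 at a fixed truncation level, then the level to
    infinity by monotone convergence. *)
Lemma moser_H10 Om delta u g1 g2 : measurable (Om : set R2) -> leb2 Om = (pi : R)%:E -> gap_ge Om delta ->
  H10 Om u g1 g2 ->
  (\int[@leb2 R]_(z in Om) (expR (u z))%:E <=
   (pi * expR (1 - delta) * expR (fine (\int[@leb2 R]_(z in Om) (g1 z ^+ 2 + g2 z ^+ 2)%:E) / (16 * pi)))%:E)%E.
Proof.
move=> mOm areaOm gd hu.
set S := fine _; set M := pi * expR _.
have trunc N : (\int[@leb2 R]_(z in Om) (expR (Num.min (u z) N))%:E <= (M * expR (S / (16 * pi)))%:E)%E.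
  have ct : (tol N S M s)%:E @[s --> 0^'+] --> (M * expR (S / (16 * pi)))%:E.
    apply: cvg_EFin; first by near=> s.
    have -> : M * expR (S / (16 * pi)) = tol N S M 0.
      by rewrite /tol addr0 mul1r expr0n mulr0 !mul0r !addr0 mulr0 addr0 mul0r addr0.
    apply: cvg_at_right_filter; apply: (_ : continuous (fun s : R => tol N S M s)).
    have ca : continuous (fun s : R => ((1 + s) * S + (2 * s ^+ 2 + 2 * s) * 2) / (16 * pi)).
      move=> s; apply: cvgM; last exact: cvg_cst.
      apply: cvgD; apply: cvgM; try exact: cvg_cst.
        by apply: cvgD; [exact: cvg_cst|exact: cvg_id].
      apply: cvgD; apply: cvgM; try exact: cvg_cst; last exact: cvg_id.
      by apply: cvgM; exact: cvg_id.
    move=> s; apply: cvgD; apply: cvgM; try exact: cvg_cst.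
      apply: (@continuous_comp _ _ _ (fun s : R => ((1 + s) * S + (2 * s ^+ 2 + 2 * s) * 2) / (16 * pi)) (@expR R)); last exact: continuous_expR.
      exact: ca.
    by apply: cvgD; [apply: cvgM; [exact: cvg_id|exact: cvg_cst]|exact: cvg_id].
  apply: cvge_to_ge ct _; near=> s; apply: (moser_trunc _ mOm areaOm gd hu).
  by near: s; exact: nbhs_right_gt.
have [[mu_ _ _] _ _] := hu.
pose g' (n : nat) (z : R2) := (expR (Num.min (u z) n%:R))%:E.
have mc := @cvg_monotone_convergence _ R2 R (@leb2 R) Om mOm g' _ _ _.
have -> : (\int[@leb2 R]_(z in Om) (expR (u z))%:E = \int[@leb2 R]_(z in Om) (limn (g'^~ z)))%E.
  apply: eq_integral => z _; apply/esym/cvg_lim => //.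
  apply: cvg_near_cst; near=> n; rewrite /g' min_l//.
  rewrite (le_trans (ler_norm _))//; apply: ltW; near: n; exact: nbhs_infty_gtr.
apply: cvge_to_le (mc _ _ _) _; last by near=> n; exact: trunc.
- move=> n; apply/measurable_EFinP; apply: measurableT_comp => //; exact: measurable_minr.
- by move=> n z _; rewrite lee_fin expR_ge0.
- move=> z _ m n mn; rewrite lee_fin ler_expR; apply: le_min2 => //.
  by rewrite ler_nat.
Unshelve. all: by end_near. Qed.

Lemma E8pi_ge Om delta : measurable (Om : set R2) -> leb2 Om = (pi : R)%:E -> gap_ge Om delta ->
  ((delta - 1)%:E <= E8pi Om)%E.
Proof.
move=> mOm areaOm gd; apply/ereal_infP => y [u [g1 [g2 [hu ->]]]].
have p0 := pi_gt0 R.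
(* The function 0 has gap 1. *)
have d1 : delta <= 1.
  have c1 : C1c (set0 : set (R * R)) (fun=> 0) (fun=> 0) (fun=> 0).
    by split=> // [z|z|z|x y0|x y0]; try exact: cvg_cst; exact: is_derive_cst.
  have := gd set0 _ _ _ compact0 (@sub0set _ _) c1 (fun=> lexx _).
  rewrite /gap /dirichlet.
  rewrite (@eq_Rintegral _ _ _ (@leb2 R) Om (fun=> 0)) => [|z _]; last by rewrite expr0n addr0.
  rewrite !Rintegral_cst// expR0 !mul0r mul1r.
  have -> : fine (@leb2 R Om) = pi by exact: (congr1 fine areaOm).
  by rewrite mulVf ?ln1 ?subr0 ?add0r// gt_eqF.
have hm := moser_H10 mOm areaOm gd hu.
have [_ [_ ig1 ig2] _] := hu.
have iS : (@leb2 R).-integrable Om (fun z => (g1 z ^+ 2 + g2 z ^+ 2)%:E).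
  by under eq_fun do rewrite EFinD; exact: integrableD.
have SgE : (\int[@leb2 R]_(z in Om) (g1 z ^+ 2 + g2 z ^+ 2)%:E = (fine (\int[@leb2 R]_(z in Om) (g1 z ^+ 2 + g2 z ^+ 2)%:E))%:E)%E.
  by rewrite fineK//; apply: integrable_fin_num.
rewrite /I8pi SgE; move: hm; set S := fine _ => hm.
have S0 : 0 <= S.
  by rewrite fine_ge0// integral_ge0// => z _; rewrite lee_fin addr_ge0// sqr_ge0.
have -> : fine (@leb2 R Om) = pi by exact: (congr1 fine areaOm).
have : (0 <= \int[@leb2 R]_(z in Om) (expR (u z))%:E)%E by apply: integral_ge0 => z _; rewrite lee_fin expR_ge0.
move: hm; case: (\int[_]_(_ in _) _)%E => [r| |] //.
move=> hr r0; rewrite lee_fin in hr; rewrite lee_fin in r0.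
rewrite -!EFinM /= -EFinB lee_fin.
have q0 : 0 <= (16 * pi)^-1 * S by rewrite mulr_ge0// invr_ge0 mulr_ge0// ltW.
(* Here [ln 0 = 0] by convention, so the functional is nonnegative and [delta <= 1] gives the
   bound. *)
have [->|rn] := eqVneq r 0.
  by rewrite mulr0 ln0// subr0; lra.
have rp : 0 < r by rewrite lt_neqAle eq_sym rn.
have : ln (pi^-1 * r) <= 1 - delta + S / (16 * pi).
  rewrite -[leRHS]expRK ler_ln ?posrE ?expR_gt0//; last by rewrite mulr_gt0// invr_gt0.
  by rewrite mulrC ler_pdivrMr// mulrC expRD mulrA.
by rewrite [S / _]mulrC; lra.
Qed.

End Density.

(** * Test functions on the disk *)

Section SmoothClass.
Variable R : realType.
Variable k : R.
Hypothesis k0 : 0 < k.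

(** The classical function flat at 0, times [t^-j]: the derivative of one member of the family is a
    combination of the two next ones, so the family is closed under differentiation. *)
Definition flat (j : nat) (t : R) : R := if 0 < t then t^-1 ^+ j * expR (- k * t^-1) else 0.

Lemma flat_ge0 j t : 0 <= flat j t.
Proof. by rewrite /flat; case: ifP => // t0; rewrite mulr_ge0 ?expR_ge0// exprn_ge0// invr_ge0 ltW. Qed.

(** With [n = j + 2], raise [x <= exp x] at [x = k / (n t)] to the power [n]. The two surplus
    factors [t] give derivative 0 at the origin. *)
Lemma flat_quadratic j t : flat j t <= (j.+2%:R / k) ^+ j.+2 * t ^+ 2.
Proof.
rewrite /flat; case: ifPn => [t0|_]; last first.
  by rewrite mulr_ge0 ?sqr_ge0// exprn_ge0// divr_ge0// ltW.
set n := j.+2; have n0 : 0 < n%:R :> R by rewrite ltr0n.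
have h : (n%:R / k * t)^-1 ^+ n <= expR (k * t^-1).
  have -> : expR (k * t^-1) = expR ((n%:R / k * t)^-1) ^+ n.
    by rewrite -expRM_natl; congr expR; field; rewrite !gt_eqF.
  have q0 : 0 <= (n%:R / k * t)^-1 by rewrite invr_ge0 mulr_ge0 ?divr_ge0// ltW.
  rewrite lerXn2r ?nnegrE ?expR_ge0//.
  by have := expR_ge1Dx ((n%:R / k * t)^-1); lra.
have q0 : 0 < n%:R / k * t by rewrite mulr_gt0 ?divr_gt0.
rewrite mulNr expRN.
apply: (@le_trans _ _ (t^-1 ^+ j * (n%:R / k * t) ^+ n)).
  rewrite ler_wpM2l ?exprn_ge0 ?invr_ge0 ?(ltW t0)//.
  rewrite -[leRHS]invrK lef_pV2 ?posrE ?expR_gt0//; last by rewrite invr_gt0 exprn_gt0.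
  by rewrite -exprVn.
rewrite le_eqVlt; apply/orP; left; apply/eqP; rewrite exprMn mulrCA; congr (_ * _).
by rewrite /n -addn2 exprD mulrA -exprMn mulVf ?gt_eqF// expr1n mul1r.
Qed.

Lemma is_derive_quadratic (f : R -> R) C : f 0 = 0 -> (forall t, `|f t| <= C * t ^+ 2) -> is_derive (0 : R) (1:R) f 0.
Proof.
move=> f0 fC; apply/is_derive1_caratheodory; exists (fun t => f t / t); split.
- move=> t; rewrite f0 !subr0; have [->|t0] := eqVneq t 0; first by rewrite f0 !mul0r.
  by rewrite divfK.
- apply/cvgrPdist_le => eps eps0 /=; rewrite f0 mul0r.
  have C1 : 0 < `|C| + 1 by rewrite ltr_wpDl.
  have : \forall t \near (0 : R), `|t| < eps / (`|C| + 1).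
    apply/nbhs_ballP; exists (eps / (`|C| + 1)); first by rewrite /= divr_gt0.
    by move=> t; rewrite /ball /= sub0r normrN.
  apply: filterS => t ht; rewrite sub0r normrN normrM.
  have [->|t0] := eqVneq t 0; first by rewrite f0 normr0 mul0r ltW.
  have nt : 0 < `|t| by rewrite normr_gt0.
  rewrite normfV ler_pdivrMr//; apply: (le_trans (fC t)).
  rewrite -(real_normK (num_real t)) expr2 mulrA; apply: ler_wpM2r => //.
  apply: (@le_trans _ _ ((`|C| + 1) * `|t|)).
    by apply: ler_wpM2r => //; have := ler_norm C; lra.
  by rewrite mulrC -ler_pdivlMr// ltW.
- by rewrite invr0 mulr0.
Qed.

Lemma is_derive_flat j (t : R) : is_derive t (1:R) (flat j) (- j%:R * flat j.+1 t + k * flat j.+2 t).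
Proof.
have [t0|t0|->] := ltgtP t 0.
- have -> : - j%:R * flat j.+1 t + k * flat j.+2 t = 0.
    by rewrite /flat !ifF ?mulr0 ?addr0//; apply/negbTE; rewrite -leNgt ltW.
  apply: (@near_eq_is_derive _ _ _ (fun=> 0)).
  near=> s; rewrite /flat ifF//; apply/negbTE; rewrite -leNgt ltW//; near: s.
  exact: lt_nbhsl.
- apply: (@near_eq_is_derive _ _ _ (fun s : R => s^-1 ^+ j * expR (- k * s^-1))).
  - by near=> s; rewrite /flat ifT//; near: s; exact: lt_nbhsr.
  - have tn : id t != 0 :> R by rewrite gt_eqF.
    have dV : is_derive t (1:R) (fun s => s^-1) (- t ^- 2).
      by have := @is_deriveV _ id t _ 1 tn (is_derive_id _ _); rewrite /= /GRing.scale /= mulr1.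
    have dk : is_derive t (1:R) (fun s => - k * s^-1) (k * t ^- 2).
      by apply: is_derive_eq; rewrite /GRing.scale /=; ring.
    have dE := @is_derive1_comp _ (@expR R) (fun s => - k * s^-1) t _ _ (is_derive_expR _) dk.
    rewrite /flat t0; elim: j => [|j IH].
      under eq_fun do rewrite expr0 mul1r.
      by apply: is_derive_eq; rewrite oppr0 mul0r add0r -exprVn; ring.
    have E : (fun s : R => s^-1 ^+ j.+1 * expR (- k * s^-1)) = (fun s => s^-1 * (s^-1 ^+ j * expR (- k * s^-1))).
      by apply/funext => s; rewrite exprS mulrA.
    rewrite E; apply: is_derive_eq; rewrite /GRing.scale /= -natr1 -!exprVn !exprS; ring.
- have f0 i : flat i 0 = 0 by rewrite /flat ltxx.
  rewrite !f0 !mulr0 addr0; apply: is_derive_quadratic => // s.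
  by rewrite ger0_norm ?flat_ge0//; exact: flat_quadratic.
Unshelve. all: by end_near. Qed.

Definition line (b : bool) (z : R * R) (t : R) : R * R := if b then (z.1, t) else (t, z.2).
Definition coord (b : bool) (z : R * R) : R := if b then z.2 else z.1.
Definition partial (b : bool) (f f' : R * R -> R) : Prop :=
  forall z, is_derive (coord b z) (1:R) (fun t => f (line b z t)) (f' z).

(* Closed under partial derivatives, which gives smoothness to all orders at once. *)
Inductive elementary : (R * R -> R) -> Prop :=
| elem_cst c : elementary (fun=> c)
| elem_fst : elementary fst
| elem_snd : elementary snd
| elem_add f g : elementary f -> elementary g -> elementary (fun z => f z + g z)
| elem_mul f g : elementary f -> elementary g -> elementary (fun z => f z * g z)
| elem_inv f : elementary f -> (forall z, 0 < f z) -> elementary (fun z => (f z)^-1)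
| elem_ln f : elementary f -> (forall z, 0 < f z) -> elementary (fun z => ln (f z))
| elem_flat j f : elementary f -> elementary (fun z => flat j (f z)).

Lemma line_coord b z : line b z (coord b z) = z.
Proof. by case: z b => x y []. Qed.

Lemma elementary_continuous f : elementary f -> continuous f.
Proof.
elim=> {f} [c|||f g _ cf _ cg|f g _ cf _ cg|f _ cf f0|f _ cf f0|j f _ cf] z.
- exact: cvg_cst.
- exact: cvg_fst.
- exact: cvg_snd.
- by apply: cvgD; [exact: cf|exact: cg].
- by apply: cvgM; [exact: cf|exact: cg].
- by apply: cvgV; [rewrite gt_eqF|exact: cf].
- by apply: (@continuous_comp _ _ _ f (@ln R)); [exact: cf|exact: continuous_ln].
- apply: (@continuous_comp _ _ _ f (flat j)); first exact: cf.
  exact: (is_derive_continuous (is_derive_flat j)).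
Qed.

Lemma elementary_partial f b : elementary f -> exists2 f', elementary f' & partial b f f'.
Proof.
elim=> {f} [c|||f g _ [f' ef' df] _ [g' eg' dg]|f g ef [f' ef' df] eg [g' eg' dg]|f ef [f' ef' df] f0|f ef [f' ef' df] f0|j f ef [f' ef' df]].
- by exists (fun=> 0); [exact: elem_cst|move=> z; exact: is_derive_cst].
- case: b; first by exists (fun=> 0); [exact: elem_cst|move=> z; exact: is_derive_cst].
  by exists (fun=> 1); [exact: elem_cst|move=> z; exact: is_derive_id].
- case: b; last by exists (fun=> 0); [exact: elem_cst|move=> z; exact: is_derive_cst].
  by exists (fun=> 1); [exact: elem_cst|move=> z; exact: is_derive_id].
- exists (fun z => f' z + g' z); first exact: elem_add.
  by move=> z; have d1 := df z; have d2 := dg z; apply: is_derive_eq.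
- exists (fun z => f z * g' z + f' z * g z); first by apply: elem_add; exact: elem_mul.
  move=> z; have d1 := df z; have d2 := dg z; apply: is_derive_eq.
  by rewrite /GRing.scale /= line_coord; ring.
- exists (fun z => - 1 * ((f z)^-1 * (f z)^-1) * f' z).
    by apply: elem_mul => //; apply: elem_mul; [exact: elem_cst|apply: elem_mul; exact: elem_inv].
  move=> z; have nz : (fun t => f (line b z t)) (coord b z) != 0 by rewrite line_coord gt_eqF.
  have := @is_deriveV _ (fun t => f (line b z t)) (coord b z) _ 1 nz (df z).
  move=> d; apply: is_derive_eq; rewrite line_coord /GRing.scale /= -exprVn; ring.
- exists (fun z => (f z)^-1 * f' z); first by apply: elem_mul => //; exact: elem_inv.
  move=> z; have pz : 0 < f (line b z (coord b z)) by rewrite line_coord.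
  have := @is_derive1_comp _ (@ln R) (fun t => f (line b z t)) (coord b z) _ _ (is_derive1_ln pz) (df z).
  by rewrite line_coord.
- exists (fun z => (- j%:R * flat j.+1 (f z) + k * flat j.+2 (f z)) * f' z).
    apply: elem_mul => //; apply: elem_add; apply: elem_mul; try exact: elem_cst; exact: elem_flat.
  move=> z; have := @is_derive1_comp _ (flat j) (fun t => f (line b z t)) (coord b z) _ _ (is_derive_flat j _) (df z).
  by rewrite line_coord.
Qed.

Lemma partial_is_derive b f f' z : partial b f f' -> is_derive z (edir R b) f (f' z).
Proof.
case: z => x y /(_ (x, y)); case: b => /= -[d1 d2].
  split; first by move: d1; rewrite /derivable pderiv_quotient2.
  by rewrite -d2 /derive pderiv_quotient2.
split; first by move: d1; rewrite /derivable pderiv_quotient1.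
by rewrite -d2 /derive pderiv_quotient1.
Qed.

Lemma partial_pderiv b f f' : partial b f f' -> pderiv b f = f'.
Proof.
move=> df; apply/funext => z; rewrite /pderiv.
exact: (@derive_val _ _ _ _ _ _ _ (partial_is_derive z df)).
Qed.

Lemma elementary_smooth f : elementary f -> smooth f.
Proof.
move=> ef s.
have es : elementary (pderivs s f).
  elim: s => [//|b s IH] /=; have [f' ef' df] := elementary_partial b IH.
  by rewrite (partial_pderiv df).
split; first exact: elementary_continuous.
move=> b z; have [f' _ df] := elementary_partial b es.
by have [] := partial_is_derive z df.
Qed.

End SmoothClass.

(** * Smoothly truncated bubbles *)

Section TestFunction.
Variable R : realType.
Variables (c : R * R) (e k : R).
Hypotheses (e0 : 0 < e) (k0 : 0 < k).
Local Notation R2 := (measurableTypeR R * measurableTypeR R)%type.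
Local Notation D := (disk c 1).

(** [t exp (- k / t)] for positive [t], a smooth substitute for the positive part: it loses at most
    [k] ([th_ge]) and, by [1 + x <= exp x], its slope is at most 1 ([th'_sqr]). *)
Let th t : R := t * flat k 0 t.
Let th' t : R := flat k 0 t + t * (k * flat k 2 t).

Lemma is_derive_th (t : R) : is_derive t (1:R) th (th' t).
Proof.
have d := is_derive_flat k0 0 t.
by apply: is_derive_eq; rewrite /GRing.scale /= /th'; ring.
Qed.

Lemma th_ge0 t : 0 <= th t.
Proof.
have [t0|t0] := ltP 0 t; first by rewrite mulr_ge0 ?flat_ge0// ltW.
by rewrite /th /flat ltNge t0 /= mulr0.
Qed.

Lemma th_ge t : t - k <= th t.
Proof.
have [t0|t0] := ltP 0 t; last by have := th_ge0 t; move: k0 => h; lra.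
rewrite /th /flat t0 expr0 mul1r.
have h := expR_ge1Dx (- k * t^-1).
have := ler_wpM2l (ltW t0) h; rewrite mulrDr mulr1 mulrCA mulfV ?gt_eqF// mulr1; lra.
Qed.

Lemma th'_sqr t : th' t ^+ 2 <= 1.
Proof.
have [t0|t0] := ltP 0 t; last by rewrite /th' /flat ltNge t0 /= !mulr0 addr0 expr0n ler01.
have E : th' t = (1 + k * t^-1) * (expR (k * t^-1))^-1.
  by rewrite /th' /flat t0 -expRN mulNr; field; rewrite gt_eqF.
have h := expR_ge1Dx (k * t^-1).
have x0 : 0 <= k * t^-1 by rewrite mulr_ge0 ?invr_ge0// ltW.
rewrite expr_le1//; first by rewrite E ler_pdivrMr ?expR_gt0// mul1r.
by rewrite E mulr_ge0 ?invr_ge0 ?expR_ge0//; lra.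
Qed.

Let q := dist2 c.
Let qe z : 0 < q z + e. Proof. by rewrite ltr_wpDl// dist2_ge0. Qed.
(* The bubble is lowered by [k] so that its positive part is compactly supported in the disk. *)
Definition liouville z : R := 2 * ln (1 + e) - k + (- 2) * ln (dist2 c z + e).
Definition test z : R := th (liouville z).
Definition test_grad b z : R := th' (liouville z) * (- 4 * (coord b z - coord b c) / (dist2 c z + e)).
Local Notation U := liouville.

Lemma elementary_test : elementary k test.
Proof.
have eq_ : elementary k (dist2 c).
  rewrite (_ : dist2 c = fun z => (z.1 + - c.1) * (z.1 + - c.1) + (z.2 + - c.2) * (z.2 + - c.2)).
    by apply: elem_add; apply: elem_mul; apply: elem_add; [exact: elem_fst|exact: elem_cst|exact: elem_fst|exact: elem_cst|exact: elem_snd|exact: elem_cst|exact: elem_snd|exact: elem_cst].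
  by apply/funext => z; rewrite /dist2 !expr2.
have eU : elementary k U.
  apply: elem_add; first exact: elem_cst.
  apply: elem_mul; first exact: elem_cst.
  by apply: elem_ln; [apply: elem_add => //; exact: elem_cst|exact: qe].
by apply: elem_mul => //; exact: elem_flat.
Qed.

Let smooth_test : smooth test := elementary_smooth k0 elementary_test.

Lemma test_partial b : partial b test (test_grad b).
Proof.
move=> z.
have dq : is_derive (coord b z) (1:R) (fun t => dist2 c (line b z t) + e) (2 * (coord b z - coord b c)).
  rewrite /dist2; case: b => /=.
    by apply: is_derive_eq; rewrite /GRing.scale /=; ring.
  by apply: is_derive_eq; rewrite /GRing.scale /=; ring.
have pz : 0 < (fun t => dist2 c (line b z t) + e) (coord b z) by exact: qe.
have dl := @is_derive1_comp _ (@ln R) (fun t => dist2 c (line b z t) + e) (coord b z) _ _ (is_derive1_ln pz) dq.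
have dU : is_derive (coord b z) (1:R) (fun t => U (line b z t)) (- 4 * (coord b z - coord b c) / (dist2 c z + e)).
  rewrite /liouville; apply: is_derive_eq; rewrite /GRing.scale /= line_coord; field.
  by rewrite gt_eqF// qe.
have := @is_derive1_comp _ th (fun t => U (line b z t)) (coord b z) _ _ (is_derive_th _) dU.
by rewrite line_coord.
Qed.

Let pderiv_test b : pderiv b test = test_grad b := partial_pderiv (@test_partial b).

Let K : set (R * R) := [set z | 0 <= U z].

Let U_continuous : continuous U.
Proof.
move=> z; apply: cvgD; first exact: cvg_cst.
apply: cvgM; first exact: cvg_cst.
apply: (@continuous_comp _ _ _ (fun z => dist2 c z + e) (@ln R)); last exact: continuous_ln.
by apply: cvgD; [exact: dist2_continuous|exact: cvg_cst].
Qed.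

Let KD : K `<=` D.
Proof.
move=> z; rewrite /K /= /liouville => Uz; rewrite /disk /= expr1n -/(dist2 c z).
have h : ln (dist2 c z + e) < ln (1 + e) by move: k0 => h; lra.
by move: h; rewrite ltr_ln ?posrE ?qe//; move: e0 => h; lra.
Qed.

Let compactK : compact K.
Proof.
pose X := 1 + `|c.1| + `|c.2|.
apply: (@subclosed_compact _ _ (box X)).
- rewrite (_ : K = U @^-1` `[0, +oo[%classic); last by apply/seteqP; split=> z; rewrite /= in_itv /= andbT.
  by apply: preimage_closed => [z _|]; [exact: U_continuous|exact: interval_closed].
- by apply: compact_setX; exact: segment_compact.
move=> z /KD; rewrite /disk /= expr1n => zD.
have h1 : `|z.1 - c.1| <= 1.
  by rewrite -ler_sqr ?nnegrE// expr1n real_normK ?num_real//; have := sqr_ge0 (z.2 - c.2); lra.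
have h2 : `|z.2 - c.2| <= 1.
  by rewrite -ler_sqr ?nnegrE// expr1n real_normK ?num_real//; have := sqr_ge0 (z.1 - c.1); lra.
have n1 := normr_ge0 c.1; have n2 := normr_ge0 c.2.
split; rewrite /seg /= in_itv /= -ler_norml /X.
  by have := ler_normD (z.1 - c.1) c.1; rewrite subrK; lra.
by have := ler_normD (z.2 - c.2) c.2; rewrite subrK; lra.
Qed.

Let test_off z : ~ K z -> test z = 0.
Proof.
move=> /negP; rewrite -ltNge => h.
by rewrite /test /th /flat ifF ?mulr0//; apply/negbTE; rewrite -leNgt ltW.
Qed.

Lemma Cc_inf_test : Cc_inf D test.
Proof. by split=> //; exists K; split. Qed.

Let mD : measurable (D : set R2) := measurable_disk c 1.
Let finD : (@leb2 R D < +oo)%E. Proof. by rewrite disk_area ltry. Qed.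

Let bm_test : bm (T := R2) D test := bm_continuous_supported compactK D (smooth_test [::]).1 test_off.
Let clK := compact_closed2 compactK.
Let bm_grad b : bm (T := R2) D (test_grad b).
Proof.
have D1 x y := pderiv_is_derive1 ((smooth_test [::]).2 false (x, y)).
have D2 x y := pderiv_is_derive2 ((smooth_test [::]).2 true (x, y)).
rewrite -pderiv_test; case: b.
  exact: (bm_continuous_supported compactK D (smooth_test [:: true]).1 (deriv2_off_support clK D2 test_off)).
exact: (bm_continuous_supported compactK D (smooth_test [:: false]).1 (deriv1_off_support clK D1 test_off)).
Qed.

Lemma H10_test : H10 D test (test_grad false) (test_grad true).
Proof.
have mb f : bm (T := R2) D f -> measurable_fun D f by move=> [m _]; exact: measurable_funTS.
have ib f : bm (T := R2) D f -> (@leb2 R).-integrable D (fun z => (f z ^+ 2)%:E).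
  by move=> bf; apply: (@bm_integrable _ R2 R (@leb2 R) D mD finD); exact: bmX.
split.
- by split; apply: mb; [exact: bm_test|exact: bm_grad|exact: bm_grad].
- by split; apply: ib; [exact: bm_test|exact: bm_grad|exact: bm_grad].
exists (fun=> test); split; first by move=> _; exact: Cc_inf_test.
have L0 f : (fun=> L2dist2 D f f) n @[n --> \oo] --> (0%E : \bar R).
  rewrite (_ : (fun=> _) = fun=> 0%E); first exact: cvg_cst.
  apply/funext => _; apply: integral0_eq => z _; by rewrite subrr expr0n.
by rewrite !pderiv_test; split; exact: L0.
Qed.

Lemma radial_value (f F : R -> R) : (forall s, 0 <= s -> 0 <= f s) -> (forall s, 0 <= s -> {for s, continuous f}) ->
  (forall s : R, 0 <= s -> is_derive s (1:R) F (f s)) ->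
  (\int[@leb2 R]_(z in D) (f (dist2 c z))%:E = (pi * (F 1 - F 0))%:E)%E.
Proof.
(* The functions to be integrated have a pole at [-e]; freezing them at negative arguments gives a
   continuous function on the line with the same values on squared distances. *)
move=> f0 cf dF; pose h s := f (Num.max 0 s).
have m0 (s : R) : 0 <= Num.max 0 s by rewrite le_max lexx.
have ch : continuous h.
  move=> s; apply: (@continuous_comp _ _ _ (fun s : R => Num.max 0 s) f); last exact: cf.
  by apply: (@continuous_max R _ (fun=> 0) id); [exact: cvg_cst|exact: cvg_id].
have mh : measurable_fun setT h by exact: continuous_measurable_fun.
have mu1 : (@lebesgue_measure R `[0%R, 1%R]%classic < +oo)%E.
  by rewrite lebesgue_measure_itv /= lte_fin ltr01 -EFinD ltry.
have := radial_integral c mh (fun s => f0 _ (m0 s)).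
have -> : (\int[@leb2 R]_(z in D) (h (dist2 c z))%:E = \int[@leb2 R]_(z in D) (f (dist2 c z))%:E)%E.
  by apply: eq_integral => z _; rewrite /h max_r// dist2_ge0.
move=> ->; rewrite EFinM; congr (_ * _)%E.
have bh : bm (T := measurableTypeR R) `[0%R, 1%R]%classic h.
  split=> //; have [B [_ HB]] := compact_bounded (continuous_compact (continuous_subspaceT ch) (@segment_compact _ 0 1)).
  by exists (B + 1) => x Dx; apply: (HB (B + 1)); [lra|exists x].
rewrite (@bm_intE _ (measurableTypeR R) R (@lebesgue_measure R) `[0%R, 1%R]%classic (measurable_itv _) mu1)//.
have cf1 (s : R) : 0 <= s <= 1 -> {for s, continuous f} by move=> /andP[s0 _]; exact: cf.
have dF1 (s : R) : 0 <= s <= 1 -> is_derive s (1:R) F (f s) by move=> /andP[s0 _]; exact: dF.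
congr EFin; rewrite -(FTC2in ler01 cf1 dF1).
by apply: eq_Rintegral => s; rewrite inE /= in_itv /= => /andP[s0 _]; rewrite /h max_r.
Qed.

Local Notation L := (ln (1 + e) - ln e).

(** The untruncated bubble has normalised energy [L - 1/(1+e)] and mean exponential [(1+e)/e], hence
    value [- 1/(1+e)]. The slope bound on [th] keeps the energy from growing; lowering the bubble by
    [k] and then applying [th] cost [k] each in the logarithm. *)
Lemma E8pi_disk_le_test : (E8pi D <= (2 * k - 1 / (1 + e))%:E)%E.
Proof.
have p0 := pi_gt0 R; move: e0 k0 => he hk.
have e1 : 0 < 1 + e by lra.
have se s : 0 <= s -> 0 < s + e :> R by move=> h; lra.
have did (s : R) : is_derive s (1:R) (fun t => t + e) 1.
  by apply: is_derive_eq; rewrite addr0.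
have dln (s : R) : 0 <= s -> is_derive s (1:R) (fun t => ln (t + e)) (s + e)^-1.
  move=> s0; have := @is_derive1_comp _ (@ln R) (fun t => t + e) s _ _ (is_derive1_ln (se s s0)) (did s).
  by rewrite mulr1.
have dV (s : R) : 0 <= s -> is_derive s (1:R) (fun t => (t + e)^-1) (- (s + e) ^- 2).
  move=> s0; have nz : (fun t => t + e) s != 0 by rewrite gt_eqF// se.
  by have := @is_deriveV _ (fun t => t + e) s _ 1 nz (did s); rewrite /GRing.scale /= mulr1.
have cV (s : R) : 0 <= s -> {for s, continuous (fun t : R => (t + e)^-1)}.
  move=> s0; apply: cvgV; first by rewrite gt_eqF// se.
  by apply: cvgD; [exact: cvg_id|exact: cvg_cst].
have IA : (\int[@leb2 R]_(z in D) (16 * dist2 c z * ((dist2 c z + e)^-1 * (dist2 c z + e)^-1))%:E = (pi * (16 * (L - 1 / (1 + e))))%:E)%E.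
  pose f s : R := 16 * s * ((s + e)^-1 * (s + e)^-1).
  pose F s : R := 16 * (ln (s + e) + e * (s + e)^-1).
  have f0 s : 0 <= s -> 0 <= f s by move=> s0; rewrite !mulr_ge0 ?invr_ge0// ltW// se.
  have cf s : 0 <= s -> {for s, continuous f}.
    move=> s0; apply: cvgM; last by apply: cvgM; exact: cV.
    by apply: cvgM; [exact: cvg_cst|exact: cvg_id].
  have dF (s : R) : 0 <= s -> is_derive s (1:R) F (f s).
    move=> s0; have d1 := dln s s0; have d2 := dV s s0; rewrite /F /f.
    apply: is_derive_eq; rewrite /GRing.scale /=; field.
    by rewrite gt_eqF// se.
  have := radial_value f0 cf dF; rewrite /f /F add0r mulfV ?gt_eqF// => ->.
  by congr (_ * _)%:E; field; rewrite gt_eqF.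
have IB : (\int[@leb2 R]_(z in D) (expR (- (2 * k)) * (1 + e) ^+ 2 * ((dist2 c z + e)^-1 * (dist2 c z + e)^-1))%:E = (pi * (expR (- (2 * k)) * ((1 + e) / e)))%:E)%E.
  pose f s : R := expR (- (2 * k)) * (1 + e) ^+ 2 * ((s + e)^-1 * (s + e)^-1).
  pose F s : R := - (expR (- (2 * k)) * (1 + e) ^+ 2) * (s + e)^-1.
  have f0 s : 0 <= s -> 0 <= f s by move=> s0; rewrite !mulr_ge0 ?invr_ge0 ?expR_ge0 ?sqr_ge0// ltW// se.
  have cf s : 0 <= s -> {for s, continuous f}.
    by move=> s0; apply: cvgM; [exact: cvg_cst|apply: cvgM; exact: cV].
  have dF (s : R) : 0 <= s -> is_derive s (1:R) F (f s).
    move=> s0; have d2 := dV s s0; rewrite /F /f.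
    apply: is_derive_eq; rewrite /GRing.scale /=; field.
    by rewrite gt_eqF// se.
  have := radial_value f0 cf dF; rewrite /f /F add0r => ->.
  by congr (_ * _)%:E; field; rewrite !gt_eqF.
have mq : measurable_fun D (fun z : R2 => (dist2 c z + e)^-1).
  apply: measurable_funTS; apply: continuous_measurable2 => z.
  apply: cvgV; first by rewrite gt_eqF// qe.
  by apply: cvgD; [exact: dist2_continuous|exact: cvg_cst].
have mdist : measurable_fun D (fun z : R2 => dist2 c z).
  by apply: measurable_funTS; exact: measurable_dist2.
have gE z : test_grad false z ^+ 2 + test_grad true z ^+ 2 = th' (U z) ^+ 2 * (16 * dist2 c z * ((dist2 c z + e)^-1 * (dist2 c z + e)^-1)).
  by rewrite /test_grad /dist2 /coord; field; rewrite gt_eqF//; exact: qe.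
have A_le : (\int[@leb2 R]_(z in D) (test_grad false z ^+ 2 + test_grad true z ^+ 2)%:E <= (pi * (16 * (L - 1 / (1 + e))))%:E)%E.
  rewrite -IA; apply: ge0_le_integral => //.
  - by move=> z _; rewrite lee_fin addr_ge0// sqr_ge0.
  - apply/measurable_EFinP; apply: measurable_funTS.
    have [m _] : bm (T := R2) D (fun z => test_grad false z ^+ 2 + test_grad true z ^+ 2).
      by apply: bmD; apply: bmX; exact: bm_grad.
    exact: m.
  - by apply/measurable_EFinP; apply: measurable_funM; [apply: measurable_funM|apply: measurable_funM].
  - move=> z _; rewrite lee_fin gE ler_piMl ?th'_sqr//.
    by rewrite !mulr_ge0 ?dist2_ge0 ?invr_ge0// ltW// qe.
have bexp : bm (T := R2) D (fun z => expR (test z)).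
  have [C HC] := compact_support_bounded compactK (smooth_test [::]).1 test_off; split.
    apply: continuous_measurable2 => z.
    by apply: (@continuous_comp _ _ _ test (@expR R)); [exact: (smooth_test [::]).1|exact: continuous_expR].
  exists (expR C) => z _; rewrite ger0_norm ?expR_ge0// ler_expR.
  exact: le_trans (ler_norm _) (HC z).
have B_ge : (pi * (expR (- (2 * k)) * ((1 + e) / e))) <= \int[@leb2 R]_(z in D) expR (test z).
  rewrite -lee_fin -(@bm_intE _ R2 R (@leb2 R) D mD finD)// -IB; apply: ge0_le_integral => //.
  - by move=> z _; rewrite lee_fin !mulr_ge0 ?invr_ge0 ?expR_ge0 ?sqr_ge0// ltW// qe.
  - by apply/measurable_EFinP; apply: measurable_funM => //; apply: measurable_funM.
  - by apply/measurable_EFinP; apply: measurable_funTS; have [m _] := bexp; exact: m.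
  - move=> z _; rewrite lee_fin; apply: (@le_trans _ _ (expR (U z - k))); last by rewrite ler_expR th_ge.
    have qz := qe z; rewrite -/(q z).
    have -> : U z - k = - (2 * k) + (ln (1 + e) + ln (1 + e)) + - (ln (q z + e) + ln (q z + e)) by rewrite /liouville; ring.
    rewrite !expRD [expR (- (ln _ + _))]expRN !expRD !lnK ?posrE// le_eqVlt; apply/orP; left; apply/eqP.
    by field; rewrite gt_eqF.
apply: ge_ereal_inf; exists (I8pi D test (test_grad false) (test_grad true)).
  by exists test, (test_grad false), (test_grad true); split=> //; exact: H10_test.
rewrite /I8pi (@bm_intE _ R2 R (@leb2 R) D mD finD _ bexp).
have -> : fine (@leb2 R D) = pi by exact: (congr1 fine (disk_area c)).
have bA : bm (T := R2) D (fun z => test_grad false z ^+ 2 + test_grad true z ^+ 2) by apply: bmD; apply: bmX; exact: bm_grad.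
have AE := @bm_intE _ R2 R (@leb2 R) D mD finD _ bA.
rewrite AE lee_fin in A_le; rewrite AE.
move: A_le B_ge; move: (Rintegral _ _ _) (Rintegral _ _ _) => IB' IA' A_le B_ge.
rewrite -!EFinM /= -EFinB lee_fin.
have h1 : (16 * pi)^-1 * IA' <= L - 1 / (1 + e).
  rewrite mulrC ler_pdivrMr ?mulr_gt0//; apply: le_trans A_le _.
  by rewrite le_eqVlt; apply/orP; left; apply/eqP; move: (pi : R) => p; ring.
have w0 : 0 < expR (- (2 * k)) * ((1 + e) / e) by rewrite mulr_gt0 ?expR_gt0 ?divr_gt0.
have h2 : - (2 * k) + L <= ln (pi^-1 * IB').
  have -> : - (2 * k) + L = ln (expR (- (2 * k)) * ((1 + e) / e)).
    by rewrite lnM ?posrE ?expR_gt0 ?divr_gt0// expRK ln_div ?posrE.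
  have hh : expR (- (2 * k)) * ((1 + e) / e) <= pi^-1 * IB' by rewrite [pi^-1 * _]mulrC ler_pdivlMr// mulrC.
  by rewrite ler_ln ?posrE// (lt_le_trans w0).
lra.
Qed.

End TestFunction.

(** * The value on the disk and the comparison *)

Section Disk.
Variable R : realType.

Lemma E8pi_disk_le (c : R * R) : (E8pi (disk c 1) <= (-1)%:E)%E.
Proof.
apply/lee_addgt0Pr => eps eps0.
have e0 : 0 < eps / 2 by lra.
have k0 : 0 < eps / 4 by lra.
apply: le_trans (E8pi_disk_le_test c e0 k0) _; rewrite -EFinD lee_fin.
have h : 1 - eps / 2 <= 1 / (1 + eps / 2).
  by rewrite ler_pdivlMr; [nra|lra].
lra.
Qed.

End Disk.

Lemma E8pi_disk (R : realType) (c : R * R) : E8pi (disk c 1) = (-1)%:E.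
Proof.
apply/eqP; rewrite eq_le E8pi_disk_le /=.
pose rho z := dist2 c z - 1.
have crho : continuous rho by move=> z; apply: cvgB; [exact: dist2_continuous|exact: cvg_cst].
have DE : disk c 1 = [set z | rho z < 0].
  by apply/seteqP; split=> z; rewrite /disk /rho /= subr_lt0 expr1n.
pose X := 2 + `|c.1| + `|c.2|.
have n1 := normr_ge0 c.1; have n2 := normr_ge0 c.2.
have X0 : 0 < X by rewrite /X; lra.
have DX z : disk c 1 z -> (- X < z.1 < X) && (- X < z.2 < X).
  rewrite /disk /= expr1n => zD.
  have h1 : `|z.1 - c.1| <= 1.
    by rewrite -ler_sqr ?nnegrE// expr1n real_normK ?num_real//; have := sqr_ge0 (z.2 - c.2); lra.
  have h2 : `|z.2 - c.2| <= 1.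
    by rewrite -ler_sqr ?nnegrE// expr1n real_normK ?num_real//; have := sqr_ge0 (z.1 - c.1); lra.
  rewrite -!ltr_norml /X; apply/andP; split.
    by have := ler_normD (z.1 - c.1) c.1; rewrite subrK; lra.
  by have := ler_normD (z.2 - c.2) c.2; rewrite subrK; lra.
have g0 : gap_ge (disk c 1) 0.
  move=> K u u1 u2 cK KD c1 u0; move: KD DX (disk_area c); rewrite DE => KD DX areaD.
  by have [] := gap_stability X0 crho DX areaD cK KD c1 u0.
by have := E8pi_ge (measurable_disk c 1) (disk_area c) g0; rewrite sub0r.
Qed.

(** A uniform gap [delta > 0] would place the infimum at [delta - 1] or higher, so equality leaves
    only the disk alternative. The centre is free because the functional is translation invariant:
    every unit disk has the value -1. *)
Theorem theorem1 (R : realType) (Om : set (R * R)) :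
  smooth_bounded_domain Om -> @leb2 R Om = (pi : R)%:E ->
  ((E8pi (disk (0%R, 0%R) 1%R) <= E8pi Om)%E /\
   (E8pi Om = E8pi (disk (0%R, 0%R) 1%R) <-> exists c : R * R, Om = disk c 1%R)).
Proof.
move=> [oOm _ _ [M OmM] [rho [srho OmE grad]]] areaOm.
pose X := `|M| + 1.
have X0 : 0 < X by rewrite /X; have := normr_ge0 M; lra.
have OmX z : Om z -> (- X < z.1 < X) && (- X < z.2 < X).
  move=> /OmM; rewrite /disk /= !subr0 -!ltr_norml -(real_normK (num_real M)) => h.
  have aux (x y : R) : x ^+ 2 + y ^+ 2 < `|M| ^+ 2 -> `|x| < X.
    move=> hxy; apply: (@lt_trans _ _ `|M|); last by rewrite /X; lra.
    by rewrite -ltr_sqr ?nnegrE// real_normK ?num_real//; have := sqr_ge0 y; lra.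
  by apply/andP; split; [exact: aux h|rewrite addrC in h; exact: aux h].
have mOm := open_measurable2 oOm.
rewrite E8pi_disk.
have [g0 rigid] : gap_ge Om 0 /\ ((exists c, Om = disk c 1) \/ exists2 delta, 0 < delta & gap_ge Om delta).
  by move: OmX areaOm; rewrite OmE => OmX areaOm; exact: (gap_rigidity X0 srho grad OmX areaOm).
split; first by have := E8pi_ge mOm areaOm g0; rewrite sub0r.
split=> [E|[c ->]]; last exact: E8pi_disk.
case: rigid => // -[delta d0 gd]; have := E8pi_ge mOm areaOm gd.
rewrite E lee_fin => h.
have : delta <= 0 by rewrite -(lerD2r (-1)) add0r.
by rewrite leNgt d0.
Qed.
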